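(* Let $a,b$, $\alpha_1,\alpha_2,p_1,p_2$, $\beta_1,\beta_2,q_1,q_2$, $\lambda_1,\lambda_2$, $\mu_i,\nu_i,\eta_i$ ($1\le i\le n$), $\omega_j,\sigma_j,\xi_j$ ($1\le j\le m$) be parameters satisfying the standing assumptions listed in the context (in particular $\Lambda\neq 0$), and let $X_1,X_2,Y_1,Y_2,F_1,F_2,G_1,G_2$ be the constants defined in the context. Let $f,g:[a,b]\times\mathbb{R}\times\mathbb{R}\to\mathbb{R}$ be continuous functions, and suppose there exist real constants $M_i,\overline{M}_i\ge 0$, $i=1,2,3$, such that for all $t\in[a,b]$ and $x,y\in\mathbb{R}$ $$|f(t,x,y)|\le M_1+M_2|x|+M_3|y|,\qquad |g(t,x,y)|\le \overline{M}_1+\overline{M}_2|x|+\overline{M}_3|y|.$$ If $$(F_1+F_2)M_2+(G_1+G_2)\overline{M}_2+(X_1+X_2)<1$$ and $$(F_1+F_2)M_3+(G_1+G_2)\overline{M}_3+(Y_1+Y_2)<1,$$ then the coupled system $$\begin{cases}{}^{H}D^{\alpha_1,\beta_1}\big({}^{H}D^{\alpha_2,\beta_2}+\lambda_1\big)x(t)=f(t,x(t),y(t)), & t\in[a,b],\\ {}^{H}D^{p_1,q_1}\big({}^{H}D^{p_2,q_2}+\lambda_2\big)y(t)=g(t,x(t),y(t)), & t\in[a,b],\\ x(a)=0,\quad x(b)=\sum_{i=1}^{n}\mu_i\,(I^{\nu_i}y)(\eta_i),\\ y(a)=0,\quad y(b)=\sum_{j=1}^{m}\omega_j\,(I^{\sigma_j}x)(\xi_j)\end{cases}$$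 has at least one solution on $[a,b]$.
   Context: Fractional operators. For $\alpha>0$, $(I^{\alpha}f)(t)=\frac{1}{\Gamma(\alpha)}\int_a^t(t-s)^{\alpha-1}f(s)\,ds$ is the Riemann–Liouville fractional integral with base point $a$. For $0<\alpha<1$ and $0\le\beta\le1$ the Hilfer fractional derivative of order $\alpha$ and parameter $\beta$ is defined by ${}^{H}D^{\alpha,\beta}v(t)=I^{\beta(1-\alpha)}\,D\,I^{(1-\beta)(1-\alpha)}v(t)$, $t>a$, where $D=\frac{d}{dt}$. Standing assumptions. $0\le a<b$; $n,m$ are positive integers; $0<\alpha_i,p_i<1$ and $0<\beta_i,q_i<1$ for $i=1,2$; $1<\alpha_1+\alpha_2\le 2$, $1<p_1+p_2\le2$; $\lambda_1,\lambda_2\in\mathbb{R}$; $\mu_i,\omega_j\in\mathbb{R}$; $\nu_i,\sigma_j>0$; $\eta_i,\xi_j\in[a,b]$. Put $\gamma_1=\alpha_1+\beta_1-\alpha_1\beta_1$, $\delta_1=p_1+q_1-p_1q_1$, $$\Phi_1=\frac{(b-a)^{\gamma_1+\alpha_2-1}}{\Gamma(\gamma_1+\alpha_2)},\quad \Phi_2=\sum_{i=1}^n\mu_i\frac{(\eta_i-a)^{\delta_1+p_2+\nu_i-1}}{\Gamma(\delta_1+p_2+\nu_i)},\quad \Phi_3=\sum_{j=1}^m\omega_j\frac{(\xi_j-a)^{\gamma_1+\alpha_2+\sigma_j-1}}{\Gamma(\gamma_1+\alpha_2+\sigma_j)},\quad \Phi_4=\frac{(b-a)^{\delta_1+p_2-1}}{\Gamma(\delta_1+p_2)},$$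 and assume $\Lambda=\Phi_1\Phi_4-\Phi_2\Phi_3\ne0$. Constants. Write $P=\frac{(b-a)^{\gamma_1+\alpha_2-1}}{|\Lambda|\Gamma(\gamma_1+\alpha_2)}$ and $Q=\frac{(b-a)^{\delta_1+p_2-1}}{|\Lambda|\Gamma(\delta_1+p_2)}$. Then $$X_1=|\lambda_1|\Big\{\frac{(b-a)^{\alpha_2}}{\Gamma(\alpha_2+1)}+P\Big[|\Phi_4|\frac{(b-a)^{\alpha_2}}{\Gamma(\alpha_2+1)}+|\Phi_2|\sum_{j=1}^m|\omega_j|\frac{(\xi_j-a)^{\alpha_2+\sigma_j}}{\Gamma(\alpha_2+\sigma_j+1)}\Big]\Big\},$$ $$Y_1=|\lambda_2|P\Big[|\Phi_4|\sum_{i=1}^n|\mu_i|\frac{(\eta_i-a)^{p_2+\nu_i}}{\Gamma(p_2+\nu_i+1)}+|\Phi_2|\frac{(b-a)^{p_2}}{\Gamma(p_2+1)}\Big],$$ $$F_1=\frac{(b-a)^{\alpha_1+\alpha_2}}{\Gamma(\alpha_1+\alpha_2+1)}\big(1+P|\Phi_4|\big)+P|\Phi_2|\sum_{j=1}^m|\omega_j|\frac{(\xi_j-a)^{\alpha_1+\alpha_2+\sigma_j}}{\Gamma(\alpha_1+\alpha_2+\sigma_j+1)},$$ $$G_1=P\Big(|\Phi_4|\sum_{i=1}^n|\mu_i|\frac{(\eta_i-a)^{p_1+p_2+\nu_i}}{\Gamma(p_1+p_2+\nu_i+1)}+|\Phi_2|\frac{(b-a)^{p_1+p_2}}{\Gamma(p_1+p_2+1)}\Big),$$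 $$X_2=|\lambda_1|Q\Big[|\Phi_1|\sum_{j=1}^m|\omega_j|\frac{(\xi_j-a)^{\alpha_2+\sigma_j}}{\Gamma(\alpha_2+\sigma_j+1)}+|\Phi_3|\frac{(b-a)^{\alpha_2}}{\Gamma(\alpha_2+1)}\Big],$$ $$Y_2=|\lambda_2|\Big\{\frac{(b-a)^{p_2}}{\Gamma(p_2+1)}+Q\Big[|\Phi_1|\frac{(b-a)^{p_2}}{\Gamma(p_2+1)}+|\Phi_3|\sum_{i=1}^n|\mu_i|\frac{(\eta_i-a)^{p_2+\nu_i}}{\Gamma(p_2+\nu_i+1)}\Big]\Big\},$$ $$F_2=Q\Big(|\Phi_1|\sum_{j=1}^m|\omega_j|\frac{(\xi_j-a)^{\alpha_1+\alpha_2+\sigma_j}}{\Gamma(\alpha_1+\alpha_2+\sigma_j+1)}+|\Phi_3|\frac{(b-a)^{\alpha_1+\alpha_2}}{\Gamma(\alpha_1+\alpha_2+1)}\Big),$$ $$G_2=\frac{(b-a)^{p_1+p_2}}{\Gamma(p_1+p_2+1)}\big(1+Q|\Phi_1|\big)+Q|\Phi_3|\sum_{i=1}^n|\mu_i|\frac{(\eta_i-a)^{p_1+p_2+\nu_i}}{\Gamma(p_1+p_2+\nu_i+1)}.$$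
   Formalization: The Hilfer derivative I^{β(1-α)} D V, V = I^{(1-β)(1-α)}v, is read as D I^{β(1-α)}(V − V(a+)) on (a,b], equal to it when V is absolutely continuous; if D V must be an integrable function, the claim fails, e.g. for f(t,x,y)=W(t), a Weierstrass function. *)

(* Defs.v *)
From HB Require Import structures.
From mathcomp Require Import all_boot all_order all_algebra.
From mathcomp Require Import all_classical all_reals all_analysis.
From mathcomp Require Import measurable_realfun lra.
Set Implicit Arguments.
Unset Strict Implicit.
Unset Printing Implicit Defensive.
Import Order.TTheory GRing.Theory Num.Theory.
Import numFieldNormedType.Exports.
Local Open Scope classical_set_scope.
Local Open Scope ring_scope.

Section FractionalCalculus.
Variable R : realType.
Local Notation mu := (@lebesgue_measure R).
Implicit Types (a b s alpha beta l t : R) (v w V : R -> R).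

(* Euler's integral; only used at positive arguments, where it converges. *)
Definition Gamma (z : R) : R :=
  \int[mu]_(t in `]0, +oo[) (t `^ (z - 1) * expR (- t)).

(* The integrand at s = t is irrelevant: it is a null set. *)
Definition RLkernel alpha v t : R -> R :=
  fun s => (t - s) `^ (alpha - 1) * v s.

(* Riemann-Liouville fractional integral of order alpha > 0, base point a. *)
Definition RLint a alpha v : R -> R :=
  fun t => (Gamma alpha)^-1 * \int[mu]_(s in `[a, t]) RLkernel alpha v t s.

(* [Rintegral] is total; this says that the integral (I^alpha v)(t) exists. *)
Definition RLint_exists a alpha v t : Prop :=
  mu.-integrable `[a, t] (EFin \o RLkernel alpha v t).

(* The derivative of V at t relative to A: two-sided at interior points of A,
   one-sided at an endpoint belonging to A. *)
Definition has_deriv_within (A : set R) V t l : Prop :=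
  (V u - V t) / (u - t) @[u --> within A t^'] --> l.

(* I^s D V = w on ]a, b], for s > 0. The composite I^s D is taken in the form
   in which the Caputo derivative (of order 1 - s) is usually defined,
       I^s D V = D I^s (V - V(a+)),
   both sides being equal when V is absolutely continuous
   (see [fracD_abs_continuous] below). The right-hand side makes sense without
   an integrable D V: for a V of the form c + I^(1-s) h with h merely
   continuous, D V need not exist as a function, although I^s D V = h. *)
Definition is_fracD a b s V w : Prop :=
  exists V0 : R, V t @[t --> a^'+] --> V0 /\
  forall t, t \in `]a, b] ->
    RLint_exists a s (fun r => V r - V0) t /\
    has_deriv_within `]a, b] (RLint a s (fun r => V r - V0)) t (w t).

(* w is the Hilfer derivative I^(beta(1-alpha)) D I^((1-beta)(1-alpha)) v
   on ]a, b], for 0 < alpha, beta < 1 (so that both integrals have positive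
   order). *)
Definition is_Hilfer a b alpha beta v w : Prop :=
  (forall t, t \in `]a, b] -> RLint_exists a ((1 - beta) * (1 - alpha)) v t) /\
  is_fracD a b (beta * (1 - alpha)) (RLint a ((1 - beta) * (1 - alpha)) v) w.

End FractionalCalculus.

Module FracD.
Section FracDAbsContinuous.
Variable R : realType.
Local Notation mu := (@lebesgue_measure R).

Lemma ge0_FTC2_oo (f F : R -> R) (r t : R) : r < t ->
  (forall x, x \in `]r, t[ -> 0 <= f x) ->
  {in `]r, t[, continuous f} ->
  derivable_oo_LRcontinuous F r t ->
  {in `]r, t[, derive1 F =1 f} ->
  (\int[mu]_(x in `[r, t]) (f x)%:E = (F t - F r)%:E)%E.
Proof.
move=> rt f0 cf [dF Fr Ft] F'f.
pose h (n : nat) : R := (t - r) / n.+3%:R.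
have h0 n : 0 < h n by rewrite divr_gt0 ?subr_gt0.
have hS n : h n.+1 <= h n.
  by rewrite ler_pM2l ?subr_gt0// lef_pV2 ?posrE// ler_nat.
have h3 n : h n + h n < t - r.
  rewrite -mulrDr gtr_pMr ?subr_gt0// -mulr2n -(mulr_natl _ 2) ltr_pdivrMr//.
  by rewrite mul1r ltr_nat.
have hcvg : h n @[n --> \oo] --> (0 : R).
  rewrite -[X in _ --> X](mulr0 (t - r)); apply: cvgMr.
  have := @cvg_harmonic R; rewrite -(cvg_shiftn 2)/= /harmonic.
  by under eq_fun do rewrite addn2.
pose A n : set R := [set` `[r + h n, t - h n]].
have Aoo n : A n `<=` [set` `]r, t[].
  by move=> x; rewrite /A/= !in_itv/= => /andP[? ?]; have := h0 n; lra.
have Acc n x : x \in `[r + h n, t - h n] -> x \in `]r, t[.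
  by move=> xA; have := Aoo n x; rewrite /=; apply.
have UA : \bigcup_n A n = [set` `]r, t[].
  apply/seteqP; split=> [x [n _ /Aoo//]|x /=]; rewrite in_itv/= => /andP[rx xt].
  have : \forall n \near \oo, h n < Num.min (x - r) (t - x).
    by apply: (cvgr_lt (0:R)) => //; rewrite lt_min !subr_gt0 rx.
  move=> [n _ /(_ n (leqnn _))]; rewrite /= lt_min => /andP[? ?].
  by exists n => //; rewrite /A/= in_itv/=; lra.
have nA : nondecreasing_seq A.
  apply/nondecreasing_seqP => n; apply/subsetPset => x.
  by rewrite /A/= !in_itv/= => /andP[? ?]; have := hS n; lra.
have cA n : {within A n, continuous f}.
  by apply: continuous_in_subspaceT => x /set_mem xA; apply: cf; exact: Aoo xA.
have IA n : (\int[mu]_(x in A n) (f x)%:E = (F (t - h n) - F (r + h n))%:E)%E.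
  rewrite EFinB; apply: continuous_FTC2.
  - by have := h3 n; lra.
  - exact: cA.
  - have rin : r + h n \in `]r, t[ by rewrite in_itv/=; have := h0 n; have := h3 n; lra.
    have tin : t - h n \in `]r, t[ by rewrite in_itv/=; have := h0 n; have := h3 n; lra.
    have cF y : y \in `]r, t[ -> {for y, continuous F}.
      by move=> yrt; apply/differentiable_continuous/derivable1_diffP; exact: dF.
    split.
    + move=> x xA; apply: dF; apply: (Acc n); exact: subset_itv_oo_cc xA.
    + by apply: cvg_at_right_filter; exact: cF.
    + by apply: cvg_at_left_filter; exact: cF.
  - by move=> x xA; apply: F'f; apply: (Acc n); exact: subset_itv_oo_cc xA.
have mA n : measurable (A n) by exact: measurable_itv.
have mfA n : measurable_fun (A n) f by exact: subspace_continuous_measurable_fun.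
have lim1 : (\int[mu]_(x in A n) (f x)%:E)%E @[n --> \oo] -->
            (\int[mu]_(x in \bigcup_n A n) (f x)%:E)%E.
  apply: ge0_nondecreasing_set_cvg_integral => // [i|i x /Aoo xA].
    by apply/measurable_EFinP; exact: mfA.
  by rewrite lee_fin; exact: f0.
move: lim1; rewrite UA => lim1.
have mf : measurable_fun [set` `]r, t[] f.
  by rewrite -UA; apply/measurable_fun_bigcup.
rewrite integral_itv_bndoo; last exact/measurable_EFinP.
have lim2 : (\int[mu]_(x in A n) (f x)%:E)%E @[n --> \oo] --> (F t - F r)%:E.
  rewrite (_ : (fun n => _) = EFin \o (fun n => F (t - h n) - F (r + h n))); last first.
    by apply/funext => n /=; rewrite -IA.
  apply: cvg_EFin; first exact: nearW.
  apply: cvgB.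
  - move/cvg_at_leftP: Ft; apply; split=> [n|]; first by have := h0 n; lra.
    by rewrite -[X in _ --> X]subr0; apply: cvgB => //; exact: cvg_cst.
  - move/cvg_at_rightP: Fr; apply; split=> [n|]; first by have := h0 n; lra.
    by rewrite -[X in _ --> X]addr0; apply: cvgD => //; exact: cvg_cst.
exact: (cvg_unique _ lim1 lim2).
Qed.

Lemma is_derive_powl (s r x : R) : 0 < s -> r < x ->
  is_derive x 1 (fun y : R => (y - r) `^ s / s) ((x - r) `^ (s - 1)).
Proof.
move=> s0 rx.
have H := @is_derive1_powR R s (x - r).
have x0 : 0 < x - r by rewrite subr_gt0.
move: H => /(_ x0) H.
have D : is_derive x 1 (fun y : R => y - r) 1.
  by apply: is_derive_eq; rewrite subr0.
have D2 := @is_derive1_comp R (fun z => z `^ s) (fun y => y - r) x _ _ H D.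
have -> : (fun y : R => (y - r) `^ s / s) = s^-1 *: ((fun z => z `^ s) \o (fun y => y - r)).
  by apply/funext => y /=; rewrite mulrC.
apply: is_derive_eq.
by rewrite mulr1 /GRing.scale/= mulrA mulVf ?mul1r// gt_eqF.
Qed.

Lemma is_derive_powr (s t x : R) : 0 < s -> x < t ->
  is_derive x 1 (fun y : R => - ((t - y) `^ s / s)) ((t - x) `^ (s - 1)).
Proof.
move=> s0 rx.
have H := @is_derive1_powR R s (t - x).
have x0 : 0 < t - x by rewrite subr_gt0.
move: H => /(_ x0) H.
have D : is_derive x 1 (fun y : R => t - y) (-1).
  by apply: is_derive_eq; rewrite add0r mul1r.
have D2 := @is_derive1_comp R (fun z => z `^ s) (fun y => t - y) x _ _ H D.
have -> : (fun y : R => - ((t - y) `^ s / s)) = (- s^-1) *: ((fun z => z `^ s) \o (fun y => t - y)).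
  by apply/funext => y /=; rewrite [RHS]mulNr mulrC.
apply: is_derive_eq.
by rewrite mulrN1 scaleNr scalerN opprK /GRing.scale/= mulrA mulVf ?mul1r// gt_eqF.
Qed.

Lemma cvg_powl (s r : R) : 0 < s -> (x - r) `^ s @[x --> r^'+] --> 0.
Proof.
move=> s0; apply/cvg_at_rightP => u [ur uc].
have := powR_cvg0 s0 => /cvg_at_rightP; apply; split => [n|].
  by rewrite subr_gt0.
by rewrite -(subrr r); apply: cvgB => //; exact: cvg_cst.
Qed.

Lemma cvg_powr (s t : R) : 0 < s -> (t - x) `^ s @[x --> t^'-] --> 0.
Proof.
move=> s0; apply/cvg_at_leftP => u [ur uc].
have := powR_cvg0 s0 => /cvg_at_rightP; apply; split => [n|].
  by rewrite subr_gt0.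
by rewrite -(subrr t); apply: cvgB => //; exact: cvg_cst.
Qed.

Lemma continuous_powR_gt0 (p x : R) : 0 < x -> {for x, continuous (fun z : R => z `^ p)}.
Proof.
move=> x0; apply/differentiable_continuous/derivable1_diffP.
by have [] := @is_derive1_powR R p x x0.
Qed.

Lemma int_powl (s r t : R) : 0 < s -> r < t ->
  (\int[mu]_(x in `[r, t]) ((x - r) `^ (s - 1))%:E = ((t - r) `^ s / s)%:E)%E.
Proof.
move=> s0 rt.
have := @ge0_FTC2_oo (fun x => (x - r) `^ (s - 1)) (fun y => (y - r) `^ s / s) r t rt.
rewrite subrr powR0 ?gt_eqF// mul0r subr0; apply.
- by move=> x _; exact: powR_ge0.
- move=> x /[!in_itv]/= /andP[rx _].
  apply: (@continuous_comp _ _ _ (fun x => x - r) (fun z => z `^ (s - 1))).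
    by apply: cvgB; [exact: cvg_id|exact: cvg_cst].
  by apply: continuous_powR_gt0; rewrite subr_gt0.
- split.
  + by move=> x /[!in_itv]/= /andP[rx _]; have [] := is_derive_powl s0 rx.
  + rewrite /= subrr powR0 ?gt_eqF//.
    by apply: cvgMr_tmp; exact: cvg_powl.
  + have [D _] := is_derive_powl s0 rt.
    apply: cvg_at_left_filter.
    suff: {for t, continuous (fun y : R => (y - r) `^ s / s)} by [].
    exact/differentiable_continuous/derivable1_diffP.
- move=> x /[!in_itv]/= /andP[rx _]; rewrite derive1E.
  by have D := is_derive_powl s0 rx; rewrite derive_val.
Qed.

Lemma int_powr (s r t : R) : 0 < s -> r < t ->
  (\int[mu]_(x in `[r, t]) ((t - x) `^ (s - 1))%:E = ((t - r) `^ s / s)%:E)%E.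
Proof.
move=> s0 rt.
have := @ge0_FTC2_oo (fun x => (t - x) `^ (s - 1)) (fun y => - ((t - y) `^ s / s)) r t rt.
rewrite subrr powR0 ?gt_eqF// mul0r oppr0 sub0r opprK; apply.
- by move=> x _; exact: powR_ge0.
- move=> x /[!in_itv]/= /andP[_ xt].
  apply: (@continuous_comp _ _ _ (fun x => t - x) (fun z => z `^ (s - 1))).
    by apply: cvgB; [exact: cvg_cst|exact: cvg_id].
  by apply: continuous_powR_gt0; rewrite subr_gt0.
- split.
  + by move=> x /[!in_itv]/= /andP[_ rx]; have [] := is_derive_powr s0 rx.
  + have [D _] := is_derive_powr s0 rt.
    apply: cvg_at_right_filter.
    suff: {for r, continuous (fun y : R => - ((t - y) `^ s / s))} by [].
    exact/differentiable_continuous/derivable1_diffP.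
  + rewrite /= subrr powR0 ?gt_eqF//.
    by apply: cvgN; apply: cvgMr_tmp; exact: cvg_powr.
- move=> x /[!in_itv]/= /andP[_ rx]; rewrite derive1E.
  by have D := is_derive_powr s0 rx; rewrite derive_val.
Qed.

Section fub.
Variables (k : R -> R -> R) (u c : R -> R) (C : R).
Hypothesis k0 : forall s r, 0 <= k s r.
Hypothesis mk : measurable_fun setT (fun z : R * R => k z.1 z.2).
Hypothesis kc : forall r, (\int[mu]_s (k s r)%:E = (c r)%:E)%E.
Hypothesis cC : forall r, 0 <= c r <= C.
Hypothesis iu : mu.-integrable setT (EFin \o u).

Let mu2 : measurable_fun setT u.
Proof. by move/integrableP : iu => [/measurable_EFinP]. Qed.

Let mkr r : measurable_fun setT (k ^~ r).
Proof. exact: (measurableT_comp mk (measurable_pair2 r)). Qed.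

Let mf : measurable_fun setT (fun z : R * R => (k z.1 z.2 * u z.2)%:E).
Proof.
apply/measurable_EFinP; apply: measurable_funM => //.
exact: (measurableT_comp mu2 measurable_snd).
Qed.

Let C0 : 0 <= C. Proof. by have /andP[] := cC 0; exact: le_trans. Qed.

Lemma fub_int : (mu \x mu)%E.-integrable setT (fun z : R * R => (k z.1 z.2 * u z.2)%:E).
Proof.
apply/integrable21ltyP => //=.
have E r : (\int[mu]_s `|(k s r * u r)%:E| = (c r * `|u r|)%:E)%E.
  under eq_integral do rewrite /= normrM (ger0_norm (k0 _ _)) EFinM.
  rewrite ge0_integralZr//; last 2 first.
  - by apply/measurable_EFinP; exact: mkr.
  - by move=> s _; rewrite lee_fin.
  by rewrite kc.
under eq_integral do rewrite E.
have /integrableP[_ ] := iu.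
move=> iuoo.
apply: (@le_lt_trans _ _ (\int[mu]_r (C%:E * `|(u r)%:E|))%E).
  apply: ge0_le_integral => //.
  - move=> r _; rewrite lee_fin mulr_ge0//; by have /andP[] := cC r.
  - rewrite (_ : (fun r => _) = (fun r => \int[mu]_s `|(k s r * u r)%:E|)%E); last by apply/funext => r; rewrite E.
    have H := @measurable_fun_fubini_tonelli_G _ _ _ _ _ mu (fun z : R * R => `|(k z.1 z.2 * u z.2)%:E|%E).
    apply: H => //; exact: measurableT_comp.
  - by apply/measurable_EFinP; apply: measurable_funM => //; exact: measurableT_comp.
  - by move=> r _; rewrite /= lee_fin ler_wpM2r//; have /andP[] := cC r.
rewrite ge0_integralZl//; first exact: lte_mul_pinfty.
by apply/measurable_EFinP; exact: measurableT_comp.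
Qed.

Lemma fub_eq : (\int[mu]_s \int[mu]_r (k s r * u r)%:E = \int[mu]_r (c r * u r)%:E)%E.
Proof.
rewrite (Fubini fub_int)/=; apply: eq_integral => r _.
under eq_integral do rewrite EFinM.
rewrite integralZr//; first by rewrite kc.
apply/integrableP; split; first by apply/measurable_EFinP; exact: mkr.
under eq_integral do rewrite gee0_abs ?lee_fin//.
by rewrite kc ltry.
Qed.

Lemma fub_itg : mu.-integrable setT (fun s => \int[mu]_r (k s r * u r)%:E)%E.
Proof. exact: (integrable_fubini_F fub_int). Qed.
End fub.

Section ID.
Variables (a b sg : R) (u : R -> R).
Hypotheses (ab : a < b) (sg0 : 0 < sg).
Hypothesis iu : mu.-integrable `[a, b] (EFin \o u).
Hypothesis eu : forall t, t \in `]a, b] -> RLint_exists a sg u t.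

Let u' : R -> R := u \_ `[a, b].
Let iu' : mu.-integrable setT (EFin \o u').
Proof. by rewrite /u' -restrict_EFin; apply/integrable_restrict => //=; rewrite setTI. Qed.

Let W t := \int[mu]_(r in `[a, t]) u r.

Section t.
Variable t : R.
Hypothesis tab : t \in `]a, b].
Let at_ : a < t. Proof. by move: tab; rewrite in_itv/= => /andP[]. Qed.
Let tb : t <= b. Proof. by move: tab; rewrite in_itv/= => /andP[]. Qed.

Let D s r := ((a <= r) && (r <= s) && (s <= t)).
Let k1 s r : R := if D s r then (t - s) `^ (sg - 1) else 0.
Let k2 s r : R := if D s r then (s - r) `^ (sg - 1) else 0.
Let c r : R := if (a <= r) && (r <= t) then (t - r) `^ sg / sg else 0.

Let mD : measurable_fun setT (fun z : R * R => D z.1 z.2).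
Proof.
apply: measurable_and; first apply: measurable_and; apply: measurable_fun_ler => //.
Qed.

Let mk1 : measurable_fun setT (fun z : R * R => k1 z.1 z.2).
Proof.
apply: measurable_fun_ifT => //.
apply: (measurableT_comp (measurable_powR (sg - 1))).
exact: measurable_funB.
Qed.

Let mk2 : measurable_fun setT (fun z : R * R => k2 z.1 z.2).
Proof.
apply: measurable_fun_ifT => //.
apply: (measurableT_comp (measurable_powR (sg - 1))).
exact: measurable_funB.
Qed.

Let kc (k : R -> R -> R) (e : R -> R -> R) r :
  (forall s r, k s r = if D s r then e s r else 0) ->
  ((r < t)%R -> \int[mu]_(s in `[r, t]) (e s r)%:E = ((t - r) `^ sg / sg)%:E)%E ->
  (\int[mu]_s (k s r)%:E = (c r)%:E)%E.
Proof.
move=> kE eE.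
have [ar|ra] := leP a r; last first.
  rewrite /c leNgt ra/=; apply: integral0_eq => s _.
  by rewrite kE /D leNgt ra.
transitivity (\int[mu]_(s in `[r, t]) (e s r)%:E)%E.
  rewrite [RHS]integral_mkcond; apply: eq_integral => s _.
  rewrite kE /D ar/= patchE; case: ifPn => [h|h].
    by rewrite ifT// inE/= in_itv/=.
  by rewrite ifF//; apply/negbTE; rewrite notin_setE/= in_itv/=; apply/negP.
rewrite /c ar/=; have [rt|tr|<-] := ltgtP r t.
- by rewrite eE.
- by rewrite set_itv_ge ?integral_set0// bnd_simp -ltNge.
- by rewrite set_itv1 integral_set1 subrr powR0 ?gt_eqF// mul0r.
Qed.

Let kc1 r : (\int[mu]_s (k1 s r)%:E = (c r)%:E)%E.
Proof. by apply: kc => // rt; exact: int_powr. Qed.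

Let kc2 r : (\int[mu]_s (k2 s r)%:E = (c r)%:E)%E.
Proof. by apply: kc => // rt; exact: int_powl. Qed.

Let cC r : 0 <= c r <= (t - a) `^ sg / sg.
Proof.
rewrite /c; case: ifPn => [/andP[ar rt]|_].
  rewrite divr_ge0 ?powR_ge0 ?(ltW sg0)//= ler_pM2r ?invr_gt0//.
  apply: ge0_ler_powR; rewrite ?nnegrE ?subr_ge0 ?lerD2l ?lerN2 ?(ltW sg0)//; exact: ltW.
by rewrite lexx divr_ge0 ?powR_ge0 ?(ltW sg0).
Qed.

Let k10 s r : 0 <= k1 s r. Proof. by rewrite /k1; case: ifP => // _; exact: powR_ge0. Qed.
Let k20 s r : 0 <= k2 s r. Proof. by rewrite /k2; case: ifP => // _; exact: powR_ge0. Qed.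

Let I1 s : (\int[mu]_r (k1 s r * u' r)%:E = ((RLkernel sg W t) \_ `[a, t] s)%:E)%E.
Proof.
rewrite patchE; case: ifPn => [|h]; last first.
  apply: integral0_eq => r _; rewrite /k1 /D; case: ifPn => [h2|]; last by rewrite mul0r.
  exfalso; move/negP : h; apply; rewrite inE/= in_itv/=; have := tb; lra.
rewrite inE/= in_itv/= => /andP[as_ st].
have isu : mu.-integrable `[a, s] (EFin \o u).
  apply: integrableS iu => //; apply: subset_itvl; rewrite bnd_simp; have := tb; lra.
transitivity (\int[mu]_(r in `[a, s]) (((t - s) `^ (sg - 1))%:E * (u r)%:E))%E.
  rewrite [RHS]integral_mkcond; apply: eq_integral => r _.
  rewrite patchE /k1 /D st andbT; case: ifPn => [/andP[ar rs]|h].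
    rewrite ifT ?inE/= ?in_itv/= ?ar// /u' patchE ifT ?EFinM// inE/= in_itv/=; have := tb; lra.
  rewrite mul0r ifF//; apply/negbTE; rewrite notin_setE/= in_itv/=; exact/negP.
rewrite integralZl// /RLkernel EFinM /W /Rintegral fineK//.
exact: integrable_fin_num.
Qed.

Let I2 s : (\int[mu]_r (k2 s r * u' r)%:E =
  ((fun s => \int[mu]_(r in `[a, s]) RLkernel sg u s r) \_ `[a, t] s)%:E)%E.
Proof.
rewrite patchE; case: ifPn => [|h]; last first.
  apply: integral0_eq => r _; rewrite /k2 /D; case: ifPn => [h2|]; last by rewrite mul0r.
  exfalso; move/negP : h; apply; rewrite inE/= in_itv/=; have := tb; lra.
rewrite inE/= in_itv/= => /andP[as_ st].
transitivity (\int[mu]_(r in `[a, s]) (RLkernel sg u s r)%:E)%E.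
  rewrite [RHS]integral_mkcond; apply: eq_integral => r _.
  rewrite patchE /k2 /D st andbT; case: ifPn => [/andP[ar rs]|h].
    rewrite ifT ?inE/= ?in_itv/= ?ar// /u' patchE ifT// inE/= in_itv/=; have := tb; lra.
  rewrite mul0r ifF//; apply/negbTE; rewrite notin_setE/= in_itv/=; exact/negP.
rewrite /Rintegral fineK//.
move: as_; rewrite le_eqVlt => /predU1P[<-|as_].
  by rewrite set_itv1 integral_set1.
apply: integrable_fin_num => //; apply: eu; rewrite in_itv/=; have := tb; lra.
Qed.

Lemma ID_exists1 : RLint_exists a sg W t.
Proof.
rewrite /RLint_exists; suff: mu.-integrable setT (EFin \o (RLkernel sg W t \_ `[a, t])).
  by rewrite -restrict_EFin => /integrable_restrict; rewrite setTI; apply.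
have := fub_itg k10 mk1 kc1 cC iu'.
by apply: eq_integrable => // s _; rewrite I1.
Qed.

Lemma ID_int2 : mu.-integrable `[a, t] (EFin \o (fun s => \int[mu]_(r in `[a, s]) RLkernel sg u s r)).
Proof.
suff: mu.-integrable setT (EFin \o ((fun s => \int[mu]_(r in `[a, s]) RLkernel sg u s r) \_ `[a, t])).
  by rewrite -restrict_EFin => /integrable_restrict; rewrite setTI; apply.
have := fub_itg k20 mk2 kc2 cC iu'.
by apply: eq_integrable => // s _; rewrite I2.
Qed.

Lemma ID_eq : \int[mu]_(s in `[a, t]) RLkernel sg W t s =
  \int[mu]_(s in `[a, t]) \int[mu]_(r in `[a, s]) RLkernel sg u s r.
Proof.
rewrite /Rintegral; congr fine.
rewrite integral_mkcond [RHS]integral_mkcond.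
have := fub_eq k10 mk1 kc1 cC iu'; rewrite -(fub_eq k20 mk2 kc2 cC iu').
move=> E.
transitivity (\int[mu]_s \int[mu]_r (k1 s r * u' r)%:E)%E.
  by apply: eq_integral => s _; rewrite I1 !patchE; case: ifP.
by rewrite E; apply: eq_integral => s _; rewrite I2 !patchE; case: ifP.
Qed.

End t.

Variables (V0 : R) (V : R -> R).
Hypothesis VE : forall t, t \in `[a, b] -> V t = V0 + W t.
Hypothesis cu : {within `]a, b], continuous (RLint a sg u)}.

Let w := RLint a sg u.
Let J t := \int[mu]_(r in `[a, t]) w r.

Let bb : b \in `]a, b]. Proof. by rewrite in_itv/= ab lexx. Qed.

Let iw : mu.-integrable `[a, b] (EFin \o w).
Proof.
have := @integrableZl _ _ _ mu `[a, b] (measurable_itv _) ((Gamma sg)^-1)%R _ (ID_int2 bb).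
by apply: eq_integrable.
Qed.

Let RJ t : t \in `]a, b] -> RLint a sg (fun r => V r - V0) t = J t.
Proof.
move=> tab; rewrite /RLint.
have -> : \int[mu]_(s in `[a, t]) RLkernel sg (fun r => V r - V0) t s =
          \int[mu]_(s in `[a, t]) RLkernel sg W t s.
  apply: eq_Rintegral => s; rewrite inE/= => sat; rewrite /RLkernel VE.
    by rewrite (addrC V0) addrK.
  by move: sat tab; rewrite !in_itv/= => /andP[-> st] /andP[_]; exact: le_trans.
by rewrite ID_eq// /J /w /RLint RintegralZl//; exact: ID_int2.
Qed.

Let w' : R -> R := fun x => (w \_ `[a, b]) x + (cst (w b) \_ `]b, b + 1]) x.

Let iw' : mu.-integrable `[a, b + 1] (EFin \o w').
Proof.
apply: (@integrableS _ _ _ mu setT) => //.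
have -> : EFin \o w' = ((EFin \o (w \_ `[a, b])) \+ (EFin \o (cst (w b) \_ `]b, (b + 1)%R])))%E.
  by apply/funext => x; rewrite /w'/= EFinD.
apply: integrableD => //.
- by rewrite -restrict_EFin; apply/integrable_restrict => //=; rewrite setTI.
- rewrite -restrict_EFin; apply/integrable_restrict => //=; rewrite setTI.
  apply/integrableP; split; first exact/measurable_EFinP.
  rewrite (eq_integral (cst (`|w b|%:E)))// integral_cst//= lebesgue_measure_itv/= lte_fin ltrDl ltr01.
  by rewrite -EFinB -EFinM ltry.
Qed.

Let w'E x : a < x -> x < b + 1 -> w' x = w (Num.min x b).
Proof.
move=> ax xb1; rewrite /w' !patchE; have [xb|bx] := leP x b.
  rewrite ifT ?inE/= ?in_itv/= ?xb ?(ltW ax)// ifF ?addr0//.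
  by apply/negbTE; rewrite notin_setE/= in_itv/= ltNge xb.
rewrite ifF; last by apply/negbTE; rewrite notin_setE/= in_itv/= (leNgt x) bx andbF.
by rewrite ifT ?add0r// inE/= in_itv/= bx ltW.
Qed.

Let cw' t : t \in `]a, b] -> {for t, continuous w'}.
Proof.
move=> tab; have /andP[at_ tb] : a < t <= b by move: tab; rewrite in_itv.
move/subspace_continuousP : cu => /(_ t tab) /cvgrPdist_lt ct.
apply/cvgrPdist_lt => e e0; have [d /= d0 H] := ct e e0.
rewrite w'E//; last by rewrite (le_lt_trans tb)// ltrDl.
rewrite (min_idPl tb); near=> x.
have ax : a < x by near: x; exact: lt_nbhsr.
have xb1 : x < b + 1.
  by near: x; apply: lt_nbhsl; rewrite (le_lt_trans tb)// ltrDl.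
have xd : `|t - x| < d by near: x; exists d => //.
rewrite w'E//; apply: H => /=.
  have [xb|bx] := leP x b; first by [].
  move: xd; rewrite ltr_norml /ball_/= => ?; rewrite ltr_norml; lra.
by rewrite in_itv/= lt_min ax ab/= ge_min lexx orbT.
Unshelve. all: by end_near. Qed.

Let derJ t : t \in `]a, b] -> has_deriv_within `]a, b] J t (w t).
Proof.
move=> tab; have /andP[at_ tb] : a < t <= b by move: tab; rewrite in_itv.
have tb1 : t < b + 1 by rewrite (le_lt_trans tb)// ltrDl.
have [dF F't] := continuous_FTC1_closed tb1 iw' at_ (cw' tab).
set F := (fun x => _) in dF F't.
have FJ x : x \in `]a, b] -> F x = J x.
  move=> xab; apply: eq_Rintegral => y; rewrite inE/= => yax.
  have yb : y \in `[a, b].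
    by move: yax xab; rewrite !in_itv/= => /andP[-> yx] /andP[_]; exact: le_trans.
  rewrite /w' !patchE ifT ?inE// ifF ?addr0//.
  by apply/negbTE; rewrite notin_setE/= in_itv/=; move: yb; rewrite in_itv/=; lra.
have : h^-1 *: (F (h + t) - F t) @[h --> 0^'] --> w t.
  have -> : w t = 'D_1 F t by rewrite -derive1E F't w'E// (min_idPl tb).
  rewrite (_ : (fun h : R => _) = (fun h : R => h^-1 *: (F (h *: (1 : R) + t) - F t))); last first.
    by apply/funext => h; rewrite [h *: 1]mulr1.
  exact: dF.
move/cvgrPdist_le => H; apply/cvgrPdist_le => e e0.
have [d /= d0 {}H] := H e e0.
exists d => // x /= xd xt xab.
have := H (x - t).
rewrite /= subrK sub0r normrN subr_eq0 distrC FJ// FJ// mulrC; exact.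
Qed.

Theorem main : is_fracD a b sg V (RLint a sg u).
Proof.
exists V0; split.
  have : V0 + W t @[t --> a^'+] --> V0.
    rewrite -[X in _ --> X]addr0; apply: cvgD; first exact: cvg_cst.
    by apply: cvg_at_right_filter; exact: parameterized_integral_cvg_left ab iu.
  apply: cvg_trans; apply: near_eq_cvg; near=> t.
  rewrite VE// in_itv/=; apply/andP; split; first by near: t; exact: nbhs_right_ge.
  by near: t; exact: nbhs_right_le.
move=> t tab; split.
  have := ID_exists1 tab; apply: eq_integrable => // s; rewrite inE/= => sat.
  rewrite /= /RLkernel VE; first by rewrite (addrC V0) addrK.
  by move: sat tab; rewrite !in_itv/= => /andP[-> st] /andP[_]; exact: le_trans.
rewrite /has_deriv_within RJ//.
have := derJ tab; rewrite /has_deriv_within => H.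
apply: cvg_trans H; apply: near_eq_cvg; near=> x.
have xab : x \in `]a, b] by near: x; exact: withinT.
by rewrite RJ.
Unshelve. all: by end_near. Qed.
End ID.
End FracDAbsContinuous.
End FracD.

(* For V absolutely continuous with density u, I^s D V is literally I^s u
   (wherever that function is continuous). *)
Lemma fracD_abs_continuous (R : realType) (a b s V0 : R) (u V : R -> R) :
  a < b -> 0 < s ->
  (@lebesgue_measure R).-integrable `[a, b] (EFin \o u) ->
  (forall t, t \in `[a, b] ->
     V t = V0 + \int[@lebesgue_measure R]_(r in `[a, t]) u r) ->
  (forall t, t \in `]a, b] -> RLint_exists a s u t) ->
  {within `]a, b], continuous (RLint a s u)} ->
  is_fracD a b s V (RLint a s u).
Proof. move=> ab s0 iu VE eu cu; exact (@FracD.main R a b s u ab s0 iu eu V0 V VE cu). Qed.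


Record coupled_data (R : realType) := CoupledData {
  d_a : R; d_b : R;
  d_alpha1 : R; d_alpha2 : R; d_p1 : R; d_p2 : R;
  d_beta1 : R; d_beta2 : R; d_q1 : R; d_q2 : R;
  d_lambda1 : R; d_lambda2 : R;
  d_n : nat; d_mu : 'I_d_n -> R; d_nu : 'I_d_n -> R; d_eta : 'I_d_n -> R;
  d_m : nat; d_omega : 'I_d_m -> R; d_sigma : 'I_d_m -> R; d_xi : 'I_d_m -> R }.

Section CoupledSystem.
Variables (R : realType) (S : coupled_data R).
Local Notation a := (d_a S).
Local Notation b := (d_b S).
Local Notation alpha1 := (d_alpha1 S).
Local Notation alpha2 := (d_alpha2 S).
Local Notation p1 := (d_p1 S).
Local Notation p2 := (d_p2 S).
Local Notation beta1 := (d_beta1 S).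
Local Notation beta2 := (d_beta2 S).
Local Notation q1 := (d_q1 S).
Local Notation q2 := (d_q2 S).
Local Notation lambda1 := (d_lambda1 S).
Local Notation lambda2 := (d_lambda2 S).
Local Notation n := (d_n S).
Local Notation m := (d_m S).
Local Notation "'mu_ i" := (d_mu i) (at level 8, i at level 2).
Local Notation "'nu_ i" := (d_nu i) (at level 8, i at level 2).
Local Notation "'eta_ i" := (d_eta i) (at level 8, i at level 2).
Local Notation "'omega_ j" := (d_omega j) (at level 8, j at level 2).
Local Notation "'sigma_ j" := (d_sigma j) (at level 8, j at level 2).
Local Notation "'xi_ j" := (d_xi j) (at level 8, j at level 2).

Definition gamma1 : R := alpha1 + beta1 - alpha1 * beta1.
Definition delta1 : R := p1 + q1 - p1 * q1.

(* c^r / Gamma(r + 1) *)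
Definition npow (c r : R) : R := c `^ r / Gamma (r + 1).

Definition Phi1 : R := (b - a) `^ (gamma1 + alpha2 - 1) / Gamma (gamma1 + alpha2).
Definition Phi2 : R :=
  \sum_(i < n) 'mu_i * ('eta_i - a) `^ (delta1 + p2 + 'nu_i - 1)
               / Gamma (delta1 + p2 + 'nu_i).
Definition Phi3 : R :=
  \sum_(j < m) 'omega_j * ('xi_j - a) `^ (gamma1 + alpha2 + 'sigma_j - 1)
               / Gamma (gamma1 + alpha2 + 'sigma_j).
Definition Phi4 : R := (b - a) `^ (delta1 + p2 - 1) / Gamma (delta1 + p2).
Definition Lambda : R := Phi1 * Phi4 - Phi2 * Phi3.

Definition P : R :=
  (b - a) `^ (gamma1 + alpha2 - 1) / (`|Lambda| * Gamma (gamma1 + alpha2)).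
Definition Q : R :=
  (b - a) `^ (delta1 + p2 - 1) / (`|Lambda| * Gamma (delta1 + p2)).

Definition X1 : R :=
  `|lambda1| * (npow (b - a) alpha2
    + P * (`|Phi4| * npow (b - a) alpha2
           + `|Phi2| * \sum_(j < m) `|'omega_j| * npow ('xi_j - a) (alpha2 + 'sigma_j))).
Definition Y1 : R :=
  `|lambda2| * P *
    (`|Phi4| * \sum_(i < n) `|'mu_i| * npow ('eta_i - a) (p2 + 'nu_i)
     + `|Phi2| * npow (b - a) p2).
Definition F1 : R :=
  npow (b - a) (alpha1 + alpha2) * (1 + P * `|Phi4|)
  + P * `|Phi2| *
    \sum_(j < m) `|'omega_j| * npow ('xi_j - a) (alpha1 + alpha2 + 'sigma_j).
Definition G1 : R :=
  P * (`|Phi4| * \sum_(i < n) `|'mu_i| * npow ('eta_i - a) (p1 + p2 + 'nu_i)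
       + `|Phi2| * npow (b - a) (p1 + p2)).
Definition X2 : R :=
  `|lambda1| * Q *
    (`|Phi1| * \sum_(j < m) `|'omega_j| * npow ('xi_j - a) (alpha2 + 'sigma_j)
     + `|Phi3| * npow (b - a) alpha2).
Definition Y2 : R :=
  `|lambda2| * (npow (b - a) p2
    + Q * (`|Phi1| * npow (b - a) p2
           + `|Phi3| * \sum_(i < n) `|'mu_i| * npow ('eta_i - a) (p2 + 'nu_i))).
Definition F2 : R :=
  Q * (`|Phi1| * \sum_(j < m) `|'omega_j| * npow ('xi_j - a) (alpha1 + alpha2 + 'sigma_j)
       + `|Phi3| * npow (b - a) (alpha1 + alpha2)).
Definition G2 : R :=
  npow (b - a) (p1 + p2) * (1 + Q * `|Phi1|)
  + Q * `|Phi3| *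
    \sum_(i < n) `|'mu_i| * npow ('eta_i - a) (p1 + p2 + 'nu_i).

Definition standing_assumptions : Prop :=
  (0 <= a /\ a < b) /\ ((0 < n)%N /\ (0 < m)%N) /\
  (0 < alpha1 < 1 /\ 0 < alpha2 < 1 /\ 0 < p1 < 1 /\ 0 < p2 < 1) /\
  (0 < beta1 < 1 /\ 0 < beta2 < 1 /\ 0 < q1 < 1 /\ 0 < q2 < 1) /\
  (1 < alpha1 + alpha2 <= 2 /\ 1 < p1 + p2 <= 2) /\
  (forall i : 'I_n, 0 < 'nu_i /\ 'eta_i \in `[a, b]) /\
  (forall j : 'I_m, 0 < 'sigma_j /\ 'xi_j \in `[a, b]) /\
  Lambda != 0.

(* u and v are the inner derivatives H D^(alpha2,beta2) x, H D^(p2,q2) y. *)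
Definition is_solution (f g : R -> R -> R -> R) (x y : R -> R) : Prop :=
  {within `[a, b], continuous x} /\ {within `[a, b], continuous y} /\
  (exists u : R -> R,
     is_Hilfer a b alpha2 beta2 x u /\
     is_Hilfer a b alpha1 beta1 (fun t => u t + lambda1 * x t)
                                (fun t => f t (x t) (y t))) /\
  (exists v : R -> R,
     is_Hilfer a b p2 q2 y v /\
     is_Hilfer a b p1 q1 (fun t => v t + lambda2 * y t)
                         (fun t => g t (x t) (y t))) /\
  (x a = 0 /\ x b = \sum_(i < n) 'mu_i * RLint a ('nu_i) y ('eta_i)) /\
  (y a = 0 /\ y b = \sum_(j < m) 'omega_j * RLint a ('sigma_j) x ('xi_j)).

End CoupledSystem.

(* Main.v *)
Require Import Defs.
From mathcomp Require Import all_boot all_order all_algebra.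
From mathcomp Require Import all_classical all_reals all_analysis.
From mathcomp Require Import measurable_realfun lra ring.
Set Implicit Arguments.
Unset Strict Implicit.
Unset Printing Implicit Defensive.
Import Order.TTheory GRing.Theory Num.Theory.
Import numFieldNormedType.Exports.
Local Open Scope classical_set_scope.
Local Open Scope ring_scope.

(** Each equation is integrated twice. With [h t = f t (x t) (y t)], the function
    [x] solves the first equation with [x a = 0] when
      [x = c * rlpow (gamma1 + alpha2) + I^(alpha1 + alpha2) h
           - lambda1 * I^alpha2 x]
    for some constant [c], and similarly for [y] with a constant [d]. The
    conditions at [b] form a linear system for [(c, d)] with determinant
    [Lambda], so that [(c, d)] is an explicit functional of [(x, y)], called
    [coefficient]. The numbers [X1, ..., G2] are the resulting operator bounds,
    and the two numerical hypotheses give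
      [sup |x| + sup |y| <= K + rho * (sup |x| + sup |y|)]  with [rho < 1]
    for every solution.

    As [f] and [g] are merely continuous, existence is a topological matter. But
    the integral equations are causal: what happens at time [t] depends on the
    past of [(x, y)] and on the two numbers [c] and [d] only. If the past is
    delayed by a small [h], then the equation can be solved step by step for
    every [(c, d)], and the solution depends continuously on [(c, d)]. Matching
    [(c, d)] with the boundary conditions is a fixed point problem in the plane,
    where Brouwer's theorem has a short proof by winding numbers on a grid
    ([brouwer_plane]); the a priori bound keeps the fixed point in a given square.
    The solutions with delay are bounded and equicontinuous, and their limit as
    the delay tends to [0] solves the equations without delay
    ([causal_fixed_point]).

    The fractional calculus enters through the Beta integral, which yields the
    semigroup law [I^al I^be = I^(al + be)] ([RLint_semigroup]) and the action on
    powers; through the Hoelder bound [RLint_hoelder], which provides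
    equicontinuity; and through [volterra_Hilfer], which returns from the
    integral equation to the Hilfer derivatives. Functions on [a, b] are
    extended to the line by constants throughout, so that continuity is
    continuity on the line. *)

(** * Brouwer's theorem in the plane *)

(** The labels [Some false], [Some true] and [None] play the roles of the three
    colours of Sperner's lemma. A step counts the signed crossings of the edge
    between the first two colours, so that its sum along a closed path is a
    winding number. *)
Definition label_step (u v : option bool) : int :=
  if (u, v) is (Some x, Some y) then (y : nat)%:Z - (x : nat)%:Z else 0.

(** A closed path of four vertices that misses a colour does not wind: without
    [None] the steps telescope, and without another colour they all vanish. *)
Lemma label_step_cycle (u v w z : option bool) :
  label_step u v + label_step v w - label_step z w - label_step u z != 0 ->
  forall c, c \in [:: u; v; w; z].
Proof.
by case: u => [[]|]; case: v => [[]|]; case: w => [[]|]; case: z => [[]|];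
  move=> // _ [[]|].
Qed.

(** Sperner's lemma on a square grid. The winding numbers of the cells add up to
    that of the boundary of the grid, as interior edges cancel. On the left,
    right and top sides every step vanishes, and the bottom side contributes 1,
    so that some cell winds and hence carries all three labels. *)
Lemma sperner_grid (N : nat) (l : nat -> nat -> option bool) :
  (forall i, (i <= N)%N -> l i 0%N != None) ->
  (forall i, (i <= N)%N -> l i N = None) ->
  (forall j, (j <= N)%N -> l 0%N j != Some true) ->
  (forall j, (j <= N)%N -> l N j != Some false) ->
  exists i j, [/\ (i < N)%N, (j < N)%N & forall c,
    c \in [:: l i j; l i.+1 j; l i.+1 j.+1; l i j.+1]].
Proof.
move=> bot top left right; apply: contrapT => none.
pose H i j := label_step (l i j) (l i.+1 j).
pose V i j := label_step (l i j) (l i j.+1).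
have cell i j : (i < N)%N -> (j < N)%N ->
    (H i j - H i j.+1) + (V i.+1 j - V i j) = 0.
  move=> iN jN; apply/eqP; apply: contrapT => /negP ne0; apply: none.
  exists i, j; split => //; apply: label_step_cycle.
  rewrite -/(H i j) -/(V i.+1 j) -/(H i j.+1) -/(V i j).
  suff -> : H i j + V i.+1 j - H i j.+1 - V i j =
    (H i j - H i j.+1) + (V i.+1 j - V i j) by [].
  by ring.
have : \sum_(0 <= i < N) \sum_(0 <= j < N)
    ((H i j - H i j.+1) + (V i.+1 j - V i j)) = 0.
  rewrite big_nat big1// => i /andP[_ iN]; rewrite big_nat big1// => j /andP[_].
  exact: cell.
under eq_bigr do rewrite big_split/=; rewrite big_split/=.
rewrite [X in _ + X]exchange_big/=.
have -> : \sum_(0 <= j < N) \sum_(0 <= i < N) (V i.+1 j - V i j) = 0.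
  rewrite big_nat big1// => j /andP[_ jN]; rewrite telescope_sumr//.
  have V0 i : (i = 0%N \/ i = N) -> V i j = 0.
    rewrite /V => -[|] ->.
      have := left j (ltnW jN); have := left j.+1 jN.
      by case: (l _ _) => [[]|]// _; case: (l _ _) => [[]|].
    have := right j (ltnW jN); have := right j.+1 jN.
    by case: (l _ _) => [[]|]// _; case: (l _ _) => [[]|].
  by rewrite !V0; auto.
pose b i : int := if l i 0%N is Some x then (x : nat)%:Z else 0.
have -> : \sum_(0 <= i < N) \sum_(0 <= j < N) (H i j - H i j.+1) = b N - b 0%N.
  rewrite -(telescope_sumr b (leq0n N)) big_nat [RHS]big_nat.
  apply: eq_bigr => i /andP[_ iN].
  under eq_bigr do rewrite -opprB; rewrite sumrN telescope_sumr// opprB.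
  rewrite [H i N]/H !top// ?subr0; last exact: ltnW.
  rewrite /H /b; have := bot i (ltnW iN); have := bot i.+1 iN.
  by case: (l _ _) => [?|]// _; case: (l _ _) => [?|].
rewrite addr0 /b; have := bot _ (leq0n N); have := bot _ (leqnn N).
have := left _ (leq0n N); have := right _ (leq0n N).
by case: (l _ _) => [[]|]//; case: (l _ _) => [[]|].
Qed.

(** Along such an ultrafilter every bounded sequence converges, which replaces
    the repeated extraction of subsequences in the compactness arguments below. *)
Lemma free_ultrafilter : exists2 U : set_system nat, UltraFilter U & \oo `<=` U.
Proof.
have [U [UU oU]] := ultraFilterLemma (eventually_filter : ProperFilter \oo).
by exists U.
Qed.

Section UltraLimits.
Variables (R : realType) (U : set_system nat).
Hypotheses (UU : UltraFilter U).

Lemma ultra_bounded_cvg (u : nat -> R) (r : R) :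
  (forall n, `|u n| <= r) -> exists l : R, u n @[n --> U] --> l.
Proof.
move=> ur; have := @segment_compact R (- r) r.
move=> /(_ (u @ U)); case.
  by apply: nearW => n; rewrite /= in_itv/= -ler_norml.
move=> l [_ cl]; exists l => A Al.
have [//|UA] := in_ultra_setVsetC (u @^-1` A) UU.
by have [x []] := cl (~` A) A UA Al.
Qed.

Lemma ultra_bounded_cvg2 (u : nat -> R * R) (r : R) :
  (forall n, `|u n| <= r) -> exists l : R * R, u n @[n --> U] --> l.
Proof.
move=> ur.
have [|l1 h1] := @ultra_bounded_cvg (fun n => (u n).1) r.
  by move=> n; apply: le_trans (ur n); rewrite prod_normE/= le_max lexx.
have [|l2 h2] := @ultra_bounded_cvg (fun n => (u n).2) r.
  by move=> n; apply: le_trans (ur n); rewrite prod_normE/= le_max lexx orbT.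
exists (l1, l2).
have -> : u = (fun n => ((u n).1, (u n).2)) by apply/funext => n; case: (u n).
exact: cvg_pair h1 h2.
Qed.

End UltraLimits.

Section Brouwer.
Variables (R : realType) (F : R * R -> R * R) (r : R).
Hypotheses (cF : continuous F) (Fr : forall p, `|F p| <= r).

(* the margin makes the signs of [F p - p] strict on the boundary *)
Let s := r + 1.
Let r0 : 0 <= r. Proof. exact: le_trans (normr_ge0 _) (Fr 0). Qed.
Let pt (N i j : nat) : R * R :=
  (- s + i%:R * (2 * s / N%:R), - s + j%:R * (2 * s / N%:R)).
Let D p := F p - p.
Let lab p : option bool :=
  if (D p).2 < 0 then None else Some ((D p).1 < 0).

Let F12 p : (- r <= (F p).1 <= r) /\ (- r <= (F p).2 <= r).
Proof.
by have := Fr p; rewrite prod_normE/= ge_max => /andP[]; rewrite !ler_norml.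
Qed.

Let small_cell (k : nat) : exists p : R * R, `|p| <= s /\ forall c : option bool,
  exists q : R * R, `|q - p| <= 2 * s / k.+1%:R /\ lab q = c.
Proof.
have s0 : 0 < s by rewrite /s; have := r0; lra.
set h := 2 * s / k.+1%:R.
have h0 : 0 <= h by rewrite divr_ge0//; lra.
have hN : k.+1%:R * h = 2 * s by rewrite mulrC divfK.
have ptr : forall i, (i <= k.+1)%N -> `|- s + i%:R * h| <= s.
  move=> i ik; have : i%:R * h <= 2 * s by rewrite -hN ler_wpM2r// ler_nat.
  have : 0 <= i%:R * h by rewrite mulr_ge0.
  by rewrite ler_norml; lra.
have [||||i [j [iN jN H]]] := @sperner_grid k.+1 (fun i j => lab (pt k.+1 i j)).
- move=> i iN; rewrite /lab ifF//; apply/negbTE; rewrite -leNgt /D/= -/h.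
  rewrite mul0r; have [_] := F12 (pt k.+1 i 0).
  by rewrite /pt/= -/h mul0r /s => /andP[? ?]; lra.
- move=> i iN; rewrite /lab ifT// /D/= -/h hN.
  have [_] := F12 (pt k.+1 i k.+1).
  by rewrite /pt/= -/h hN /s => /andP[? ?]; lra.
- move=> j iN; rewrite /lab; case: ifP => //= _.
  rewrite /D/= -/h mul0r; have [+ _] := F12 (pt k.+1 0 j); rewrite /pt/= -/h mul0r.
  by case: ltP => //; rewrite /s => ? /andP[? ?]; lra.
- move=> j iN; rewrite /lab; case: ifP => //= _.
  rewrite /D/= -/h hN; have [+ _] := F12 (pt k.+1 k.+1 j); rewrite /pt/= -/h hN.
  by case: ltP => //; rewrite /s => ? /andP[? ?]; lra.
exists (pt k.+1 i j); split.
  by rewrite prod_normE/= -/h ge_max !ptr// ltnW.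
have near_pt i' j' : (i' = i \/ i' = i.+1) -> (j' = j \/ j' = j.+1) ->
    `|pt k.+1 i' j' - pt k.+1 i j| <= h.
  move=> hi hj; rewrite prod_normE/= -/h ge_max !ler_norml.
  have S (m : nat) : m.+1%:R * h = m%:R * h + h :> R by rewrite -natr1 mulrDl mul1r.
  by move: hi hj => [->|->] [->|->]; rewrite ?S; lra.
move=> c; have := H c; rewrite !inE.
by move=> /or4P[] /eqP ->; [exists (pt k.+1 i j)|exists (pt k.+1 i.+1 j)|
  exists (pt k.+1 i.+1 j.+1)|exists (pt k.+1 i j.+1)]; split => //; apply: near_pt; auto.
Qed.

(** Label [p] by the signs of the two components of [F p - p]. On the boundary of
    a square strictly larger than the range of [F] these signs are those that
    Sperner's lemma requires. The cells with all three labels accumulate, as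
    the mesh shrinks, at a point where both components are at once [<= 0] and
    [>= 0]. *)
Lemma brouwer_plane : exists p, F p = p.
Proof.
have [p pP] := choice small_cell.
pose q (k : nat) := projT1 (choice (pP k).2).
have qP k := projT2 (choice (pP k).2).
have [U UU oU] := free_ultrafilter.
have [l pl] := ultra_bounded_cvg2 UU (fun n => (pP n).1).
have ql c : q n c @[n --> U] --> l.
  have d0 : q n c - p n @[n --> U] --> (0 : R * R).
    have h0 : 2 * s / n.+1%:R @[n --> U] --> (0 : R).
      rewrite -[X in _ --> X](mulr0 (2 * s)); apply: cvgMl_tmp.
      by apply: cvg_trans (@cvg_harmonic R); apply: cvg_app.
    apply/cvgr0Pnorm_lt => e e0; have /cvgr0Pnorm_lt/(_ _ e0) := h0.
    apply: filterS => n; apply: le_lt_trans.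
    exact: le_trans (qP n c).1 (ler_norm _).
  have -> : q^~ c = (fun n => (q n c - p n) + p n).
    by apply/funext => n; rewrite subrK.
  by rewrite -[l]add0r; exact: cvgD d0 pl.
have cD : {for l, continuous D} by apply: continuousB => //; exact: cF.
have Dl c : D (q n c) @[n --> U] --> D l by exact: cvg_comp (ql c) cD.
have D1 c : (D (q n c)).1 @[n --> U] --> (D l).1.
  by apply: cvg_comp (Dl c) _; exact: cvg_fst.
have D2 c : (D (q n c)).2 @[n --> U] --> (D l).2.
  by apply: cvg_comp (Dl c) _; exact: cvg_snd.
have sgn c n : lab (q n c) = c by exact: (qP n c).2.
exists l; apply/eqP; rewrite -subr_eq0 -/(D l).
have D2le : (D l).2 <= 0.
  apply: cvgr_to_le (D2 None) _; apply: nearW => n.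
  by have := sgn None n; rewrite /lab; case: ltP => // /ltW.
have D2ge : 0 <= (D l).2.
  apply: cvgr_to_ge (D2 (Some true)) _; apply: nearW => n.
  by have := sgn (Some true) n; rewrite /lab; case: ltP.
have D1le : (D l).1 <= 0.
  apply: cvgr_to_le (D1 (Some true)) _; apply: nearW => n.
  by have := sgn (Some true) n; rewrite /lab; case: ltP => // _; case: ltP => // /ltW.
have D1ge : 0 <= (D l).1.
  apply: cvgr_to_ge (D1 (Some false)) _; apply: nearW => n.
  by have := sgn (Some false) n; rewrite /lab; case: ltP => // _; case: ltP.
rewrite -pair_eqE/=; apply/andP; split; rewrite eq_le.
  exact/andP.
exact/andP.
Qed.

End Brouwer.

(** * Fixed points of causal operators with a two-dimensional coupling *)

Lemma unif_continuous (R : realType) (V W : normedModType R) (z : V -> W) :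
  (forall e : R, 0 < e -> exists2 d : R, 0 < d &
     forall s t, `|s - t| <= d -> `|z s - z t| <= e) ->
  continuous z.
Proof.
move=> uz t; apply/cvgrPdist_le => e e0.
have [d d0 H] := uz e e0.
by apply/nbhs_normP; exists d => //= s /= ts; apply: H; exact: ltW.
Qed.

Lemma max_dist (R : realType) (a s t : R) :
  `|Num.max a s - Num.max a t| <= `|s - t|.
Proof.
have H1 := ler_norm (s - t); have := ler_norm (t - s); rewrite distrC => H2.
by rewrite ler_norml; have [?|?] := leP a s; have [?|?] := leP a t; apply/andP; split; lra.
Qed.

Lemma min_dist (R : realType) (b s t : R) :
  `|Num.min s b - Num.min t b| <= `|s - t|.
Proof.
have H1 := ler_norm (s - t); have := ler_norm (t - s); rewrite distrC => H2.
by rewrite ler_norml; have [?|?] := leP s b; have [?|?] := leP t b; apply/andP; split; lra.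
Qed.

Section Clip.
Variables (R : realType) (a b : R).

(** The retraction of the line onto [a, b], which turns functions on [a, b] into
    functions on the line, constant on both sides. *)
Definition clip (t : R) : R := Num.max a (Num.min t b).

Lemma clip_in t : a <= b -> clip t \in `[a, b].
Proof. by move=> ab; rewrite in_itv/= /clip le_max lexx ge_max ab ge_min lexx orbT. Qed.

Lemma clip_id t : t \in `[a, b] -> clip t = t.
Proof. by rewrite in_itv/= => /andP[at_ tb]; rewrite /clip (min_idPl tb) (max_idPr at_). Qed.

Lemma clip_dist s t : `|clip s - clip t| <= `|s - t|.
Proof. by apply: le_trans (max_dist _ _ _) _; exact: min_dist. Qed.

Lemma clip_continuous : continuous clip.
Proof.
apply: unif_continuous => e e0; exists e => // s t; apply: le_trans.
exact: clip_dist.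
Qed.

Lemma clip_norm t : a <= 0 <= b -> `|clip t| <= `|t|.
Proof.
move=> ab; have := clip_dist t 0; rewrite (clip_id (t := 0)) ?subr0//.
Qed.

End Clip.

Section Delay.
Variables (R : realType) (a h : R).

Definition delay (t : R) : R := Num.max a (t - h).

Lemma delay_continuous : continuous delay.
Proof.
apply: unif_continuous => e e0; exists e => // s t; apply: le_trans.
apply: le_trans (max_dist _ _ _) _.
by rewrite [X in `|X|](_ : _ = s - t)// opprB addrA subrK.
Qed.

Lemma delay_clip b t : a <= b -> 0 <= h ->
  `|clip a b (delay t) - clip a b t| <= h.
Proof.
move=> ab h0; rewrite /clip /delay ler_norml.
have [ath|tha] := leP a (t - h).
  have [?|?] := leP (t - h) b; have [?|?] := leP t b.
  - have [?|?] := leP a (t - h); have [?|?] := leP a t; apply/andP; split; lra.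
  - have [?|?] := leP a (t - h); have [?|?] := leP a b; apply/andP; split; lra.
  - have [?|?] := leP a b; have [?|?] := leP a t; apply/andP; split; lra.
  - by rewrite subrr; apply/andP; split; lra.
rewrite (min_idPl ab) maxxx; have [?|?] := leP t b.
  by have [?|?] := leP a t; apply/andP; split; lra.
by rewrite (max_idPr ab); apply/andP; split; lra.
Qed.

End Delay.

Section CausalFixedPoint.
Variables (R : realType) (a b : R).
Variables (T : R * R -> (R -> R * R) -> R -> R * R) (B : (R -> R * R) -> R * R).

Hypothesis ab : a < b.
Hypothesis T_clip : forall p (z : R -> R * R) (t : R), T p z t = T p z (clip a b t).
Hypothesis T_a : forall p (z : R -> R * R), T p z a = 0.
Hypothesis T_causal : forall p (z z' : R -> R * R) (t : R), t \in `[a, b] ->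
  (forall s, s \in `[a, t] -> z s = z' s) -> T p z t = T p z' t.
Hypothesis T_equicontinuous : forall r e : R, 0 < e -> exists2 d : R, 0 < d &
  forall p (z : R -> R * R), continuous z -> `|p| <= r -> (forall t : R, `|z t| <= r) ->
  forall s t, `|s - t| <= d -> `|T p z s - T p z t| <= e.
Hypothesis TB_uniform : forall r e : R, 0 < e -> exists2 d : R, 0 < d &
  forall p p' (z z' : R -> R * R), continuous z -> continuous z' -> `|p| <= r -> `|p'| <= r ->
  (forall t : R, `|z t| <= r) -> (forall t : R, `|z' t| <= r) ->
  `|p - p'| <= d -> (forall t : R, `|z t - z' t| <= d) ->
  `|B z - B z'| <= e /\ forall t, `|T p z t - T p' z' t| <= e.
Hypothesis B_bounded : forall r : R, exists r' : R, forall z : R -> R * R, continuous z ->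
  (forall t : R, `|z t| <= r) -> `|B z| <= r'.
Variables K rho : R.
Hypothesis rho1 : rho < 1.
Hypothesis apriori : forall p (z : R -> R * R) (X Y : R), continuous z ->
  (forall t : R, `|(z t).1| <= X) -> (forall t : R, `|(z t).2| <= Y) ->
  `|p.1| <= `|(B z).1| -> `|p.2| <= `|(B z).2| ->
  forall s t, `|(T p z s).1| + `|(T p z t).2| <= K + rho * (X + Y).

Let bounded (z : R -> R * R) := exists r : R, forall t, `|z t| <= r.

Let T_continuous p z : continuous z -> bounded z -> continuous (T p z).
Proof.
move=> cz [r zr]; apply: unif_continuous => e e0.
have [d d0 H] := @T_equicontinuous (Num.max `|p| r) e e0; exists d => //.
by apply: H => //[|t]; rewrite le_max ?lexx// zr orbT.
Qed.

Let max_clip (u : R -> R) : continuous u -> (forall t : R, u t = u (clip a b t)) ->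
  exists s, forall t, u t <= u s.
Proof.
move=> cu uc; have [|s sab H] := @EVT_max R u a b (ltW ab).
  by apply: continuous_subspaceT.
by exists s => t; rewrite uc; apply: H; apply: clip_in; exact: ltW.
Qed.

Let cvg_norm1 (z : R -> R * R) : continuous z -> continuous (fun t => `|(z t).1|).
Proof.
move=> cz t; apply: cvg_norm; apply: cvg_comp (cz t) _; exact: cvg_fst.
Qed.

Let cvg_norm2 (z : R -> R * R) : continuous z -> continuous (fun t => `|(z t).2|).
Proof.
move=> cz t; apply: cvg_norm; apply: cvg_comp (cz t) _; exact: cvg_snd.
Qed.

Let T_bounded p z : continuous z -> bounded z -> bounded (T p z).
Proof.
move=> cz bz; have cT := @T_continuous p z cz bz.
have [|t|s H] := @max_clip (fun t => `|T p z t|); last by exists `|T p z s|.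
- by move=> t; apply: cvg_norm; exact: cT.
- by rewrite [in LHS]T_clip.
Qed.

Section Delayed.
Variable n : nat.
Let h : R := (b - a) / n.+1%:R.
Local Notation dl z := (z \o delay a h).

Let h0 : 0 < h. Proof. by rewrite divr_gt0// subr_gt0. Qed.

Let dl_continuous (z : R -> R * R) : continuous z -> continuous (dl z).
Proof.
by move=> cz t; apply: continuous_comp; [exact: delay_continuous|exact: cz].
Qed.

Let picard p k : R -> R * R := iter k (fun z => T p (dl z)) (fun=> 0).

Let picard_continuous p k : continuous (picard p k) /\ bounded (picard p k).
Proof.
elim: k => [|k [ck [r bk]]].
  by split; [exact: cst_continuous|exists 0 => t; rewrite normr0].
have cd := dl_continuous ck.
have bd : bounded (dl (picard p k)) by exists r => t /=.
by split; [exact: T_continuous|exact: T_bounded].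
Qed.

Let picard_stable p k t : t \in `[a, b] -> t <= a + k%:R * h ->
  picard p k.+1 t = picard p k t.
Proof.
elim: k t => [|k IH] t tab tk.
  have -> : t = a.
    by move: tab tk; rewrite in_itv/= mul0r addr0 => /andP[? _] ?; apply/le_anti/andP.
  by rewrite /picard/= T_a.
rewrite [LHS]/= [RHS]/=; apply: T_causal => // s; rewrite in_itv/= => /andP[as_ st].
move: tab; rewrite in_itv/= => /andP[at_ tb].
apply: IH.
  by rewrite in_itv/= /delay le_max lexx/= ge_max (ltW ab)/=; have := h0; lra.
rewrite /delay ge_max lerDl mulr_ge0//=; last exact: ltW.
by move: tk; rewrite -natr1 mulrDl mul1r; lra.
Qed.

Let sol p := picard p n.+1.

Let sol_eq p t : sol p t = T p (dl (sol p)) t.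
Proof.
rewrite /sol [LHS]/= T_clip -/(picard p n) [RHS]T_clip.
have tab : clip a b t \in `[a, b] by apply: clip_in; exact: ltW.
rewrite -[RHS]/(picard p n.+2 (clip a b t)) picard_stable//.
by rewrite mulrC /h divfK ?pnatr_eq0// addrC subrK; move: tab; rewrite in_itv => /andP[].
Qed.

Let picard_param k p (e : R) : 0 < e -> exists2 d : R, 0 < d &
  forall q, `|p - q| <= d -> forall t, `|picard p k t - picard q k t| <= e.
Proof.
elim: k e => [|k IH] e e0.
  by exists 1 => // q _ t; rewrite /picard/= subrr normr0 ltW.
have [ck [r bk]] := picard_continuous p k.
pose r' := Num.max (`|p| + 1) (r + 1).
have [d d0 H] := @TB_uniform r' e e0.
have [|d' d'0 H'] := IH (Num.min d 1); first by rewrite lt_min d0 ltr01.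
exists (Num.min (Num.min d 1) d'); first by rewrite !lt_min d0 d'0 ltr01.
move=> q; rewrite !le_min => /andP[/andP[pd p1] pd'] t.
have zq s : `|picard p k s - picard q k s| <= d /\ `|picard p k s - picard q k s| <= 1.
  by have := H' q pd' s; rewrite le_min => /andP[].
have [cq _] := picard_continuous q k.
have near1 (V : normedModType R) (x y : V) (c : R) : `|x| <= c -> `|x - y| <= 1 -> `|y| <= c + 1.
  move=> xc xy; rewrite -[y](subKr x); apply: le_trans (ler_normB _ _) _.
  exact: lerD.
have [||||||||_ HT] := H p q (dl (picard p k)) (dl (picard q k)); last exact: HT.
- exact: dl_continuous.
- exact: dl_continuous.
- by rewrite le_max lerDl ler01.
- by rewrite le_max (near1 _ p).
- by move=> s /=; rewrite le_max [X in _ || X](le_trans (bk _)) ?orbT// lerDl.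
- by move=> s /=; rewrite le_max [X in _ || X](near1 _ _ _ _ (bk _) (zq _).2) orbT.
- by [].
- by move=> s /=; exact: (zq _).1.
Qed.

(** Successive approximations reach the solution for a given [p] after [n.+1]
    steps, because each step settles one more interval of length [h]. The map
    [p |-> B (dl (sol p))] is clipped to a square so that Brouwer's theorem
    applies. Clipping decreases absolute values, whence the a priori estimate
    still bounds the fixed point, and therefore the clipping was void. *)
Lemma delayed_solution (r' : R) :
  (forall z, continuous z -> (forall t, `|z t| <= K / (1 - rho)) -> `|B z| <= r') ->
  exists z p, [/\ continuous z, forall t, `|z t| <= K / (1 - rho),
    forall t, z t = T p (dl z) t & p = B (dl z)].
Proof.
move=> Br; pose r := Num.max r' 0.
pose F p : R * R := (clip (- r) r (B (dl (sol p))).1, clip (- r) r (B (dl (sol p))).2).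
have r0 : 0 <= r by rewrite le_max lexx orbT.
have rr : - r <= 0 <= r by rewrite oppr_le0 r0.
have nr : - r <= r by rewrite (le_trans (y := 0))// oppr_le0.
have Fr p : `|F p| <= r.
  by rewrite prod_normE/= ge_max !ler_norml; have := clip_in (B (dl (sol p))).1 nr;
    have := clip_in (B (dl (sol p))).2 nr; rewrite !in_itv/= => -> ->.
have cF : continuous F.
  move=> p; apply/cvgrPdist_le => e e0.
  have [cs [s bs]] := picard_continuous p n.+1.
  have [d d0 H] := @TB_uniform (Num.max `|p| (s + 1)) e e0.
  have [|d' d'0 H'] := @picard_param n.+1 p (Num.min d 1); first by rewrite lt_min d0 ltr01.
  have /cvgrPdist_lt/(_ d' d'0) := @cvg_id _ (nbhs p).
  apply: filterS => q /ltW pq.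
  have zq t : `|sol p t - sol q t| <= d /\ `|sol p t - sol q t| <= 1.
    by have := H' q pq t; rewrite le_min => /andP[].
  have [cq _] := picard_continuous q n.+1.
  have [||||||||HB _] := H p p (dl (sol p)) (dl (sol q)).
  - exact: dl_continuous.
  - exact: dl_continuous.
  - by rewrite le_max lexx.
  - by rewrite le_max lexx.
  - by move=> t /=; rewrite le_max [X in _ || X](le_trans (bs _)) ?orbT// lerDl.
  - move=> t /=; rewrite le_max; apply/orP; right.
    rewrite -[sol q _](subKr (sol p (delay a h t))); apply: le_trans (ler_normB _ _) _.
    by apply: lerD; [exact: bs|exact: (zq _).2].
  - by rewrite subrr normr0 ltW.
  - by move=> t /=; exact: (zq _).1.
  rewrite prod_normE/= ge_max; move: HB; rewrite prod_normE/= ge_max => /andP[B1 B2].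
  by apply/andP; split; apply: le_trans (clip_dist _ _ _ _) _.
have [p Fp] := brouwer_plane cF Fr.
have [cs _] := picard_continuous p n.+1.
have cd := dl_continuous cs.
have sc t : sol p t = sol p (clip a b t) by rewrite !sol_eq -T_clip.
have [|t|t1 H1] := @max_clip (fun t => `|(sol p t).1|); first exact: cvg_norm1.
  by rewrite [in LHS]sc.
have [|t|t2 H2] := @max_clip (fun t => `|(sol p t).2|); first exact: cvg_norm2.
  by rewrite [in LHS]sc.
have bnd t : `|sol p t| <= K / (1 - rho).
  have := @apriori p (dl (sol p)) _ _ cd (fun t => H1 _) (fun t => H2 _).
  have -> : `|p.1| <= `|(B (dl (sol p))).1|.
    by rewrite -{1}Fp; exact: clip_norm.
  have -> : `|p.2| <= `|(B (dl (sol p))).2|.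
    by rewrite -{1}Fp; exact: clip_norm.
  move=> /(_ isT isT t1 t2); rewrite -!sol_eq => A.
  rewrite ler_pdivlMr ?subr_gt0//.
  apply: (@le_trans _ _ ((`|(sol p t1).1| + `|(sol p t2).2|) * (1 - rho))); last by lra.
  rewrite ler_wpM2r ?subr_ge0 ?(ltW rho1)//.
  by rewrite prod_normE ge_max; apply/andP; split;
    [apply: ler_wpDr (H1 t)|apply: ler_wpDl (H2 t)].
exists (sol p), p; split; [exact: cs|exact: bnd|exact: sol_eq|].
have : `|B (dl (sol p))| <= r.
  by rewrite le_max Br// => t; exact: bnd.
rewrite prod_normE ge_max !ler_norml => /andP[B1 B2].
by rewrite -{1}Fp /F !clip_id ?in_itv//; case: (B _).
Qed.

End Delayed.

(** The parameter [p] ranges over the plane only. For the equation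
    [z t = T p (z \o delay a h) t] with a delay [h > 0], causality makes [z]
    explicit from [p] (lemma [delayed_solution]), and Brouwer's theorem in the
    plane adjusts [p] to [B]. As [h] tends to [0] the solutions are bounded and
    equicontinuous; their limit along a free ultrafilter is uniform and solves
    the equation without delay. *)
Theorem causal_fixed_point : exists z, continuous z /\ forall t, z t = T (B z) z t.
Proof.
have [r' Br] := B_bounded (K / (1 - rho)).
have := fun n => @delayed_solution n r' Br.
move=> /choice[z] /choice[p] zpP.
pose h n : R := (b - a) / n.+1%:R.
pose dz n := z n \o delay a (h n).
pose r := Num.max r' (K / (1 - rho)).
have cz n : continuous (z n) by have [] := zpP n.
have zE n t : z n t = T (p n) (dz n) t by have [] := zpP n.
have pE n : p n = B (dz n) by have [] := zpP n.
have zK n t : `|z n t| <= K / (1 - rho) by have [] := zpP n.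
have zr n t : `|z n t| <= r by rewrite le_max zK orbT.
have cdz n : continuous (dz n).
  by move=> t; apply: continuous_comp; [exact: delay_continuous|exact: cz].
have pr n : `|p n| <= r by rewrite le_max pE Br// => t; exact: zK.
have h0 n : 0 <= h n by rewrite divr_ge0// subr_ge0 ltW.
have zc n t : z n t = z n (clip a b t) by rewrite !zE -T_clip.
have equi (e : R) : 0 < e -> exists2 d : R, 0 < d &
    forall n s t, `|s - t| <= d -> `|z n s - z n t| <= e.
  move=> e0; have [d d0 H] := @T_equicontinuous r e e0; exists d => // n s t st.
  by rewrite !zE; apply: H => // u; exact: zr.
have [U UU oU] := free_ultrafilter.
have PU : ProperFilter U by exact: ultra_proper.
have [w zw] := choice (fun t => @ultra_bounded_cvg2 R U UU (z ^~ t) r (zr ^~ t)).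
have wr t : `|w t| <= K / (1 - rho).
  by apply: cvgr_to_le (cvg_norm (zw t)) _; apply: nearW.
have equiw (e : R) : 0 < e -> exists2 d : R, 0 < d &
    forall s t, `|s - t| <= d -> `|w s - w t| <= e.
  move=> /equi[d d0 H]; exists d => // s t st.
  by apply: cvgr_to_le (cvg_norm (cvgB (zw s) (zw t))) _; apply: nearW => n; exact: H.
have cw : continuous w by exact: unif_continuous.
have wc t : w t = w (clip a b t).
  have := zw t; rewrite (_ : z ^~ t = z ^~ (clip a b t)); last first.
    by apply/funext => n; exact: zc.
  by move=> zt; apply: (cvg_unique _ zt (zw _)); exact: norm_hausdorff.
have unif (e : R) : 0 < e -> \forall n \near U, forall t, `|z n t - w t| <= e.
  move=> e0; have e3 : 0 < e / 3 by rewrite divr_gt0.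
  have [d d0 H] := equi _ e3; have [d' d'0 H'] := equiw _ e3.
  suff : \forall n \near U, `[a, b] `<=` (fun t => `|z n t - w t| <= e).
    by apply: filterS => n Hn t; rewrite zc wc; apply: Hn; apply: clip_in; exact: ltW.
  apply: (compact_near_coveringP _).1 => //; first exact: segment_compact.
  move=> t _; exists ([set s | `|t - s| < Num.min d d'], [set n | `|z n t - w t| <= e / 3]).
    split => /=; first by apply/nbhs_normP; exists (Num.min d d') => //=; rewrite lt_min d0.
    by have /cvgrPdistC_le := zw t; apply.
  move=> [s n] /= []; rewrite lt_min => /andP[/ltW sd /ltW sd'] zt.
  have := H n s t; rewrite distrC => /(_ sd) H1.
  have := H' t s sd' => H2.
  have -> : z n s - w s = (z n s - z n t) + (z n t - w t) + (w t - w s).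
    by rewrite !addrA !subrK.
  apply: le_trans (ler_normD _ _) _; apply: le_trans (lerD (ler_normD _ _) (lexx _)) _.
  by lra.
have dunif (e : R) : 0 < e -> \forall n \near U, forall t, `|dz n t - w t| <= e.
  move=> e0; have e2 : 0 < e / 2 by rewrite divr_gt0.
  have [d d0 H] := equi _ e2.
  have hd : \forall n \near U, h n <= d.
    apply: oU; have : h n @[n --> \oo] --> (0 : R).
      by rewrite -[X in _ --> X](mulr0 (b - a)); apply: cvgMl_tmp; exact: cvg_harmonic.
    by move=> /cvgr_le; apply.
  apply: filterS2 hd (unif _ e2) => n hd un t.
  have -> : dz n t - w t = (dz n t - z n t) + (z n t - w t) by rewrite addrA subrK.
  apply: le_trans (ler_normD _ _) _; rewrite [e]splitr lerD//.
  rewrite /dz/= zc [in X in _ - X]zc; apply: H; apply: le_trans hd.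
  by apply: delay_clip => //; exact: ltW.
have wr' t : `|w t| <= r by rewrite le_max wr orbT.
have Bw : `|B w| <= r by rewrite le_max Br.
have cvp (e : R) : 0 < e -> \forall n \near U, `|p n - B w| <= e.
  move=> e0; have [d d0 H] := @TB_uniform r e e0.
  apply: filterS (dunif _ d0) => n dn; rewrite pE.
  have [||||||||] // := H (p n) (p n) (dz n) w => //.
  - by move=> t; exact: zr.
  - by rewrite subrr normr0 ltW.
exists w; split => // t; apply/eqP; rewrite -subr_eq0 -normr_le0; apply/ler_addgt0Pl => e e0.
have e2 : 0 < e / 2 by rewrite divr_gt0.
have [d d0 H] := @TB_uniform r _ e2.
have [n [un [pn dn]]] := filter_ex (filterI (unif _ e2) (filterI (cvp _ d0) (dunif _ d0))).
rewrite addr0.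
have -> : w t - T (B w) w t = (z n t - T (B w) w t) - (z n t - w t).
  by rewrite opprB [RHS]addrC addrA subrK.
apply: le_trans (ler_normB _ _) _; rewrite [e]splitr lerD//.
rewrite zE; have [||||||||_] // := H (p n) (B w) (dz n) w.
by move=> s; exact: zr.
Qed.

End CausalFixedPoint.

(** * Euler's Gamma and Beta integrals *)

Section AffineChange.
Variable R : realType.
Local Notation mu := (@lebesgue_measure R).

Definition affine (k r : R) : measurableTypeR R -> measurableTypeR R :=
  fun x => k * x + r.

Let measurable_affine k r : measurable_fun setT (affine k r).
Proof. by apply: measurable_funD => //; apply: measurable_funM. Qed.

Lemma lebesgue_measure_affine (k r : R) (k0 : 0 < k) (A : set R) : measurable A ->
  (k%:E * pushforward mu (affine k r) A = mu A)%E.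
Proof.
move=> mA.
have k0' := ltW k0.
pose push : {measure set (measurableTypeR R) -> \bar R} := pushforward mu (affine k r).
pose nu : {measure set (measurableTypeR R) -> \bar R} :=
  mscale (NngNum k0') (push (measurable_affine k r)).
rewrite (@lebesgue_measure_unique R nu)// => _ [[x y] _ <-].
rewrite /nu/= /mscale/= /pushforward.
have -> : affine k r @^-1` [set` `]x, y]] = [set` `](x - r) / k, (y - r) / k]].
  apply/seteqP; split => z; rewrite /affine/= !in_itv/= ltr_pdivrMr// ler_pdivlMr// mulrC.
    by rewrite ltrBlDr lerBrDr.
  by rewrite ltrBlDr lerBrDr.
rewrite !lebesgue_measure_itv/= !lte_fin ltr_pM2r ?invr_gt0// ltrD2r.
case: ifP => _; last by rewrite mule0.
rewrite -!EFinB -EFinM -mulrBl opprB addrA subrK; congr EFin.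
by rewrite mulrC divfK// gt_eqF.
Qed.

(** The image of Lebesgue measure under an affine map has constant density, by
    uniqueness of the measure with given values on the half-open intervals. *)
Lemma ge0_integral_affine (f : R -> \bar R) (k r : R) : 0 < k ->
  measurable_fun setT f -> (forall x, 0 <= f x)%E ->
  (\int[mu]_x f x = k%:E * \int[mu]_x f (k * x + r)%R)%E.
Proof.
move=> k0 mf f0.
have k0' := ltW k0.
pose push : {measure set (measurableTypeR R) -> \bar R} := pushforward mu (affine k r).
transitivity (\int[mscale (NngNum k0') (push (measurable_affine k r))]_x f x)%E.
  apply: eq_measure_integral => A mA _; rewrite /mscale/=.
  exact/esym/lebesgue_measure_affine.
rewrite ge0_integral_mscale//=; congr (_ * _)%E.
exact: (@ge0_integral_pushforward _ _ _ _ R _ (measurable_affine k r) mu setT f measurableT mf (in1W f0)).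
Qed.

End AffineChange.

Section EulerGamma.
Variable R : realType.
Local Notation mu := (@lebesgue_measure R).
Implicit Types (r s t x z : R).

Let eulerf z t : R := t `^ (z - 1) * expR (- t).
Let G z := (\int[mu]_(t in `]0%R, +oo[) (eulerf z t)%:E)%E.

Let measurable_eulerf z : measurable_fun setT (eulerf z).
Proof.
apply: measurable_funM; first exact: measurable_powR.
by apply: measurableT_comp; [exact: measurable_expR|exact: measurable_funN].
Qed.

Let eulerf_ge0 z t : 0 <= eulerf z t.
Proof. by rewrite mulr_ge0 ?powR_ge0 ?expR_ge0. Qed.

(** From [ln s < s] at [s = t / (2 m)], with an exponent [m >= z] that is
    positive. *)
Lemma powR_le_expR z : exists2 C, 0 <= C & forall t, 1 <= t -> t `^ z <= C * expR (t / 2).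
Proof.
pose m := `|z| + 1.
have m0 : 0 < m by rewrite ltr_wpDl.
exists ((2 * m) `^ m); first exact: powR_ge0.
move=> t t1; have t0 : 0 < t by exact: lt_le_trans t1.
have m2 : 0 < 2 * m by rewrite mulr_gt0.
apply: (@le_trans _ _ (t `^ m)).
  by apply: ler_powR => //; rewrite /m; have := ler_norm z; lra.
rewrite /powR !gt_eqF// -expRD ler_expR.
have -> : ln t = ln (2 * m) + ln (t / (2 * m)).
  by rewrite ln_div ?posrE// addrC subrK.
rewrite mulrDr lerD2l.
have -> : t / 2 = m * (t / (2 * m)) by field; rewrite gt_eqF.
by rewrite ler_pM2l// ltW// ln_sublinear// divr_gt0.
Qed.

Let expR_pdf t : 0 < t -> expR (- (t / 2)) = 2 * exponential_pdf (2^-1) t.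
Proof.
move=> t0; rewrite exponential_pdfE ?ltW// mulrA mulfV// mul1r; congr expR.
by rewrite mulNr mulrC.
Qed.

Let pow01 z t : R := ((fun t => t `^ (z - 1)) \_ `[0, 1]) t.

Let measurable_pow01 z : measurable_fun setT (pow01 z).
Proof. by apply/measurable_restrict => //=; rewrite setTI; apply: measurable_funTS; exact: measurable_powR. Qed.

Let int_pow01 z : 0 < z -> (\int[mu]_t (pow01 z t)%:E = (z^-1)%:E)%E.
Proof.
move=> z0; have := FracD.int_powl z0 (@ltr01 R).
rewrite subr0 powR1 mul1r => <-; rewrite [RHS]integral_mkcond.
by apply: eq_integral => t _; rewrite /pow01 !patchE subr0; case: ifP.
Qed.

Let G_lty z : 0 < z -> (G z < +oo)%E.
Proof.
move=> z0; have [C C0 HC] := powR_le_expR (z - 1).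
apply: (@le_lt_trans _ _ (\int[mu]_t ((pow01 z t)%:E + (2 * C)%:E * (exponential_pdf (2^-1) t)%:E))%E).
  rewrite /G integral_mkcond; apply: ge0_le_integral => //.
  - by move=> t _; apply: erestrict_ge0 => u _; rewrite lee_fin.
  - apply/measurable_restrict => //=; rewrite setTI; apply: measurable_funTS.
    apply/measurable_EFinP; exact: measurable_eulerf.
  - apply: emeasurable_funD; first by apply/measurable_EFinP; exact: measurable_pow01.
    apply: measurable_funeM; apply/measurable_EFinP.
    exact: measurable_exponential_pdf.
  - move=> t _; rewrite patchE; case: ifPn => [|_]; last first.
      rewrite lee_fin addr_ge0// ?mulr_ge0// ?exponential_pdf_ge0//.
      by apply: restrict_ge0 => u _; exact: powR_ge0.
    rewrite inE/= in_itv/= andbT => t0; rewrite -EFinM -EFinD lee_fin /eulerf.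
    have [t1|t1] := leP t 1.
      rewrite /pow01 patchE ifT ?inE/= ?in_itv/= ?(ltW t0)//.
      apply: ler_wpDr; first by rewrite !mulr_ge0// exponential_pdf_ge0.
      by rewrite ler_piMr ?powR_ge0// expR_le1 oppr_le0 ltW.
    apply: ler_wpDl; first by apply: restrict_ge0 => u _; exact: powR_ge0.
    rewrite mulrAC -expR_pdf//.
    have -> : expR (- t) = expR (- (t / 2)) * expR (- (t / 2)).
      by rewrite -expRD -opprD -splitr.
    rewrite mulrA mulrC ler_wpM2l ?expR_ge0// expRN ler_pdivrMr ?expR_gt0//.
    by apply: HC; exact: ltW.
rewrite ge0_integralD//=; last 4 first.
- by move=> t _; rewrite lee_fin; apply: restrict_ge0 => u _; exact: powR_ge0.
- by apply/measurable_EFinP; exact: measurable_pow01.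
- by move=> t _; rewrite mule_ge0// lee_fin ?mulr_ge0// exponential_pdf_ge0.
- by apply: measurable_funeM; apply/measurable_EFinP; exact: measurable_exponential_pdf.
rewrite int_pow01// ge0_integralZl//=; last 3 first.
- by apply/measurable_EFinP; exact: measurable_exponential_pdf.
- by move=> t _; rewrite lee_fin exponential_pdf_ge0.
- by rewrite lee_fin mulr_ge0.
by rewrite integral_exponential_pdf// mule1 -EFinD ltry.
Qed.

Let G_gt0 z : 0 < z -> (0 < G z)%E.
Proof.
move=> z0; apply: (@lt_le_trans _ _ ((expR (- 1))%:E * (z^-1)%:E)%E).
  by rewrite mule_gt0// lte_fin ?expR_gt0// invr_gt0.
rewrite -int_pow01// -ge0_integralZl//=; last 2 first.
- by apply/measurable_EFinP; exact: measurable_pow01.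
- by move=> t _; rewrite lee_fin; apply: restrict_ge0 => u _; exact: powR_ge0.
have -> : G z = (\int[mu]_(t in `[0%R, +oo[) (eulerf z t)%:E)%E.
  rewrite /G integral_itv_obnd_cbnd//; apply/measurable_EFinP.
  by apply: measurable_funTS; exact: measurable_eulerf.
rewrite [X in (_ <= X)%E]integral_mkcond; apply: ge0_le_integral => //.
- move=> t _; rewrite mule_ge0// lee_fin ?expR_ge0//.
  by apply: restrict_ge0 => u _; exact: powR_ge0.
- by apply: measurable_funeM; apply/measurable_EFinP; exact: measurable_pow01.
- apply/measurable_restrict => //=; rewrite setTI; apply: measurable_funTS.
  by apply/measurable_EFinP; exact: measurable_eulerf.
- move=> t _; rewrite /pow01 !patchE; case: ifPn => [|_]; last first.
    by rewrite mule0; case: ifP => // _; rewrite lee_fin.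
  rewrite inE/= in_itv/= => /andP[t0 t1].
  rewrite ifT ?inE/= ?in_itv/= ?t0// -EFinM lee_fin mulrC ler_wpM2l ?powR_ge0//.
  by rewrite ler_expR lerN2.
Qed.

(** The integral is finite: near [0] the integrand is dominated by
    [t `^ (z - 1)], and on [t >= 1] by an exponential density of rate [1 / 2]. *)
Lemma GammaE z : 0 < z -> (Gamma z)%:E = (\int[mu]_(t in `]0%R, +oo[) (t `^ (z - 1) * expR (- t))%:E)%E.
Proof.
move=> z0; rewrite /Gamma /Rintegral fineK// ge0_fin_numE; first exact: G_lty.
by apply: integral_ge0 => t _; rewrite lee_fin; exact: eulerf_ge0.
Qed.

Lemma Gamma_gt0 z : 0 < z -> 0 < Gamma z.
Proof. by move=> z0; rewrite -lte_fin GammaE//; exact: G_gt0. Qed.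

Lemma Gamma1 : Gamma (1 : R) = 1.
Proof.
apply/EFin_inj; rewrite GammaE//.
rewrite -(@integral_exponential_pdf R 1 ltr01) integral_itv_obnd_cbnd; last first.
  by apply/measurable_EFinP; by apply: measurable_funTS; exact: measurable_eulerf.
rewrite integral_mkcond; apply: eq_integral => t _; rewrite /exponential_pdf !patchE.
by case: ifP => // _; rewrite /eulerf subrr powRr0 !mul1r mulN1r.
Qed.

End EulerGamma.

Section BetaIntegral.
Variable R : realType.
Local Notation mu := (@lebesgue_measure R).
Implicit Types (r s t x z : R).
Variables (al be : R).
Hypotheses (al0 : 0 < al) (be0 : 0 < be).

Let betaf r t s : R := (t - s) `^ (al - 1) * (s - r) `^ (be - 1).
Let J := (\int[mu]_(x in `[0%R, 1%R]) (betaf 0 1 x)%:E)%E.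

Let measurable_betaf r t : measurable_fun setT (betaf r t).
Proof.
apply: measurable_funM; apply: (measurableT_comp (measurable_powR _)).
  exact: measurable_funB.
exact: measurable_funB.
Qed.

Let betaf_ge0 r t s : 0 <= betaf r t s.
Proof. by rewrite mulr_ge0 ?powR_ge0. Qed.

Let beta_scale r t : r < t ->
  (\int[mu]_(s in `[r, t]) (betaf r t s)%:E = ((t - r) `^ (al + be - 1))%:E * J)%E.
Proof.
move=> rt; have k0 : 0 < t - r by rewrite subr_gt0.
rewrite integral_mkcond (ge0_integral_affine r k0); last 2 first.
- apply/measurable_restrict => //=; rewrite setTI; apply: measurable_funTS.
  by apply/measurable_EFinP; exact: measurable_betaf.
- by move=> x; apply: erestrict_ge0 => u _; rewrite lee_fin; exact: betaf_ge0.
have mb : measurable_fun [set: R] ((EFin \o betaf 0 1) \_ `[0, 1]).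
  apply/measurable_restrict => //=; rewrite setTI; apply: measurable_funTS.
  by apply/measurable_EFinP; exact: measurable_betaf.
transitivity ((t - r)%:E * (((t - r) `^ (al + be - 2))%:E * J))%E; last first.
  rewrite muleA -EFinM; congr (_%:E * _)%E.
  have -> : al + be - 1 = 1 + (al + be - 2) by ring.
  by rewrite (@powRD _ _ 1) ?(gt_eqF k0) ?implybT// powRr1// ltW.
congr (_ * _)%E; rewrite /J [in RHS]integral_mkcond -ge0_integralZl//=; last 2 first.
- by move=> x _; apply: erestrict_ge0 => u _; rewrite lee_fin; exact: betaf_ge0.
- by rewrite lee_fin powR_ge0.
apply: eq_integral => x _; rewrite !patchE.
have -> : ((t - r) * x + r \in `[r, t]%classic) = (x \in `[0, 1]%classic).
  apply/idP/idP; rewrite !inE/= !in_itv/= => /andP[h1 h2].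
    move: h1; rewrite lerDr pmulr_rge0// => ->/=.
    by move: h2; rewrite -lerBrDr ger_pMr.
  by rewrite lerDr mulr_ge0 ?(ltW k0)//= -lerBrDr ger_pMr.
case: ifPn => [|_]; last by rewrite mule0.
rewrite inE/= in_itv/= => /andP[x0 x1]; rewrite -EFinM /betaf; congr EFin.
have -> : t - ((t - r) * x + r) = (t - r) * (1 - x) by ring.
rewrite addrK subr0 !powRM ?subr_ge0 ?(ltW rt)//.
have -> : al + be - 2 = (al - 1) + (be - 1) by ring.
by rewrite (@powRD _ _ (al - 1) (be - 1)) ?(gt_eqF k0) ?implybT//; ring.
Qed.

Let K (p : R * R) : R :=
  if (0 < p.1) && (p.1 < p.2) then expR (- p.2) * betaf 0 p.2 p.1 else 0.

Let measurable_K : measurable_fun setT K.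
Proof.
apply: measurable_fun_ifT => //.
  by apply: measurable_and; apply: measurable_fun_ltr.
apply: measurable_funM.
  by apply: measurableT_comp; [exact: measurable_expR|exact: measurable_funN].
apply: measurable_funM; apply: (measurableT_comp (measurable_powR _)).
  exact: measurable_funB.
exact: measurable_funB.
Qed.

Let K_ge0 p : 0 <= K p.
Proof. by rewrite /K; case: ifP => // _; rewrite mulr_ge0 ?expR_ge0. Qed.

Let int_K1 x : (\int[mu]_t (K (x, t))%:E =
  ((fun x => (x `^ (be - 1) * expR (- x))%:E) \_ `]0%R, +oo[) x * (Gamma al)%:E)%E.
Proof.
rewrite patchE; case: ifPn => [|x0]; last first.
  rewrite mul0e integral0_eq// => t _; rewrite /K/= ifF//.
  by apply/negbTE; apply: contra x0 => /andP[x0 _]; rewrite inE/= in_itv/= andbT.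
rewrite inE/= in_itv/= andbT => x0.
have mK : measurable_fun [set: R] (fun t => K (x, t)).
  exact: (measurableT_comp measurable_K (pair1_measurable x)).
rewrite (@ge0_integral_affine _ _ 1 x ltr01); last 2 first.
- by apply/measurable_EFinP; exact: mK.
- by move=> t; rewrite lee_fin.
rewrite mul1e GammaE// [in RHS]integral_mkcond -ge0_integralZl//=; last 3 first.
- apply/measurable_restrict => //=; rewrite setTI; apply: measurable_funTS.
  apply/measurable_EFinP; apply: measurable_funM; first exact: measurable_powR.
  by apply: measurableT_comp; [exact: measurable_expR|exact: measurable_funN].
- by move=> t _; apply: erestrict_ge0 => u _; rewrite lee_fin mulr_ge0 ?powR_ge0 ?expR_ge0.
- by rewrite lee_fin mulr_ge0 ?powR_ge0 ?expR_ge0.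
apply: eq_integral => t _; rewrite patchE mul1r /K/= x0 ltrDr/=.
have [t0|t0] := ltP 0 t; last first.
  rewrite ifF ?mule0//; apply/negbTE; rewrite notin_setE/= in_itv/= andbT.
  by apply/negP; rewrite -leNgt.
rewrite ifT ?inE/= ?in_itv/= ?t0// -EFinM /betaf addrK subr0 opprD expRD.
by congr EFin; ring.
Qed.

Let int_K2 t : (\int[mu]_x (K (x, t))%:E =
  ((fun x => (x `^ (al + be - 1) * expR (- x))%:E) \_ `]0%R, +oo[) t * J)%E.
Proof.
rewrite patchE; case: ifPn => [|t0]; last first.
  rewrite mul0e integral0_eq// => x _; rewrite /K/= ifF//.
  by apply/negbTE; apply: contra t0 => /andP[x0 xt];
    rewrite inE/= in_itv/= andbT (lt_trans x0).
rewrite inE/= in_itv/= andbT => t0.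
rewrite mulrC EFinM -muleA -[X in X `^ _]subr0 -beta_scale//.
rewrite integral_itv_bndoo; last first.
  by apply/measurable_EFinP; apply: measurable_funTS; exact: measurable_betaf.
rewrite [in RHS]integral_mkcond -ge0_integralZl//=; last 2 first.
- apply/measurable_restrict => //=; rewrite setTI; apply: measurable_funTS.
  by apply/measurable_EFinP; exact: measurable_betaf.
- by move=> x _; apply: erestrict_ge0 => u _; rewrite lee_fin; exact: betaf_ge0.
apply: eq_integral => x _; rewrite patchE /K/=.
have -> : (x \in `]0, t[%classic) = (0 < x) && (x < t).
  by apply/idP/idP; rewrite inE/= in_itv.
by case: ifPn; rewrite ?mule0.
Qed.

Let Gamma_mul_J : ((Gamma be)%:E * (Gamma al)%:E = (Gamma (al + be))%:E * J)%E.
Proof.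
have abe0 : 0 < al + be by rewrite addr_gt0.
have mEK : measurable_fun setT (EFin \o K).
  by apply/measurable_EFinP; exact: measurable_K.
have J0 : (0 <= J)%E by apply: integral_ge0 => x _; rewrite lee_fin.
have mg z : measurable_fun [set: R]
    ((fun x => (x `^ (z - 1) * expR (- x))%:E) \_ `]0%R, +oo[)%E.
  apply/measurable_restrict => //=; rewrite setTI; apply: measurable_funTS.
  apply/measurable_EFinP; apply: measurable_funM; first exact: measurable_powR.
  by apply: measurableT_comp; [exact: measurable_expR|exact: measurable_funN].
have g0 z x : (0 <= ((fun x => (x `^ (z - 1) * expR (- x))%:E) \_ `]0%R, +oo[) x)%E.
  by apply: erestrict_ge0 => u _; rewrite lee_fin mulr_ge0 ?powR_ge0 ?expR_ge0.
have E1 : (\int[mu]_x \int[mu]_t (K (x, t))%:E = \int[mu]_x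
    (((fun x => (x `^ (be - 1) * expR (- x))%:E) \_ `]0%R, +oo[) x * (Gamma al)%:E))%E.
  by apply: eq_integral => x _; exact: int_K1.
have E2 : (\int[mu]_t \int[mu]_x (K (x, t))%:E = \int[mu]_t
    (((fun x => (x `^ (al + be - 1) * expR (- x))%:E) \_ `]0%R, +oo[) t * J))%E.
  by apply: eq_integral => t _; exact: int_K2.
have E : (\int[mu]_x \int[mu]_t (K (x, t))%:E = \int[mu]_t \int[mu]_x (K (x, t))%:E)%E.
  exact: (@fubini_tonelli _ _ _ _ R mu mu (EFin \o K) mEK K_ge0).
move: E; rewrite [LHS]E1 [RHS]E2 => {E1 E2}.
rewrite ge0_integralZr//=; last by rewrite lee_fin ltW// Gamma_gt0.
rewrite ge0_integralZr//=; last exact: mg.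
  by rewrite -!integral_mkcond -(GammaE be0) -(GammaE abe0).
exact: mg.
Qed.

(** The affine substitution that sends [0, 1] to [r, t] produces the power of
    [t - r] and reduces the integral to a constant [J]. The constant comes from
    Tonelli's theorem for [expR (- t) * (t - x) `^ (al - 1) * x `^ (be - 1)]
    on [0 < x < t]: integration in [t] first gives
    [Gamma al * Gamma be], integration in [x] first gives
    [J * Gamma (al + be)]. *)
Lemma beta_integral r t : r < t ->
  (\int[mu]_(s in `[r, t]) ((t - s) `^ (al - 1) * (s - r) `^ (be - 1))%:E =
   (Gamma al * Gamma be / Gamma (al + be) * (t - r) `^ (al + be - 1))%:E)%E.
Proof.
move=> rt; rewrite beta_scale// muleC EFinM; congr (_ * _)%E.
have g0 : 0 < Gamma (al + be) by rewrite Gamma_gt0// addr_gt0.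
have J0 : (0 <= J)%E by apply: integral_ge0 => x _; rewrite lee_fin.
move: J0 Gamma_mul_J; case: J => [j _|_|//].
  move=> [E]; congr EFin.
  by rewrite [Gamma al * _]mulrC E [_ * j]mulrC mulfK// lt0r_neq0.
by rewrite (gt0_muley (x := (Gamma (al + be))%:E)) ?lte_fin.
Qed.

End BetaIntegral.

(** The Beta integral with second parameter [1], computed directly. *)
Lemma GammaS (R : realType) (z : R) : 0 < z -> Gamma (z + 1) = z * Gamma z.
Proof.
move=> z0; have := beta_integral z0 (@ltr01 R) (@ltr01 R).
have -> : (\int[lebesgue_measure]_(s in `[0%R, 1%R])
    ((1 - s) `^ (z - 1) * (s - 0) `^ (1 - 1))%:E =
    \int[lebesgue_measure]_(s in `[0%R, 1%R]) ((1 - s) `^ (z - 1))%:E)%E.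
  by apply: eq_integral => s _; rewrite subrr powRr0 mulr1.
rewrite FracD.int_powr// subr0 !powR1 Gamma1 !mulr1 mul1r => -[E].
have g0 : Gamma (z + 1) != 0 by rewrite gt_eqF// Gamma_gt0// addr_gt0.
by rewrite -[Gamma z](divfK g0) -E mulrA mulfV ?mul1r// gt_eqF.
Qed.

(** * Riemann-Liouville integrals *)

Section RiemannLiouville.
Variables (R : realType) (a : R).
Local Notation mu := (@lebesgue_measure R).
Implicit Types (al be s t K : R) (u v h : R -> R).

Definition rlkern al t s : R := (t - s) `^ (al - 1).

Lemma measurable_rlkern al t : measurable_fun setT (rlkern al t).
Proof. by apply: (measurableT_comp (measurable_powR _)); exact: measurable_funB. Qed.

Lemma rlkern_ge0 al t s : 0 <= rlkern al t s. Proof. exact: powR_ge0. Qed.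

Lemma int_rlkern al t : 0 < al -> a <= t ->
  (\int[mu]_(s in `[a, t]) (rlkern al t s)%:E = ((t - a) `^ al / al)%:E)%E.
Proof.
move=> al0; rewrite le_eqVlt => /predU1P[->|]; last exact: FracD.int_powr.
by rewrite set_itv1 integral_set1 subrr powR0 ?mul0r// gt_eqF.
Qed.

Lemma integrable_rlkern al t : 0 < al -> mu.-integrable `[a, t] (EFin \o rlkern al t).
Proof.
move=> al0; have [at_|ta] := leP a t; last first.
  by rewrite set_itv_ge ?bnd_simp -?ltNge//; exact: integrable_set0.
apply/integrableP; split.
  by apply/measurable_EFinP; apply: measurable_funTS; exact: measurable_rlkern.
under eq_integral do rewrite /= ger0_norm ?rlkern_ge0//.
by rewrite int_rlkern// ltry.
Qed.

Lemma integrableZ_real (D : set R) (c : R) (v : R -> R) : measurable D ->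
  mu.-integrable D (EFin \o v) -> mu.-integrable D (EFin \o (fun s => c * v s)).
Proof. by move=> mD iv; have := @integrableZl _ _ _ mu D mD c _ iv; apply: eq_integrable. Qed.

Lemma integrableB_real (D : set R) (u v : R -> R) : measurable D ->
  mu.-integrable D (EFin \o u) -> mu.-integrable D (EFin \o v) ->
  mu.-integrable D (EFin \o (fun s => u s - v s)).
Proof.
by move=> mD iu iv; have := @integrableB _ _ _ mu D mD _ _ iu iv; apply: eq_integrable.
Qed.

Lemma RLint_exists_bounded al v t K : 0 < al -> measurable_fun setT v ->
  (forall s, s \in `[a, t] -> `|v s| <= K) -> RLint_exists a al v t.
Proof.
move=> al0 mv vK; rewrite /RLint_exists.
apply: (@le_integrable _ _ _ mu `[a, t] _ _ (fun s => (K%:E * (EFin \o rlkern al t) s)%E)) => //.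
- apply/measurable_EFinP; apply: measurable_funM; apply: measurable_funTS => //.
  exact: measurable_rlkern.
- move=> s sat; rewrite /= lee_fin /RLkernel -/(rlkern al t s) !normrM mulrC (ger0_norm (rlkern_ge0 _ _ _)).
  rewrite ler_wpM2r ?rlkern_ge0//; apply: le_trans (ler_norm _); exact: vK.
- by apply: integrableZl => //; exact: integrable_rlkern.
Qed.

Lemma RLint_exists_continuous al h t : 0 < al -> continuous h -> RLint_exists a al h t.
Proof.
move=> al0 ch; have [at_|ta] := leP a t; last first.
  rewrite /RLint_exists set_itv_ge ?bnd_simp -?ltNge//; exact: integrable_set0.
have [|c cat H] := @EVT_max R (fun s => `|h s|) a t at_.
  by apply: continuous_subspaceT => s; apply: cvg_norm; exact: ch.
apply: (@RLint_exists_bounded al h t `|h c|) => //.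
exact: continuous_measurable_fun.
Qed.

Lemma RLint_norm al v t K : 0 < al -> a <= t -> RLint_exists a al v t ->
  (forall s, s \in `[a, t] -> `|v s| <= K) ->
  `|RLint a al v t| <= K * npow (t - a) al.
Proof.
move=> al0 at_ ev vK; have G0 := Gamma_gt0 al0.
rewrite /RLint normrM gtr0_norm ?invr_gt0//.
have -> : K * npow (t - a) al = (Gamma al)^-1 * (K * ((t - a) `^ al / al)).
  by rewrite /npow GammaS// invfM; ring.
rewrite ler_pM2l ?invr_gt0//; apply: le_trans (le_normr_Rintegral _ ev) _ => //.
have -> : (t - a) `^ al / al = \int[mu]_(s in `[a, t]) rlkern al t s.
  by rewrite /Rintegral int_rlkern.
rewrite -RintegralZl//; last exact: integrable_rlkern.
apply: le_Rintegral => //.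
- exact: integrable_norm.
- by apply: integrableZ_real => //; exact: integrable_rlkern.
- move=> s sat; rewrite /RLkernel normrM ger0_norm ?powR_ge0// mulrC ler_wpM2r ?powR_ge0//.
  exact: vK.
Qed.

Lemma RLint_exists_lin al u v t (c : R) : RLint_exists a al u t ->
  RLint_exists a al v t -> RLint_exists a al (fun s => u s + c * v s) t.
Proof.
move=> eu ev; have := integrableD _ eu (integrableZl _ c ev).
move=> /(_ (measurable_itv _) (measurable_itv _)); apply: eq_integrable => // s _.
by rewrite /= /RLkernel -EFinM -EFinD; congr EFin; ring.
Qed.

Lemma RLint_lin al u v t (c : R) : RLint_exists a al u t ->
  RLint_exists a al v t ->
  RLint a al (fun s => u s + c * v s) t = RLint a al u t + c * RLint a al v t.
Proof.
move=> eu ev; rewrite /RLint mulrCA -mulrDr; congr (_ * _).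
rewrite -RintegralZl// -RintegralD//; last exact: integrableZ_real.
by apply: eq_Rintegral => s _; rewrite /RLkernel; ring.
Qed.

Lemma eq_RLint al u v t : (forall s, s \in `[a, t] -> u s = v s) ->
  RLint a al u t = RLint a al v t.
Proof.
move=> uv; rewrite /RLint; congr (_ * _); apply: eq_Rintegral => s.
by rewrite inE/= /RLkernel => /uv ->.
Qed.

Lemma eq_RLint_exists al u v t : (forall s, s \in `[a, t] -> u s = v s) ->
  RLint_exists a al u t -> RLint_exists a al v t.
Proof.
by move=> uv; apply: eq_integrable => // s; rewrite inE/= /RLkernel => /uv ->.
Qed.

Lemma RLint_base al v : RLint a al v a = 0.
Proof. by rewrite /RLint set_itv1 Rintegral_set1 mulr0. Qed.

End RiemannLiouville.

Section RiemannLiouvilleHoelder.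
Variables (R : realType) (a : R).
Local Notation mu := (@lebesgue_measure R).
Implicit Types (al be s t K : R) (u v h : R -> R).

Let Rint_rlkern al t : 0 < al -> a <= t ->
  \int[mu]_(r in `[a, t]) rlkern al t r = (t - a) `^ al / al.
Proof. by move=> al0 at_; rewrite /Rintegral int_rlkern. Qed.

Let rlkern_mono al s t r : al < 1 -> r < s -> s <= t -> rlkern al t r <= rlkern al s r.
Proof.
move=> al1 rs st; rewrite /rlkern; have -> : al - 1 = - (1 - al) by rewrite opprB.
rewrite !powRN.
rewrite lef_pV2 ?posrE ?powR_gt0 ?subr_gt0//; last exact: lt_le_trans st.
by apply: ge0_ler_powR; rewrite ?nnegrE; lra.
Qed.

(** For [al < 1] the kernel decreases in [t], so that both the increment of the
    kernel on [a, s] and the new piece on [s, t] have mass at most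
    [(t - s) `^ al / al]. The resulting modulus depends on [h] through its bound
    only, which is what equicontinuity needs. *)
Lemma RLint_hoelder al h s t K : 0 < al < 1 -> a <= s -> s <= t -> continuous h ->
  (forall r, r \in `[a, t] -> `|h r| <= K) ->
  `|RLint a al h t - RLint a al h s| <= 2 * K * npow (t - s) al.
Proof.
move=> /andP[al0 al1] as_ st ch hK; have at_ := le_trans as_ st.
have K0 : 0 <= K by apply: le_trans (hK a _) => //; rewrite in_itv/= lexx.
have G0 := Gamma_gt0 al0.
have et := RLint_exists_continuous a t al0 ch.
have es := RLint_exists_continuous a s al0 ch.
have sub_st : [set` `]s, t]] `<=` [set` `[a, t]].
  by move=> x/=; rewrite !in_itv/= => /andP[sx ->]; rewrite (le_trans as_)// ltW.
have sub_as : [set` `[a, s[] `<=` [set` `[a, t]].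
  by move=> x/=; rewrite !in_itv/= => /andP[-> xs]; rewrite (le_trans (ltW xs)).
have sub_as' : [set` `[a, s[] `<=` [set` `[a, s]].
  by move=> x/=; rewrite !in_itv/= => /andP[-> xs]; rewrite ltW.
have intS (D E : set R) (f : R -> R) : measurable D -> measurable E -> D `<=` E ->
    mu.-integrable E (EFin \o f) -> mu.-integrable D (EFin \o f).
  by move=> mD mE DE; apply: integrableS.
have split_t (f : R -> R) : mu.-integrable `[a, t] (EFin \o f) ->
    \int[mu]_(r in `[a, t]) f r =
    \int[mu]_(r in `[a, s[) f r + \int[mu]_(r in `]s, t]) f r.
  move=> itf; rewrite -(@Rintegral_itvB _ f (BLeft a) (BRight t) s) ?bnd_simp//.
  rewrite Rintegral_itv_bndo_bndc; last exact: intS itf.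
  by rewrite addrC subrK.
have Rbo (f : R -> R) : mu.-integrable `[a, s] (EFin \o f) ->
    \int[mu]_(r in `[a, s]) f r = \int[mu]_(r in `[a, s[) f r.
  by move=> itf; rewrite Rintegral_itv_bndo_bndc//; exact: intS itf.
have ikt := integrable_rlkern a t al0; have iks := integrable_rlkern a s al0.
have E1 : \int[mu]_(r in `]s, t]) rlkern al t r = (t - s) `^ al / al.
  rewrite Rintegral_itv_obnd_cbnd; last exact: intS ikt.
  by rewrite /Rintegral int_rlkern.
have Ediff : \int[mu]_(r in `[a, s[) (rlkern al s r - rlkern al t r) <= (t - s) `^ al / al.
  rewrite RintegralB//; [|exact: intS iks|exact: intS ikt].
  rewrite -Rbo// Rint_rlkern//.
  have := split_t _ ikt; rewrite E1 Rint_rlkern// => H.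
  have : (s - a) `^ al / al <= (t - a) `^ al / al.
    rewrite ler_pM2r ?invr_gt0//; apply: ge0_ler_powR; rewrite ?nnegrE; lra.
  by lra.
rewrite /RLint -mulrBr normrM gtr0_norm ?invr_gt0//.
have -> : 2 * K * npow (t - s) al = (Gamma al)^-1 * (2 * (K * ((t - s) `^ al / al))).
  by rewrite /npow GammaS// invfM; ring.
rewrite ler_pM2l ?invr_gt0// (split_t _ et) (Rbo _ es) addrAC.
have it' : mu.-integrable `[a, s[ (EFin \o RLkernel al h t) by exact: intS et.
have is' : mu.-integrable `[a, s[ (EFin \o RLkernel al h s) by exact: intS es.
rewrite -RintegralB//.
apply: le_trans (ler_normD _ _) _; rewrite [leRHS]mulrDl mul1r lerD//.
  have -> : (fun r => RLkernel al h t r - RLkernel al h s r) =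
            (fun r => (rlkern al t r - rlkern al s r) * h r).
    by apply/funext => r; rewrite /RLkernel /rlkern; ring.
  have id : mu.-integrable `[a, s[ (EFin \o (fun r => (rlkern al t r - rlkern al s r) * h r)).
    have := integrableB_real (measurable_itv _) it' is'.
    by apply: eq_integrable => // r _ /=; congr EFin; rewrite /RLkernel /rlkern; ring.
  apply: le_trans (le_normr_Rintegral _ id) _ => //.
  have ikd : mu.-integrable `[a, s[ (EFin \o (fun r => rlkern al s r - rlkern al t r)).
    by apply: integrableB_real; [|exact: intS iks|exact: intS ikt].
  apply: (@le_trans _ _ (K * \int[mu]_(r in `[a, s[) (rlkern al s r - rlkern al t r))); last first.
    by rewrite ler_wpM2l.
  rewrite -RintegralZl//; apply: le_Rintegral => //.
  - exact: integrable_norm.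
  - exact: integrableZ_real.
  - move=> r; rewrite /= in_itv/= => /andP[ar rs].
    have d0 : 0 <= rlkern al s r - rlkern al t r by rewrite subr_ge0 rlkern_mono.
    rewrite normrM distrC (ger0_norm d0) mulrC ler_wpM2r//.
    by apply: hK; rewrite in_itv/= ar (le_trans (ltW rs)).
have ist : mu.-integrable `]s, t] (EFin \o RLkernel al h t) by exact: intS et.
apply: le_trans (le_normr_Rintegral _ ist) _ => //.
rewrite -E1 -RintegralZl//; last exact: intS ikt.
apply: le_Rintegral => //.
- exact: integrable_norm.
- by apply: integrableZ_real => //; exact: intS ikt.
- move=> r rst; rewrite /RLkernel normrM ger0_norm ?powR_ge0// mulrC ler_wpM2r ?powR_ge0//.
  by apply: hK; exact: sub_st.
Qed.

End RiemannLiouvilleHoelder.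

Section RiemannLiouvilleSemigroup.
Variables (R : realType) (a : R).
Local Notation mu := (@lebesgue_measure R).
Implicit Types (al be s t K : R) (u v h : R -> R).

Lemma RLint_exists_pow al be t : 0 < al -> 0 < be -> a < t ->
  RLint_exists a al (fun s => (s - a) `^ (be - 1) / Gamma be) t.
Proof.
move=> al0 be0 at_; have mk (c d : R -> R) p q : measurable_fun setT c -> measurable_fun setT d ->
    measurable_fun setT (fun s : R => c s `^ p * d s `^ q).
  move=> mc md; apply: measurable_funM; exact: (measurableT_comp (measurable_powR _)).
have mf : measurable_fun setT (fun s : R => (t - s) `^ (al - 1) * (s - a) `^ (be - 1)).
  by apply: mk; exact: measurable_funB.
suff : mu.-integrable `[a, t] (EFin \o (fun s : R => (t - s) `^ (al - 1) * (s - a) `^ (be - 1))).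
  move=> /(integrableZ_real (Gamma be)^-1 (measurable_itv _)); apply: eq_integrable => // s _.
  by rewrite /= /RLkernel; congr EFin; rewrite mulrC mulrA.
apply/integrableP; split; first by apply/measurable_EFinP; exact: measurable_funTS.
under eq_integral do rewrite /= ger0_norm ?mulr_ge0 ?powR_ge0//.
by rewrite beta_integral// ltry.
Qed.

Lemma RLint_pow al be t : 0 < al -> 0 < be -> a < t ->
  RLint a al (fun s => (s - a) `^ (be - 1) / Gamma be) t =
  (t - a) `^ (al + be - 1) / Gamma (al + be).
Proof.
move=> al0 be0 at_; have := RLint_exists_pow al0 be0 at_.
have Gal := Gamma_gt0 al0; have Gbe := Gamma_gt0 be0.
have Gab : 0 < Gamma (al + be) by rewrite Gamma_gt0// addr_gt0.
rewrite /RLint /RLint_exists => ep.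
have -> : \int[mu]_(s in `[a, t]) RLkernel al (fun s => (s - a) `^ (be - 1) / Gamma be) t s =
   (Gamma be)^-1 * \int[mu]_(s in `[a, t]) ((t - s) `^ (al - 1) * (s - a) `^ (be - 1)).
  rewrite -RintegralZl//; first by apply: eq_Rintegral => s _; rewrite /RLkernel; ring.
  move: ep => /(integrableZ_real (Gamma be) (measurable_itv _)); apply: eq_integrable => // s _.
  by rewrite /= /RLkernel; congr EFin; field; rewrite gt_eqF.
rewrite /Rintegral beta_integral//=.
move: Gal Gbe Gab; move: (Gamma al) (Gamma be) (Gamma (al + be)) => x y z x0 y0 z0.
by field; rewrite !gt_eqF.
Qed.

Section Semigroup.
Variables (al be : R) (h : R -> R).
Hypotheses (al0 : 0 < al) (be0 : 0 < be) (ch : continuous h).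
Variable t : R.
Hypothesis at_ : a < t.

Let abe0 : 0 < al + be. Proof. exact: addr_gt0. Qed.

(* Fubini's theorem on the triangle [a <= r <= s < t]. The factor
   [(t - r) `^ (al + be - 1)], possibly singular at [t], is moved from the kernel
   [k] into [u]; by the Beta integral the mass of [k] in [s] is then the constant
   [C], whatever the orders. *)
Let D s r := ((a <= r) && (r <= s) && (s < t)).
Let k s r : R := if D s r
  then (t - s) `^ (al - 1) * (s - r) `^ (be - 1) / (t - r) `^ (al + be - 1) else 0.
Let C : R := Gamma al * Gamma be / Gamma (al + be).
Let c r : R := if (a <= r) && (r < t) then C else 0.
Let u r : R := if (a <= r) && (r < t) then (t - r) `^ (al + be - 1) * h r else 0.

Let k0 s r : 0 <= k s r.
Proof. by rewrite /k; case: ifP => // _; rewrite !mulr_ge0 ?invr_ge0 ?powR_ge0. Qed.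

Let mk : measurable_fun setT (fun z : R * R => k z.1 z.2).
Proof.
apply: measurable_fun_ifT => //.
  apply: measurable_and; first apply: measurable_and.
  - exact: measurable_fun_ler.
  - exact: measurable_fun_ler.
  - exact: measurable_fun_ltr.
apply: measurable_funM; first apply: measurable_funM.
- by apply: (measurableT_comp (measurable_powR _)); exact: measurable_funB.
- by apply: (measurableT_comp (measurable_powR _)); exact: measurable_funB.
- under eq_fun do rewrite -powRN.
  by apply: (measurableT_comp (measurable_powR _)); exact: measurable_funB.
Qed.

Let C0 : 0 <= C.
Proof. by rewrite !mulr_ge0 ?invr_ge0// ltW// Gamma_gt0. Qed.

Let cC r : 0 <= c r <= C.
Proof. by rewrite /c; case: ifP => _; rewrite ?lexx C0. Qed.

Let kc r : (\int[mu]_s (k s r)%:E = (c r)%:E)%E.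
Proof.
rewrite /c; case: ifPn => [/andP[ar rt]|h0]; last first.
  apply: integral0_eq => s _; rewrite /k ifF//; apply/negbTE; apply: contra h0.
  by rewrite /D => /andP[/andP[-> rs] st]; rewrite (le_lt_trans rs).
have tr0 : 0 < t - r by rewrite subr_gt0.
have mf : measurable_fun setT (fun s : R => (t - s) `^ (al - 1) * (s - r) `^ (be - 1)).
  apply: measurable_funM; apply: (measurableT_comp (measurable_powR _)); exact: measurable_funB.
transitivity ((((t - r) `^ (al + be - 1))^-1)%:E *
   \int[mu]_(s in `[r, t[) ((t - s) `^ (al - 1) * (s - r) `^ (be - 1))%:E)%E.
  rewrite [in RHS]integral_mkcond -ge0_integralZl//=; last 3 first.
  - apply/measurable_restrict => //=; rewrite setTI; apply: measurable_funTS.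
    exact/measurable_EFinP.
  - by move=> s _; apply: erestrict_ge0 => x _; rewrite lee_fin mulr_ge0 ?powR_ge0.
  - by rewrite lee_fin invr_ge0 powR_ge0.
  apply: eq_integral => s _; rewrite patchE /k /D ar/=.
  have -> : (s \in `[r, t[%classic) = (r <= s) && (s < t).
    by apply/idP/idP; rewrite inE/= in_itv.
  by case: ifP => _; rewrite ?mule0// -EFinM mulrC.
rewrite integral_itv_bndo_bndc; last by apply/measurable_EFinP; exact: measurable_funTS.
rewrite beta_integral// -EFinM; congr EFin.
by rewrite -/C mulrCA mulVf ?mulr1// gt_eqF// powR_gt0.
Qed.

Let iu : mu.-integrable setT (EFin \o u).
Proof.
have e := RLint_exists_continuous a t abe0 ch.
suff : mu.-integrable setT (EFin \o (RLkernel (al + be) h t \_ `[a, t[)).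
  apply: eq_integrable => // r _ /=; congr EFin; rewrite patchE /u /RLkernel.
  have -> : (r \in `[a, t[%classic) = (a <= r) && (r < t).
    by apply/idP/idP; rewrite inE/= in_itv.
  by [].
rewrite -restrict_EFin; apply/integrable_restrict => //=; rewrite setTI.
by apply: integrableS e => // x /=; rewrite !in_itv/= => /andP[-> /ltW].
Qed.

Let inner s : (\int[mu]_r (k s r * u r)%:E =
  ((fun s => Gamma be * RLkernel al (RLint a be h) t s) \_ `[a, t[ s)%:E)%E.
Proof.
rewrite patchE; case: ifPn => [|h0]; last first.
  apply: integral0_eq => r _; rewrite /k /D; case: ifPn => [h2|]; last by rewrite mul0r.
  exfalso; move/negP : h0; apply; rewrite inE/= in_itv/=.
  by move: h2 => /andP[/andP[ar rs] ->]; rewrite (le_trans ar).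
rewrite inE/= in_itv/= => /andP[as_ st].
have es := RLint_exists_continuous a s be0 ch.
have G0 := Gamma_gt0 be0.
rewrite /RLkernel /RLint -/(RLkernel be h s).
have -> : Gamma be * ((t - s) `^ (al - 1) * ((Gamma be)^-1 * \int[mu]_(r in `[a, s]) RLkernel be h s r))
    = (t - s) `^ (al - 1) * \int[mu]_(r in `[a, s]) RLkernel be h s r.
  by field; rewrite gt_eqF.
rewrite EFinM /Rintegral fineK; last exact: integrable_fin_num.
rewrite -integralZl// integral_mkcond [RHS]integral_mkcond; apply: eq_integral => r _.
rewrite !patchE in_setT /k /u /D st andbT.
have -> : (r \in `[a, s]%classic) = (a <= r) && (r <= s).
  by apply/idP/idP; rewrite inE/= in_itv.
case: ifPn => [/andP[ar rs]|_]; last by rewrite mul0r.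
have rt := le_lt_trans rs st; rewrite ar rt /= -EFinM /RLkernel; congr EFin.
by field; rewrite gt_eqF// powR_gt0// subr_gt0.
Qed.

Let int_co (f : R -> R) : mu.-integrable `[a, t[ (EFin \o f) ->
  mu.-integrable `[a, t] (EFin \o f).
Proof.
move=> /integrableP[mf foo].
have mf' : measurable_fun `[a, t] (EFin \o f).
  rewrite (_ : `[a, t]%classic = `[a, t[%classic `|` [set t]); last first.
    by rewrite setUitv1// bnd_simp ltW.
  by apply/measurable_funU => //; split => //; exact: measurable_fun_set1.
apply/integrableP; split => //; rewrite -integral_itv_bndo_bndc//.
exact: measurableT_comp.
Qed.

Lemma RLint_exists_comp_gt : RLint_exists a al (RLint a be h) t.
Proof.
apply: int_co; have G0 := Gamma_gt0 be0.
suff : mu.-integrable `[a, t[ (EFin \o (fun s => Gamma be * RLkernel al (RLint a be h) t s)).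
  move=> /(integrableZ_real (Gamma be)^-1 (measurable_itv _)); apply: eq_integrable => // s _ /=.
  by rewrite mulrA mulVf ?mul1r// gt_eqF.
suff : mu.-integrable setT (EFin \o ((fun s => Gamma be * RLkernel al (RLint a be h) t s) \_ `[a, t[)).
  by rewrite -restrict_EFin => /integrable_restrict; rewrite setTI; apply.
have := FracD.fub_itg k0 mk kc cC iu.
by apply: eq_integrable => // s _; rewrite inner.
Qed.

Lemma RLint_semigroup_gt : RLint a al (RLint a be h) t = RLint a (al + be) h t.
Proof.
have G1 := Gamma_gt0 al0; have G2 := Gamma_gt0 be0; have G3 := Gamma_gt0 abe0.
have E := FracD.fub_eq k0 mk kc cC iu.
have e1 := RLint_exists_comp_gt.
have e2 := RLint_exists_continuous a t abe0 ch.
have co : [set` `[a, t[] `<=` [set` `[a, t]].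
  by move=> x/=; rewrite !in_itv/= => /andP[-> /ltW].
have E1 : (\int[mu]_s \int[mu]_r (k s r * u r)%:E =
    (Gamma be * \int[mu]_(s in `[a, t]) RLkernel al (RLint a be h) t s)%:E)%E.
  rewrite -RintegralZl//.
  rewrite -Rintegral_itv_bndo_bndc; last first.
    by apply: integrableZ_real => //; apply: integrableS e1.
  rewrite /Rintegral fineK; last first.
    by apply: integrable_fin_num => //; apply: integrableZ_real => //; apply: integrableS e1.
  rewrite [RHS]integral_mkcond; apply: eq_integral => s _.
  by rewrite inner !patchE; case: ifP.
have E2 : (\int[mu]_r (c r * u r)%:E =
    (C * \int[mu]_(s in `[a, t]) RLkernel (al + be) h t s)%:E)%E.
  rewrite -RintegralZl//.
  rewrite -Rintegral_itv_bndo_bndc; last first.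
    by apply: integrableZ_real => //; apply: integrableS e2.
  rewrite /Rintegral fineK; last first.
    by apply: integrable_fin_num => //; apply: integrableZ_real => //; apply: integrableS e2.
  rewrite [RHS]integral_mkcond; apply: eq_integral => s _.
  rewrite patchE /c /u.
  have -> : (s \in `[a, t[%classic) = (a <= s) && (s < t).
    by apply/idP/idP; rewrite inE/= in_itv.
  by case: ifP; rewrite ?mul0r.
move: E; rewrite [LHS]E1 [RHS]E2 => -[E]; clear e1 e2 E1 E2.
rewrite /RLint; move: E; rewrite /C; move: G1 G2 G3 (\int[mu]_(s in _) _) (\int[mu]_(s in _) _).
move: (Gamma al) (Gamma be) (Gamma (al + be)) => x y z x0 y0 z0 p q E.
apply: (mulfI (lt0r_neq0 y0)); rewrite mulrCA E; field.
by rewrite !gt_eqF.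
Qed.

End Semigroup.

Lemma RLint_exists_comp al be h t : 0 < al -> 0 < be -> continuous h -> a <= t ->
  RLint_exists a al (RLint a be h) t.
Proof.
move=> al0 be0 ch; rewrite le_eqVlt => /predU1P[<-|]; last exact: RLint_exists_comp_gt.
apply: (@eq_RLint_exists R a al (fun=> 0)).
  by move=> s; rewrite in_itv/= -eq_le => /eqP <-; rewrite RLint_base.
by apply: RLint_exists_continuous => //; exact: cst_continuous.
Qed.

Lemma RLint_semigroup al be h t : 0 < al -> 0 < be -> continuous h -> a <= t ->
  RLint a al (RLint a be h) t = RLint a (al + be) h t.
Proof.
move=> al0 be0 ch; rewrite le_eqVlt => /predU1P[<-|]; last exact: RLint_semigroup_gt.
by rewrite !RLint_base.
Qed.

End RiemannLiouvilleSemigroup.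

(** * Continuity of fractional integrals and Hilfer derivatives *)

Section RiemannLiouvilleContinuity.
Variables (R : realType) (a : R).
Local Notation mu := (@lebesgue_measure R).
Implicit Types (al be s t K : R) (u v h : R -> R).

Lemma RLint_max al v t : RLint a al v t = RLint a al v (Num.max a t).
Proof.
have [at_//|ta] := leP a t.
by rewrite RLint_base /RLint set_itv_ge ?bnd_simp -?ltNge// Rintegral_set0 mulr0.
Qed.

Lemma npow_ge0 (c r : R) : 0 < r -> 0 <= npow c r.
Proof. by move=> r0; rewrite divr_ge0 ?powR_ge0// ltW// Gamma_gt0// addr_gt0. Qed.

Lemma npow_le (c d r : R) : 0 < r -> 0 <= c <= d -> npow c r <= npow d r.
Proof.
move=> r0 /andP[c0 cd]; rewrite ler_pM2r ?invr_gt0 ?Gamma_gt0 ?addr_gt0//.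
by apply: ge0_ler_powR; rewrite ?nnegrE ?(ltW r0)// (le_trans c0).
Qed.

Lemma npow_small (r C e : R) : 0 < r -> 0 <= C -> 0 < e ->
  exists2 d, 0 < d & C * npow d r <= e.
Proof.
move=> r0 C0 e0; have G0 : 0 < Gamma (r + 1) by rewrite Gamma_gt0// addr_gt0.
have C1 : 0 < C + 1 by rewrite ltr_wpDl.
pose x := e * Gamma (r + 1) / (C + 1).
have x0 : 0 < x by rewrite divr_gt0// mulr_gt0.
exists (x `^ r^-1); first exact: powR_gt0.
rewrite /npow -powRrM mulVf ?gt_eqF// powRr1 ?(ltW x0)// /x.
have -> : C * (e * Gamma (r + 1) / (C + 1) / Gamma (r + 1)) = e * (C / (C + 1)).
  by move: (Gamma (r + 1)) G0 => G G0; field; rewrite !gt_eqF.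
by rewrite ler_piMr ?(ltW e0)// ler_pdivrMr// mul1r lerDl.
Qed.

Lemma RLint_hoelder_sym al h s t T K : 0 < al < 1 -> a <= T -> s <= T -> t <= T ->
  continuous h -> (forall r, r \in `[a, T] -> `|h r| <= K) ->
  `|RLint a al h s - RLint a al h t| <= 2 * K * npow `|s - t| al.
Proof.
move=> al01 aT sT tT ch hK; have /andP[al0 _] := al01.
have K0 : 0 <= K by apply: le_trans (hK a _) => //; rewrite in_itv/= lexx.
wlog st : s t sT tT / t <= s.
  have [?|/ltW ?] := leP t s => H; first exact: H.
  by rewrite distrC (distrC s); exact: H.
rewrite (RLint_max al h s) (RLint_max al h t).
have mst : Num.max a t <= Num.max a s by rewrite ge_max !le_max lexx st orbT.
apply: le_trans (RLint_hoelder (K := K) al01 _ mst ch _) _.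
- by rewrite le_max lexx.
- move=> r rs; apply: hK; move: rs; rewrite !in_itv/= => /andP[-> rs].
  by apply: le_trans rs _; rewrite ge_max aT.
- rewrite ler_wpM2l ?mulr_ge0// npow_le// subr_ge0 mst/=.
  by apply: le_trans (ler_norm _) _; exact: max_dist.
Qed.

Lemma continuous_bounded h T : continuous h -> a <= T ->
  exists K, forall r, r \in `[a, T] -> `|h r| <= K.
Proof.
move=> ch aT; have [|c cat H] := @EVT_max R (fun s => `|h s|) a T aT; last by exists `|h c|.
by apply: continuous_subspaceT => s; apply: cvg_norm; exact: ch.
Qed.

Lemma RLint_continuous al h : 0 < al < 1 -> continuous h -> continuous (RLint a al h).
Proof.
move=> al01 ch t; have /andP[al0 _] := al01.
pose T := Num.max a t + 1.
have aT : a <= T by rewrite ler_wpDr// le_max lexx.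
have [K hK] := continuous_bounded ch aT.
have K0 : 0 <= K by apply: le_trans (hK a _) => //; rewrite in_itv/= lexx.
apply/cvgrPdist_le => e e0.
have [|d d0 dP] := @npow_small al (2 * K) e al0 _ e0; first exact: mulr_ge0.
apply/nbhs_normP; exists (Num.min d 1); first by rewrite /= lt_min d0/=.
move=> s /=; rewrite lt_min => /andP[/ltW sd /ltW s1].
have tT : t <= T by rewrite ler_wpDr// le_max lexx orbT.
have sT : s <= T.
  move: s1; rewrite ler_norml => /andP[s1 _]; rewrite /T.
  have : t <= Num.max a t by rewrite le_max lexx orbT.
  by lra.
apply: le_trans (RLint_hoelder_sym al01 aT tT sT ch hK) _.
apply: le_trans dP; rewrite ler_wpM2l ?mulr_ge0// npow_le//.
by rewrite normr_ge0.
Qed.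

(** Integrals ignore the point [a], where a fractional integral vanishes even if
    its limit from the right does not. *)
Lemma RLint_oc al u v t : RLint_exists a al v t ->
  (forall s, s \in `]a, t] -> u s = v s) ->
  RLint_exists a al u t /\ RLint a al u t = RLint a al v t.
Proof.
move=> ev uv; have [ta|at_] := leP t a.
  have -> : RLint a al u t = RLint a al v t.
    by rewrite RLint_max [RHS]RLint_max (max_idPl ta) !RLint_base.
  split => //; move: ta; rewrite le_eqVlt => /predU1P[->|ta]; last first.
    by rewrite /RLint_exists set_itv_ge ?bnd_simp -?ltNge//; exact: integrable_set0.
  rewrite /RLint_exists set_itv1; apply/integrableP; split; first exact: measurable_fun_set1.
  by rewrite integral_set1.
have uv' s : s \in `]a, t]%classic -> RLkernel al u t s = RLkernel al v t s.
  by rewrite inE/= /RLkernel => /uv ->.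
have /integrableP[mv voo] := ev.
have mv' : measurable_fun `]a, t] (EFin \o RLkernel al v t).
  by apply: measurable_funS mv => // s/=; rewrite !in_itv/= => /andP[/ltW -> ->].
have mu' : measurable_fun `]a, t] (EFin \o RLkernel al u t).
  by apply: eq_measurable_fun mv' => s sat /=; rewrite uv'.
have mu1 : measurable_fun `[a, t] (EFin \o RLkernel al u t).
  rewrite (_ : `[a, t]%classic = [set a] `|` `]a, t]%classic); last first.
    by rewrite setU1itv// bnd_simp ltW.
  by apply/measurable_funU => //; split => //; exact: measurable_fun_set1.
split.
  apply/integrableP; split => //; rewrite -integral_itv_obnd_cbnd; last exact: measurableT_comp.
  rewrite -integral_itv_obnd_cbnd in voo; last exact: measurableT_comp.
  apply: le_lt_trans voo; rewrite le_eqVlt; apply/orP; left; apply/eqP.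
  by apply: eq_integral => s sat /=; rewrite uv'.
rewrite /RLint /Rintegral; congr (_ * fine _).
rewrite -integral_itv_obnd_cbnd// -[RHS]integral_itv_obnd_cbnd//.
by apply: eq_integral => s sat; rewrite uv'.
Qed.

Lemma RLint1 v t : RLint a 1 v t = \int[mu]_(s in `[a, t]) v s.
Proof.
rewrite /RLint Gamma1 invr1 mul1r; apply: eq_Rintegral => s _.
by rewrite /RLkernel subrr powRr0 mul1r.
Qed.

Lemma RLint1_exists v t : RLint_exists a 1 v t -> mu.-integrable `[a, t] (EFin \o v).
Proof.
by apply: eq_integrable => // s _; rewrite /= /RLkernel subrr powRr0 mul1r.
Qed.

(** The fundamental theorem of calculus at a point where [w] is continuous; [w]
    itself may be unbounded near [a]. *)
Lemma has_deriv_within_RLint1 b w F t : t \in `]a, b] ->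
  (forall s, a < s -> RLint_exists a 1 w s) -> {for t, continuous w} ->
  (forall s, s \in `]a, b] -> F s = RLint a 1 w s) ->
  has_deriv_within `]a, b] F t (w t).
Proof.
move=> tab ew cw FE; have /andP[at_ tb] : a < t <= b by move: tab; rewrite in_itv.
have iw : mu.-integrable `[a, b + 1] (EFin \o w).
  by apply: RLint1_exists; apply: ew; rewrite (lt_le_trans at_)// ler_wpDr.
have tb1 : t < b + 1 by rewrite (le_lt_trans tb)// ltrDl.
have [dF F't] := continuous_FTC1_closed tb1 iw at_ cw.
set J := (fun x => _) in dF F't.
have FJ x : x \in `]a, b] -> F x = J x by move=> xab; rewrite FE// RLint1.
have : h^-1 *: (J (h + t) - J t) @[h --> 0^'] --> w t.
  have -> : w t = 'D_1 J t by rewrite -derive1E F't.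
  rewrite (_ : (fun h : R => _) = (fun h : R => h^-1 *: (J (h *: (1 : R) + t) - J t))); last first.
    by apply/funext => h; rewrite [h *: 1]mulr1.
  exact: dF.
move/cvgrPdist_le => H; apply/cvgrPdist_le => e e0.
have [d /= d0 {}H] := H e e0.
exists d => // x /= xd xt xab.
have := H (x - t).
rewrite /= subrK sub0r normrN subr_eq0 distrC FJ// FJ// mulrC; exact.
Qed.

End RiemannLiouvilleContinuity.

Section HilferInverse.
Variables (R : realType) (a b : R).
Implicit Types (al be ka c t : R) (h g x : R -> R).

(** The powers satisfy [I^al (rlpow ka) = rlpow (al + ka)]; they span the
    kernels of the fractional derivatives. *)
Definition rlpow ka t : R := (t - a) `^ (ka - 1) / Gamma ka.

Lemma RLint_exists_rlpow al ka t : 0 < al -> 0 < ka -> a < t ->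
  RLint_exists a al (rlpow ka) t.
Proof. exact: RLint_exists_pow. Qed.

Lemma RLint_rlpow al ka t : 0 < al -> 0 < ka -> a < t ->
  RLint a al (rlpow ka) t = rlpow (al + ka) t.
Proof. exact: RLint_pow. Qed.

Lemma rlpow_continuous ka t : a < t -> {for t, continuous (rlpow ka)}.
Proof.
move=> at_; apply: cvgMr_tmp.
suff : {for t, continuous ((fun z : R => z `^ (ka - 1)) \o (fun x : R => x - a))} by [].
apply: continuous_comp.
  by apply: cvgB; [exact: cvg_id|exact: cvg_cst].
by apply: FracD.continuous_powR_gt0; rewrite subr_gt0.
Qed.

Let oc_gt t : t \in `]a, b] -> a < t. Proof. by rewrite in_itv/= => /andP[]. Qed.

(** The Hilfer derivative inverts [I^al] and annihilates [rlpow ga] for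
    [ga = al + be - al * be]: as [s1 + ga = 1], the inner integral of order
    [s1 = (1 - be) (1 - al)] sends [rlpow ga] to the constant [1], which is then
    the limit subtracted at [a]. *)
Lemma is_Hilfer_integral_kernel al be h c : 0 < al < 1 -> 0 < be < 1 -> continuous h ->
  is_Hilfer a b al be
    (fun t => RLint a al h t + c * rlpow (al + be - al * be) t) h.
Proof.
move=> al01 be01 ch; have /andP[al0 al1] := al01; have /andP[be0 be1] := be01.
set s1 := (1 - be) * (1 - al); set s2 := be * (1 - al); set ga := al + be - al * be.
have s10 : 0 < s1 by rewrite mulr_gt0 ?subr_gt0.
have s20 : 0 < s2 by rewrite mulr_gt0 ?subr_gt0.
have s12 : s2 + (s1 + al) = 1 by rewrite /s1 /s2; ring.
have s1g : s1 + ga = 1 by rewrite /s1 /ga; ring.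
have ga0 : 0 < ga.
  have -> : ga = al + s2 by rewrite /ga /s2; ring.
  exact: addr_gt0.
have s1al : 0 < s1 + al < 1 by apply/andP; split; [exact: addr_gt0|lra].
have e1 t : a < t -> RLint_exists a s1 (RLint a al h) t.
  by move=> at_; apply: RLint_exists_comp => //; exact: ltW.
have e2 t : a < t -> RLint_exists a s1 (rlpow ga) t by exact: RLint_exists_rlpow.
have VE t : a < t -> RLint a s1 (fun t => RLint a al h t + c * rlpow ga t) t =
    RLint a (s1 + al) h t + c.
  move=> at_; rewrite RLint_lin//; [|exact: e1|exact: e2].
  rewrite RLint_semigroup//; last exact: ltW.
  by rewrite (RLint_rlpow s10 ga0 at_) s1g /rlpow subrr powRr0 Gamma1 divr1 mulr1.
have VE' t s : s \in `]a, t] ->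
    RLint a s1 (fun t => RLint a al h t + c * rlpow ga t) s - c = RLint a (s1 + al) h s.
  by rewrite in_itv/= => /andP[as_ _]; rewrite VE// addrK.
have cV : continuous (RLint a (s1 + al) h) by exact: RLint_continuous.
split; first by move=> t /oc_gt at_; apply: RLint_exists_lin; [exact: e1|exact: e2].
exists c; split.
  have : RLint a (s1 + al) h t + c @[t --> a^'+] --> c.
    rewrite -[X in _ --> X]add0r; apply: cvgD; last exact: cvg_cst.
    by rewrite -(RLint_base a (s1 + al) h); apply: cvg_at_right_filter; exact: cV.
  apply: cvg_trans; apply: near_eq_cvg; near=> t; rewrite VE//.
have I2 t : a < t -> RLint_exists a s2 (fun r => RLint a s1 (fun t => RLint a al h t + c * rlpow ga t) r - c) t /\
    RLint a s2 (fun r => RLint a s1 (fun t => RLint a al h t + c * rlpow ga t) r - c) t = RLint a 1 h t.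
  move=> at_; have [e0 E0] := RLint_oc (RLint_exists_continuous a t s20 cV) (VE' t).
  split; first exact: e0.
  by have /andP[s1al0 _] := s1al; rewrite E0 (RLint_semigroup s20 s1al0 ch (ltW at_)) s12.
move=> t tab; have at_ := oc_gt tab; split; first by have [] := I2 t at_.
apply: has_deriv_within_RLint1 => //.
- by move=> s _; exact: RLint_exists_continuous.
- exact: ch.
- by move=> s /oc_gt /I2[].
Unshelve. all: by end_near. Qed.

(** Here [x] tends to [0] at [a], and so does its inner integral. By the
    semigroup law the two integrals of the Hilfer derivative compose to
    [I^(1 - al) x = I^1 w], where [w] is the claimed derivative. *)
Lemma is_Hilfer_integral_pow al be g c ka x : 0 < al < 1 -> 0 < be < 1 -> 0 < ka ->
  continuous g -> continuous x ->
  (forall t, t \in `]a, b] -> x t = RLint a al g t + c * rlpow (ka + al) t) ->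
  is_Hilfer a b al be x (fun t => g t + c * rlpow ka t).
Proof.
move=> al01 be01 ka0 cg cx xE.
have /andP[al0 al1] := al01; have /andP[be0 be1] := be01.
set s1 := (1 - be) * (1 - al); set s2 := be * (1 - al).
have s10 : 0 < s1 by rewrite mulr_gt0 ?subr_gt0.
have s20 : 0 < s2 by rewrite mulr_gt0 ?subr_gt0.
have s12 : s2 + s1 = 1 - al by rewrite /s1 /s2; ring.
have s1l : 0 < s1 < 1 by rewrite s10/=; lra.
have cV : continuous (RLint a s1 x) by exact: RLint_continuous.
have ew t : a < t -> RLint_exists a 1 (fun t => g t + c * rlpow ka t) t.
  move=> at_; apply: RLint_exists_lin; first exact: RLint_exists_continuous.
  exact: RLint_exists_rlpow.
have al1' : 0 < 1 - al by rewrite subr_gt0.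
have kal0 : 0 < ka + al by rewrite addr_gt0.
have E t : t \in `]a, b] -> RLint a s2 (fun r => RLint a s1 x r - 0) t =
    RLint a 1 (fun t => g t + c * rlpow ka t) t.
  move=> tab; have at_ := oc_gt tab; have at' := ltW at_.
  rewrite (_ : (fun r => _) = RLint a s1 x); last by apply/funext => r; rewrite subr0.
  rewrite RLint_semigroup// s12.
  have e1 := RLint_exists_comp al1' al0 cg at'.
  have e2 : RLint_exists a (1 - al) (rlpow (ka + al)) t by exact: RLint_exists_rlpow.
  have [|_ ->] := RLint_oc (u := x) (RLint_exists_lin c e1 e2).
    move=> s; rewrite in_itv/= => /andP[as_ st]; apply: xE; rewrite in_itv/= as_/=.
    by move: tab; rewrite in_itv/= => /andP[_]; exact: le_trans.
  rewrite (RLint_lin _ e1 e2) (RLint_semigroup al1' al0 cg at') (RLint_rlpow al1' kal0 at_).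
  rewrite subrK (RLint_lin _ (RLint_exists_continuous _ _ ltr01 cg) (RLint_exists_rlpow ltr01 ka0 at_)).
  rewrite (RLint_rlpow ltr01 ka0 at_); congr (_ + c * rlpow _ t).
  by ring.
split; first by move=> t _; exact: RLint_exists_continuous.
exists 0; split.
  by rewrite -(RLint_base a s1 x); apply: cvg_at_right_filter; exact: cV.
move=> t tab; split.
  apply: RLint_exists_continuous => // r.
  by apply: cvgB; [exact: cV|exact: cvg_cst].
apply: (has_deriv_within_RLint1 (w := fun t => g t + c * rlpow ka t)) => //.
have at_ := oc_gt tab.
apply: cvgD; first exact: cg.
by apply: cvgMl_tmp; exact: rlpow_continuous.
Qed.

End HilferInverse.

(** * Superposition operators and Volterra terms *)

Section ClippedField.
Variables (R : realType) (a b : R) (f : R -> R -> R -> R).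
Hypothesis ab : a < b.
Hypothesis cf : {within [set z : R * R * R | z.1.1 \in `[a, b]],
  continuous (fun z : R * R * R => f z.1.1 z.1.2 z.2)}.

Definition superposition (z : R -> R * R) (s : R) : R :=
  f (clip a b s) (z s).1 (z s).2.

Let clipped_cvg (T : Type) (F : set_system T) (FF : Filter F) (t : T -> R) (z : T -> R * R)
    (t0 : R) (z0 : R * R) :
  t n @[n --> F] --> t0 -> z n @[n --> F] --> z0 ->
  f (clip a b (t n)) (z n).1 (z n).2 @[n --> F] --> f (clip a b t0) z0.1 z0.2.
Proof.
move=> ct cz.
have c1 : clip a b (t n) @[n --> F] --> clip a b t0.
  by apply: cvg_comp ct _; exact: clip_continuous.
have c2 : (z n).1 @[n --> F] --> z0.1 by apply: cvg_comp cz _; exact: cvg_fst.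
have c3 : (z n).2 @[n --> F] --> z0.2 by apply: cvg_comp cz _; exact: cvg_snd.
pose A := [set z : R * R * R | z.1.1 \in `[a, b]].
have Ain s (w : R * R) : A ((clip a b s, w.1), w.2) by exact: (clip_in _ (ltW ab)).
have c4 : ((clip a b (t n), (z n).1), (z n).2) @[n --> F] -->
    ((clip a b t0, z0.1), z0.2) by exact: cvg_pair (cvg_pair c1 c2) c3.
have /subspace_continuousP/(_ _ (Ain t0 z0)) cf0 := cf.
have c5 : ((clip a b (t n), (z n).1), (z n).2) @[n --> F] -->
    within A (nbhs ((clip a b t0, z0.1), z0.2)).
  by move=> W /c4; apply: (@filterS _ F) => n H; apply: H; exact: (Ain (t n) (z n)).
exact: cvg_comp c5 cf0.
Qed.

Lemma superposition_continuous z : continuous z -> continuous (superposition z).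
Proof. by move=> cz s; apply: clipped_cvg; [exact: cvg_id|exact: cz]. Qed.

(** Heine's theorem for [f] on [a, b] x [-r, r]^2: counterexamples with
    arguments closer and closer to each other have a common limit, where [f] is
    continuous. *)
Lemma superposition_uniform (r e : R) : 0 < e -> exists2 d : R, 0 < d &
  forall z z' : R -> R * R, (forall t, `|z t| <= r) -> (forall t, `|z' t| <= r) ->
    (forall t, `|z t - z' t| <= d) ->
    forall t, `|superposition z t - superposition z' t| <= e.
Proof.
move=> e0; apply: contrapT => none.
have bad (n : nat) : exists q : R * (R * R) * (R * R),
    [/\ `|q.1.2| <= r, `|q.2| <= r, `|q.1.2 - q.2| <= n.+1%:R^-1 &
     e < `|f (clip a b q.1.1) q.1.2.1 q.1.2.2 - f (clip a b q.1.1) q.2.1 q.2.2|].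
  apply: contrapT => Hn; apply: none; exists (n.+1%:R^-1); first by rewrite invr_gt0.
  move=> z z' zr z'r zz' t; rewrite leNgt; apply/negP => lt_e; apply: Hn.
  by exists (t, z t, z' t); split => /=.
have [q qP] := choice bad.
have [U UU oU] := free_ultrafilter.
have PU : ProperFilter U by exact: ultra_proper.
have [|t0 ct] := @ultra_bounded_cvg R U UU (fun n => clip a b (q n).1.1) (`|a| + `|b|).
  move=> n; have := clip_in (q n).1.1 (ltW ab); rewrite in_itv/= => /andP[h1 h2].
  rewrite ler_norml; have := ler_norm (- a); have := ler_norm b; rewrite normrN.
  by have := normr_ge0 a; have := normr_ge0 b => ? ? ? ?; apply/andP; split; lra.
have [|z0 cz] := @ultra_bounded_cvg2 R U UU (fun n => (q n).1.2) r; first by move=> n; have [] := qP n.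
have cz' : (q n).2 @[n --> U] --> z0.
  have d0 : (q n).1.2 - (q n).2 @[n --> U] --> (0 : R * R).
    have h0 : n.+1%:R^-1 @[n --> U] --> (0 : R).
      by apply: cvg_trans (@cvg_harmonic R); apply: cvg_app.
    apply/cvgr0Pnorm_lt => d d0; have /cvgr0Pnorm_lt/(_ _ d0) := h0.
    apply: filterS => n; apply: le_lt_trans.
    have [_ _ H _] := qP n; exact: le_trans H (ler_norm _).
  have -> : (fun n => (q n).2) = (fun n => (q n).1.2 - ((q n).1.2 - (q n).2)).
    by apply/funext => n; rewrite subKr.
  by rewrite -[z0]subr0; exact: cvgB cz d0.
have FU : Filter U by exact: filter_filter.
pose D n := f (clip a b (clip a b (q n).1.1)) (q n).1.2.1 (q n).1.2.2 -
  f (clip a b (clip a b (q n).1.1)) (q n).2.1 (q n).2.2.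
have C0 : `|D n| @[n --> U] --> (0 : R).
  rewrite -[0](normr0 R) -[in X in _ --> X](subrr (f (clip a b t0) z0.1 z0.2)).
  exact: cvg_norm (cvgB (clipped_cvg FU ct cz) (clipped_cvg FU ct cz')).
suff : e <= 0 by rewrite leNgt e0.
apply: (cvgr_to_ge C0); apply: nearW => n; have [_ _ _ /ltW] := qP n.
by rewrite /D [clip a b (clip a b _)]clip_id// clip_in// ltW.
Qed.

End ClippedField.

Section VolterraPart.
Variables (R : realType) (a : R).
Implicit Types (A B lam t : R) (h x : R -> R).

(** Integrating [D^al1 (D^al2 + lam) x = h] twice gives this expression, for
    [A = al1 + al2] and [B = al2], up to a multiple of a power. Its integral of
    order [nu] has the same form with both orders raised by [nu]. *)
Definition rl_pair A B lam h x t : R := RLint a A h t - lam * RLint a B x t.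

Lemma rl_pair_norm A B lam h x t (H X : R) : 0 < A -> 0 < B -> a <= t ->
  continuous h -> continuous x -> (forall s, `|h s| <= H) -> (forall s, `|x s| <= X) ->
  `|rl_pair A B lam h x t| <= npow (t - a) A * H + `|lam| * npow (t - a) B * X.
Proof.
move=> A0 B0 at_ ch cx hH xX; apply: le_trans (ler_normB _ _) _.
rewrite (normrM lam); apply: lerD.
  by rewrite mulrC; apply: RLint_norm => //; exact: RLint_exists_continuous.
rewrite -mulrA ler_wpM2l// mulrC.
by apply: RLint_norm => //; exact: RLint_exists_continuous.
Qed.

Lemma rl_pairB A B lam h h' x x' t : 0 < A -> 0 < B ->
  continuous h -> continuous x -> continuous h' -> continuous x' ->
  rl_pair A B lam h x t - rl_pair A B lam h' x' t =
  rl_pair A B lam (fun s => h s - h' s) (fun s => x s - x' s) t.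
Proof.
move=> A0 B0 ch cx ch' cx'.
have linB C u v : 0 < C -> continuous u -> continuous v ->
    RLint a C (fun s => u s - v s) t = RLint a C u t - RLint a C v t.
  move=> C0 cu cv; rewrite -mulN1r.
  have := RLint_lin (-1) (RLint_exists_continuous a t C0 cu) (RLint_exists_continuous a t C0 cv).
  by move=> <-; apply: eq_RLint => s _; rewrite mulN1r.
by rewrite /rl_pair !linB//; ring.
Qed.

Lemma RLint_rl_pair nu A B lam h x t : 0 < nu -> 0 < A -> 0 < B -> a <= t ->
  continuous h -> continuous x ->
  RLint_exists a nu (rl_pair A B lam h x) t /\
  RLint a nu (rl_pair A B lam h x) t = rl_pair (nu + A) (nu + B) lam h x t.
Proof.
move=> nu0 A0 B0 at_ ch cx.
have e1 := RLint_exists_comp nu0 A0 ch at_; have e2 := RLint_exists_comp nu0 B0 cx at_.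
have E : rl_pair A B lam h x = (fun s => RLint a A h s + (- lam) * RLint a B x s).
  by apply/funext => s; rewrite mulNr.
rewrite E; split; first exact: RLint_exists_lin.
by rewrite (RLint_lin _ e1 e2) !RLint_semigroup// mulNr.
Qed.

Lemma eq_rl_pair A B lam h h' x x' t : (forall s, s \in `[a, t] -> h s = h' s) ->
  (forall s, s \in `[a, t] -> x s = x' s) ->
  rl_pair A B lam h x t = rl_pair A B lam h' x' t.
Proof. by move=> hh xx; rewrite /rl_pair (eq_RLint _ hh) (eq_RLint _ xx). Qed.

Lemma rl_pair_base A B lam h x : rl_pair A B lam h x a = 0.
Proof. by rewrite /rl_pair !RLint_base mulr0 subr0. Qed.

(** Writing the pair as an integral of order [al2 < 1] makes the Hoelder
    estimate available, although [al1 + al2] exceeds [1]. *)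
Lemma rl_pair_outer al1 al2 lam h x t : 0 < al1 < 1 -> 0 < al2 -> a <= t ->
  continuous h -> continuous x ->
  rl_pair (al1 + al2) al2 lam h x t =
  RLint a al2 (fun s => RLint a al1 h s - lam * x s) t.
Proof.
move=> al1P al20 at_ ch cx; have /andP[al10 _] := al1P.
have c1 : continuous (RLint a al1 h) by exact: RLint_continuous.
have := RLint_lin (- lam) (RLint_exists_continuous a t al20 c1) (RLint_exists_continuous a t al20 cx).
rewrite (RLint_semigroup al20 al10 ch at_) mulNr /rl_pair (addrC al2) => <-.
by apply: eq_RLint => s _; rewrite mulNr.
Qed.

Lemma rlpow_npow ka t : rlpow a ka t = npow (t - a) (ka - 1).
Proof. by rewrite /npow subrK. Qed.

Lemma rlpow_base ka : 1 < ka -> rlpow a ka a = 0.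
Proof. by move=> ka1; rewrite /rlpow subrr powR0 ?mul0r// subr_eq0 gt_eqF. Qed.

Lemma RLint_one ka t : 1 < ka -> a <= t -> rlpow a ka t = RLint a (ka - 1) (fun=> 1) t.
Proof.
move=> ka1; rewrite le_eqVlt => /predU1P[<-|at_]; first by rewrite RLint_base rlpow_base.
rewrite -{1}[ka](subrK 1) -RLint_rlpow ?subr_gt0//.
by apply: eq_RLint => s _; rewrite /rlpow subrr powRr0 Gamma1 divr1.
Qed.

Lemma RLint_rlpow_le nu ka t : 0 < nu -> 1 < ka -> a <= t ->
  RLint_exists a nu (rlpow a ka) t /\ RLint a nu (rlpow a ka) t = rlpow a (nu + ka) t.
Proof.
move=> nu0 ka1 at_; have ka0 : 0 < ka by exact: lt_trans ka1.
have k1 : 0 < ka - 1 by rewrite subr_gt0.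
have c1 : continuous (fun _ : R => 1 : R) by exact: cst_continuous.
split.
  apply: (@eq_RLint_exists _ _ _ (RLint a (ka - 1) (fun=> 1))).
    by move=> s; rewrite in_itv/= => /andP[as_ _]; rewrite RLint_one.
  exact: RLint_exists_comp.
move: at_; rewrite le_eqVlt => /predU1P[<-|at_]; last exact: RLint_rlpow.
by rewrite RLint_base rlpow_base// ltr_wpDl// ltW.
Qed.

End VolterraPart.

(** * The Volterra form of one equation *)

(** The system is symmetric under the exchange of its two equations. With this
    involution every statement about [y] is the one about [x] for the swapped
    data. *)
Definition swap_data (R : realType) (S : coupled_data R) : coupled_data R :=
  @CoupledData R (d_a S) (d_b S) (d_p1 S) (d_p2 S) (d_alpha1 S) (d_alpha2 S)
    (d_q1 S) (d_q2 S) (d_beta1 S) (d_beta2 S) (d_lambda2 S) (d_lambda1 S)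
    (d_m S) (@d_omega _ S) (@d_sigma _ S) (@d_xi _ S)
    (d_n S) (@d_mu _ S) (@d_nu _ S) (@d_eta _ S).

Lemma Lambda_swap (R : realType) (S : coupled_data R) : Lambda (swap_data S) = Lambda S.
Proof.
by rewrite /Lambda [Phi1 S * _]mulrC [Phi2 S * _]mulrC.
Qed.

Lemma standing_assumptions_swap (R : realType) (S : coupled_data R) :
  standing_assumptions S -> standing_assumptions (swap_data S).
Proof.
move=> [ab [[n0 m0] [[? [? [? ?]]] [[? [? [? ?]]] [[? ?] [hn [hm L]]]]]]].
by do !split => //; rewrite Lambda_swap.
Qed.

Section OneEquation.
Variables (R : realType) (S : coupled_data R).
Local Notation a := (d_a S).
Local Notation b := (d_b S).
Local Notation alpha1 := (d_alpha1 S).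
Local Notation alpha2 := (d_alpha2 S).
Local Notation p1 := (d_p1 S).
Local Notation p2 := (d_p2 S).
Local Notation ka := (gamma1 S + alpha2).
Implicit Types (c t H G X Y K : R) (h g x y : R -> R).

(** The part of [x b] that does not involve the constant of integration. *)
Definition end_value h x : R :=
  rl_pair a (alpha1 + alpha2) alpha2 (d_lambda1 S) h x b.

(** The part of the nonlocal condition on [x b] that does not involve the
    constant of integration of [y]. *)
Definition nonlocal_value g y : R :=
  \sum_(i < d_n S) d_mu i *
    rl_pair a (d_nu i + (p1 + p2)) (d_nu i + p2) (d_lambda2 S) g y (d_eta i).

Definition volterra c h x t : R :=
  c * rlpow a ka t + rl_pair a (alpha1 + alpha2) alpha2 (d_lambda1 S) h x t.

Definition end_bound H X : R :=
  npow (b - a) (alpha1 + alpha2) * H + `|d_lambda1 S| * npow (b - a) alpha2 * X.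

Definition nonlocal_bound G Y : R :=
  (\sum_(i < d_n S) `|d_mu i| * npow (d_eta i - a) (p1 + p2 + d_nu i)) * G +
  `|d_lambda2 S| * (\sum_(i < d_n S) `|d_mu i| * npow (d_eta i - a) (p2 + d_nu i)) * Y.

Hypothesis HS : standing_assumptions S.

Let ab : a < b. Proof. by case: HS => -[]. Qed.
Let al1 : 0 < alpha1 < 1. Proof. by case: HS => _ [_ [[]]]. Qed.
Let al2 : 0 < alpha2 < 1. Proof. by case: HS => _ [_ [[_ []]]]. Qed.
Let pp1 : 0 < p1 < 1. Proof. by case: HS => _ [_ [[_ [_ []]]]]. Qed.
Let pp2 : 0 < p2 < 1. Proof. by case: HS => _ [_ [[_ [_ []]]]]. Qed.
Let be1 : 0 < d_beta1 S < 1. Proof. by case: HS => _ [_ [_ [[]]]]. Qed.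
Let be2 : 0 < d_beta2 S < 1. Proof. by case: HS => _ [_ [_ [[_ []]]]]. Qed.
Let al12 : 1 < alpha1 + alpha2. Proof. by case: HS => _ [_ [_ [_ [[/andP[]]]]]]. Qed.
Let nu_eta (i : 'I_(d_n S)) : 0 < d_nu i /\ d_eta i \in `[a, b].
Proof. by case: HS => _ [_ [_ [_ [_ []]]]]. Qed.

Let al10 : 0 < alpha1. Proof. by case/andP: al1. Qed.
Let al20 : 0 < alpha2. Proof. by case/andP: al2. Qed.
Let p10 : 0 < p1. Proof. by case/andP: pp1. Qed.
Let p20 : 0 < p2. Proof. by case/andP: pp2. Qed.
Let p120 : 0 < p1 + p2. Proof. exact: addr_gt0. Qed.
Let al120 : 0 < alpha1 + alpha2. Proof. exact: addr_gt0. Qed.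
Let ga0 : alpha1 < gamma1 S.
Proof.
rewrite /gamma1 -addrA ltrDl; have /andP[b0 _] := be1; have /andP[_ a1] := al1.
have : 0 < d_beta1 S * (1 - alpha1) by rewrite mulr_gt0// subr_gt0.
by lra.
Qed.
Let ga1 : gamma1 S < 1.
Proof.
have /andP[b0 b1] := be1; have /andP[_ a1] := al1.
have : 0 < (1 - d_beta1 S) * (1 - alpha1) by rewrite mulr_gt0 ?subr_gt0.
by rewrite /gamma1; lra.
Qed.
Let ka1 : 1 < ka. Proof. by have := ga0; have := al12; lra. Qed.
Let ka2 : 0 < ka - 1 < 1.
Proof. by have := ka1; have := ga1; have /andP[_] := al2 => *; apply/andP; split; lra. Qed.

Lemma end_value_norm h x H X : continuous h -> continuous x ->
  (forall s, `|h s| <= H) -> (forall s, `|x s| <= X) ->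
  `|end_value h x| <= end_bound H X.
Proof. by move=> ch cx hH xX; apply: rl_pair_norm => //; exact: ltW. Qed.

Lemma nonlocal_value_norm g y G Y : continuous g -> continuous y ->
  (forall s, `|g s| <= G) -> (forall s, `|y s| <= Y) ->
  `|nonlocal_value g y| <= nonlocal_bound G Y.
Proof.
move=> cg cy gG yY; apply: le_trans (ler_norm_sum _ _ _) _.
rewrite /nonlocal_bound mulr_suml mulr_sumr mulr_suml -big_split/=.
apply: ler_sum => i _; rewrite normrM; have [nu0] := nu_eta i.
rewrite in_itv/= => /andP[ae _].
rewrite (addrC (p1 + p2)) (addrC p2); set A := _ + (p1 + p2); set B := _ + p2.
have A0 : 0 < A by exact: addr_gt0.
have B0 : 0 < B by exact: addr_gt0.
have := rl_pair_norm (d_lambda2 S) A0 B0 ae cg cy gG yY.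
move=> /(ler_wpM2l (normr_ge0 (d_mu i))) /le_trans; apply.
by rewrite le_eqVlt; apply/orP; left; apply/eqP; ring.
Qed.

Lemma end_valueB h h' x x' :
  continuous h -> continuous x -> continuous h' -> continuous x' ->
  end_value h x - end_value h' x' = end_value (fun s => h s - h' s) (fun s => x s - x' s).
Proof. by move=> *; exact: rl_pairB. Qed.

Lemma nonlocal_valueB h h' x x' :
  continuous h -> continuous x -> continuous h' -> continuous x' ->
  nonlocal_value h x - nonlocal_value h' x' =
  nonlocal_value (fun s => h s - h' s) (fun s => x s - x' s).
Proof.
move=> ch cx ch' cx'; rewrite /nonlocal_value -sumrB; apply: eq_bigr => i _.
have [nu0 _] := nu_eta i.
by rewrite -mulrBr rl_pairB// addr_gt0.
Qed.

Lemma rlpow_le t : t \in `[a, b] -> 0 <= rlpow a ka t <= Phi1 S.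
Proof.
rewrite in_itv/= => /andP[at_ tb]; have /andP[k0 _] := ka2.
rewrite rlpow_npow npow_ge0//= -[Phi1 S]/(rlpow a ka b) rlpow_npow.
by apply: npow_le => //; rewrite subr_ge0 at_ lerD2r.
Qed.

Lemma Phi1_gt0 : 0 < Phi1 S.
Proof.
by rewrite divr_gt0 ?powR_gt0 ?subr_gt0// Gamma_gt0//; exact: lt_trans ka1.
Qed.

Lemma PE : P S = Phi1 S / `|Lambda S|.
Proof. by rewrite /P /Phi1 invfM mulrA mulrAC. Qed.

Lemma volterra_norm c h x H X t : t \in `[a, b] -> continuous h -> continuous x ->
  (forall s, `|h s| <= H) -> (forall s, `|x s| <= X) ->
  `|volterra c h x t| <= `|c| * Phi1 S + end_bound H X.
Proof.
move=> tab ch cx hH xX; apply: le_trans (ler_normD _ _) _; apply: lerD.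
  have /andP[r0 r1] := rlpow_le tab.
  by rewrite normrM (ger0_norm r0) ler_wpM2l.
move: tab; rewrite in_itv/= => /andP[at_ tb].
apply: le_trans (rl_pair_norm _ _ _ at_ ch cx hH xX) _ => //.
have H0 : 0 <= H by exact: le_trans (hH 0).
have X0 : 0 <= X by exact: le_trans (xX 0).
have tab : 0 <= t - a <= b - a by rewrite subr_ge0 at_ lerD2r.
rewrite /end_bound; apply: lerD; apply: ler_wpM2r => //; first exact: npow_le al120 tab.
by apply: ler_wpM2l => //; exact: npow_le al20 tab.
Qed.

Lemma volterraB c c' h h' x x' t :
  continuous h -> continuous x -> continuous h' -> continuous x' ->
  volterra c h x t - volterra c' h' x' t =
  volterra (c - c') (fun s => h s - h' s) (fun s => x s - x' s) t.
Proof.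
move=> ch cx ch' cx'; rewrite /volterra -(rl_pairB _ _ _ al120 al20 ch cx ch' cx').
by ring.
Qed.

Lemma volterra_base c h x : volterra c h x a = 0.
Proof. by rewrite /volterra rl_pair_base rlpow_base// mulr0 addr0. Qed.

Lemma volterra_outer c h x t : a <= t -> continuous h -> continuous x ->
  volterra c h x t =
  RLint a alpha2 (fun s => RLint a alpha1 h s - d_lambda1 S * x s) t + c * rlpow a ka t.
Proof. by move=> at_ ch cx; rewrite /volterra rl_pair_outer// addrC. Qed.

Lemma inner_continuous h x : continuous h -> continuous x ->
  continuous (fun s => RLint a alpha1 h s - d_lambda1 S * x s).
Proof.
move=> ch cx t; apply: cvgB; first exact: RLint_continuous.
by apply: cvgMl_tmp; exact: cx.
Qed.

(** Both terms are fractional integrals of order below [1] of bounded functions: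
    the first by [volterra_outer], and the power as an integral of [1]. *)
Lemma volterra_equicontinuous K (e : R) : 0 < e -> exists2 d, 0 < d &
  forall c h x, `|c| <= K -> continuous h -> continuous x ->
  (forall s, `|h s| <= K) -> (forall s, `|x s| <= K) ->
  forall s t, s \in `[a, b] -> t \in `[a, b] -> `|s - t| <= d ->
  `|volterra c h x s - volterra c h x t| <= e.
Proof.
move=> e0; pose K' := Num.max K 0.
have K'0 : 0 <= K' by rewrite le_max lexx orbT.
pose M := npow (b - a) alpha1 * K' + `|d_lambda1 S| * K'.
have ab' : 0 <= b - a by rewrite subr_ge0 ltW.
have M0 : 0 <= M by rewrite addr_ge0// mulr_ge0// npow_ge0.
have e2 : 0 < e / 2 by rewrite divr_gt0.
have /andP[k0 k1] := ka2.
have [|d d0 Hd] := @npow_small R alpha2 (2 * M) _ al20 _ e2; first exact: mulr_ge0.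
have [|d' d'0 Hd'] := @npow_small R (ka - 1) (K' * 2) _ k0 _ e2; first exact: mulr_ge0.
exists (Num.min d d'); first by rewrite lt_min d0.
move=> c h x cK ch cx hK xK s t sab tab; rewrite le_min => /andP[sd sd'].
have KK : K <= K' by rewrite le_max lexx.
move: (sab) (tab); rewrite !in_itv/= => /andP[as_ sb] /andP[at_ tb].
have cg := inner_continuous ch cx.
have gM r : r \in `[a, b] -> `|RLint a alpha1 h r - d_lambda1 S * x r| <= M.
  rewrite in_itv/= => /andP[ar rb]; apply: le_trans (ler_normB _ _) _; rewrite lerD//.
    apply: (@le_trans _ _ (K' * npow (r - a) alpha1)).
      apply: RLint_norm => //; first exact: RLint_exists_continuous.
      by move=> u _; exact: le_trans (hK u) _.
    rewrite mulrC ler_wpM2r// npow_le//; first by rewrite subr_ge0 ar lerD2r.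
  by rewrite (normrM (d_lambda1 S)) ler_wpM2l//; exact: le_trans (xK r) _.
rewrite !volterra_outer// opprD addrACA -(mulrBr c).
apply: le_trans (ler_normD _ _) _; rewrite [e]splitr lerD//.
  apply: le_trans (RLint_hoelder_sym al2 (ltW ab) sb tb cg gM) _.
  apply: le_trans Hd; rewrite ler_wpM2l ?mulr_ge0// npow_le//.
  by rewrite normr_ge0.
rewrite !RLint_one// (normrM c).
have c1 : continuous (fun _ : R => 1 : R) by exact: cst_continuous.
have b1 r : r \in `[a, b] -> `|1 : R| <= 1 by rewrite normr1.
have := RLint_hoelder_sym ka2 (ltW ab) sb tb c1 b1; rewrite mulr1 => Ho.
apply: le_trans (ler_wpM2l (normr_ge0 _) Ho) _; apply: le_trans Hd'.
rewrite mulrA; apply: ler_pM => //.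
- exact: npow_ge0.
- by rewrite ler_wpM2r//; exact: le_trans cK _.
- by apply: npow_le => //; rewrite normr_ge0.
Qed.

Lemma RLint_volterra nu c h x t : 0 < nu -> a <= t -> continuous h -> continuous x ->
  RLint a nu (volterra c h x) t =
  c * rlpow a (nu + ka) t +
  rl_pair a (nu + (alpha1 + alpha2)) (nu + alpha2) (d_lambda1 S) h x t.
Proof.
move=> nu0 at_ ch cx.
have [e1 E1] := RLint_rlpow_le nu0 ka1 at_.
have [e2 E2] := RLint_rl_pair (d_lambda1 S) nu0 al120 al20 at_ ch cx.
rewrite -E1 -E2 addrC -RLint_lin//; apply: eq_RLint => s _.
by rewrite /volterra addrC.
Qed.

(** The inner derivative is [u = I^alpha1 h - lambda1 x + c rlpow gamma1], so that
    [u + lambda1 x] is exactly a function whose outer derivative is [h]. *)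
Lemma volterra_Hilfer c h x : continuous h -> continuous x ->
  (forall t, t \in `[a, b] -> x t = volterra c h x t) ->
  exists u, is_Hilfer a b alpha2 (d_beta2 S) x u /\
    is_Hilfer a b alpha1 (d_beta1 S) (fun t => u t + d_lambda1 S * x t) h.
Proof.
move=> ch cx xE; have cg := inner_continuous ch cx.
exists (fun t => (RLint a alpha1 h t - d_lambda1 S * x t) + c * rlpow a (gamma1 S) t).
split.
  apply: is_Hilfer_integral_pow => //; first exact: lt_trans ga0.
  move=> t tab; have at_ : a <= t by move: tab; rewrite in_itv/= => /andP[/ltW].
  rewrite xE ?volterra_outer//.
  by move: tab; rewrite !in_itv/= at_ => /andP[_ ->].
have := @is_Hilfer_integral_kernel R a b alpha1 (d_beta1 S) h c al1 be1 ch.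
congr (is_Hilfer a b _ _ _ _); apply/funext => t.
by rewrite /gamma1; ring.
Qed.

End OneEquation.

(** * The coupled system *)

Section BoundaryCoefficient.
Variables (R : realType) (S : coupled_data R).
Hypothesis HS : standing_assumptions S.
Local Notation S' := (swap_data S).
Implicit Types (H G X Y : R) (h g x y : R -> R).

Let HS' : standing_assumptions S'. Proof. exact: standing_assumptions_swap. Qed.

(** Cramer's rule for the constants of integration [c], [d] of the system
    formed by the two nonlocal conditions; see [coefficient_solve]. *)
Definition coefficient h g x y : R :=
  (Phi4 S * (nonlocal_value S g y - end_value S h x) +
   Phi2 S * (nonlocal_value S' h x - end_value S' g y)) / Lambda S.

Definition coefficient_bound H G X Y : R :=
  (`|Phi4 S| * (nonlocal_bound S G Y + end_bound S H X) +
   `|Phi2 S| * (nonlocal_bound S' H X + end_bound S' G Y)) / `|Lambda S|.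

Lemma coefficient_norm h g x y H G X Y :
  continuous h -> continuous g -> continuous x -> continuous y ->
  (forall s, `|h s| <= H) -> (forall s, `|g s| <= G) ->
  (forall s, `|x s| <= X) -> (forall s, `|y s| <= Y) ->
  `|coefficient h g x y| <= coefficient_bound H G X Y.
Proof.
move=> ch cg cx cy hH gG xX yY; rewrite normrM normfV ler_wpM2r ?invr_ge0//.
apply: le_trans (ler_normD _ _) _; rewrite !normrM; apply: lerD; apply: ler_wpM2l => //.
  apply: le_trans (ler_normB _ _) _; apply: lerD; first exact: nonlocal_value_norm.
  exact: end_value_norm.
apply: le_trans (ler_normB _ _) _; apply: lerD; first exact: (nonlocal_value_norm HS').
exact: (end_value_norm HS').
Qed.

Lemma coefficientB h g x y h' g' x' y' :
  continuous h -> continuous g -> continuous x -> continuous y ->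
  continuous h' -> continuous g' -> continuous x' -> continuous y' ->
  coefficient h g x y - coefficient h' g' x' y' =
  coefficient (fun s => h s - h' s) (fun s => g s - g' s)
              (fun s => x s - x' s) (fun s => y s - y' s).
Proof.
move=> ch cg cx cy ch' cg' cx' cy'; rewrite /coefficient.
rewrite -(nonlocal_valueB HS cg cy cg' cy') -(end_valueB HS ch cx ch' cx').
rewrite -(nonlocal_valueB HS' ch cx ch' cx') -(end_valueB HS' cg cy cg' cy').
by ring.
Qed.

(** This is where the constants [F1], [G1], [X1] and [Y1] come from: they are the
    coefficients of the bound on [volterra] when its constant of integration
    obeys the nonlocal condition. *)
Lemma coefficient_bound_affine H G X Y :
  coefficient_bound H G X Y * Phi1 S + end_bound S H X =
  F1 S * H + G1 S * G + X1 S * X + Y1 S * Y.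
Proof.
rewrite /coefficient_bound /F1 /G1 /X1 /Y1 PE /nonlocal_bound /end_bound /=.
move: (\sum_(i < d_n S) `|d_mu i| * npow (d_eta i - d_a S) (d_p1 S + d_p2 S + d_nu i)).
move: (\sum_(i < d_n S) `|d_mu i| * npow (d_eta i - d_a S) (d_p2 S + d_nu i)).
move: (\sum_(j < d_m S) `|d_omega j| * npow (d_xi j - d_a S) (d_alpha1 S + d_alpha2 S + d_sigma j)).
move: (\sum_(j < d_m S) `|d_omega j| * npow (d_xi j - d_a S) (d_alpha2 S + d_sigma j)).
move: (npow _ (d_alpha1 S + d_alpha2 S)) (npow _ (d_alpha2 S)) (npow _ (d_p1 S + d_p2 S)).
move: (npow _ (d_p2 S)) (Phi1 S) `|Phi2 S| `|Phi4 S| `|d_lambda1 S| `|d_lambda2 S|.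
by move=> *; ring.
Qed.

Lemma end_boundZ k : end_bound S k k = k * end_bound S 1 1.
Proof.
rewrite /end_bound; move: (npow _ (d_alpha1 S + d_alpha2 S)) (npow _ (d_alpha2 S)).
by move=> u v; ring.
Qed.

End BoundaryCoefficient.

Lemma nonlocal_boundZ (R : realType) (S : coupled_data R) (k : R) :
  nonlocal_bound S k k = k * nonlocal_bound S 1 1.
Proof. by rewrite /nonlocal_bound !mulr1 mulrDr; congr (_ + _); exact: mulrC. Qed.

Lemma coefficient_boundZ (R : realType) (S : coupled_data R) (k : R) :
  coefficient_bound S k k k k = k * coefficient_bound S 1 1 1 1.
Proof.
rewrite /coefficient_bound (nonlocal_boundZ S) (nonlocal_boundZ (swap_data S)).
rewrite (end_boundZ S) (end_boundZ (swap_data S)).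
move: (end_bound S 1 1) (end_bound _ 1 1) (nonlocal_bound S 1 1) (nonlocal_bound _ 1 1).
by move: `|Phi2 S| `|Phi4 S| => *; ring.
Qed.

Lemma coefficient_solve (R : realType) (S : coupled_data R) (h g x y : R -> R) :
  Lambda S != 0 ->
  coefficient S h g x y * Phi1 S - coefficient (swap_data S) g h y x * Phi2 S =
  nonlocal_value S g y - end_value S h x.
Proof.
move=> L0; rewrite /coefficient Lambda_swap.
have -> : Phi4 (swap_data S) = Phi1 S by [].
have -> : Phi2 (swap_data S) = Phi3 S by [].
have -> : nonlocal_value (swap_data (swap_data S)) g y = nonlocal_value S g y by [].
have -> : end_value (swap_data (swap_data S)) h x = end_value S h x by [].
move: L0; rewrite /Lambda => L0.
move: (nonlocal_value _ g y) (end_value _ h x) (nonlocal_value _ h x) (end_value _ g y) => ? ? ? ?.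
by field.
Qed.

Section SwappedConstants.
Variables (R : realType) (S : coupled_data R).

Lemma P_swap : P (swap_data S) = Q S. Proof. by rewrite /P Lambda_swap. Qed.
Lemma F1_swap : F1 (swap_data S) = G2 S. Proof. by rewrite /F1 P_swap. Qed.
Lemma G1_swap : G1 (swap_data S) = F2 S. Proof. by rewrite /G1 P_swap. Qed.
Lemma X1_swap : X1 (swap_data S) = Y2 S. Proof. by rewrite /X1 P_swap. Qed.
Lemma Y1_swap : Y1 (swap_data S) = X2 S. Proof. by rewrite /Y1 P_swap. Qed.
End SwappedConstants.

Lemma eq_is_Hilfer (R : realType) (a b al be : R) (v w w' : R -> R) :
  (forall t, t \in `]a, b] -> w t = w' t) ->
  is_Hilfer a b al be v w -> is_Hilfer a b al be v w'.
Proof.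
move=> ww [e [V0 [cV H]]]; split => //; exists V0; split => // t tab.
by rewrite -ww//; exact: H.
Qed.

Section CoupledFixedPoint.
Variables (R : realType) (S : coupled_data R).
Variables (f g : R -> R -> R -> R) (M1 M2 M3 N1 N2 N3 : R).
Local Notation a := (d_a S).
Local Notation b := (d_b S).
Local Notation S' := (swap_data S).
Hypothesis HS : standing_assumptions S.
Hypothesis cf : {within [set z : R * R * R | z.1.1 \in `[a, b]],
  continuous (fun z : R * R * R => f z.1.1 z.1.2 z.2)}.
Hypothesis cg : {within [set z : R * R * R | z.1.1 \in `[a, b]],
  continuous (fun z : R * R * R => g z.1.1 z.1.2 z.2)}.
Hypotheses (M20 : 0 <= M2) (M30 : 0 <= M3) (N20 : 0 <= N2) (N30 : 0 <= N3).
Hypothesis fM : forall t x y : R, t \in `[a, b] ->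
  `|f t x y| <= M1 + M2 * `|x| + M3 * `|y|.
Hypothesis gN : forall t x y : R, t \in `[a, b] ->
  `|g t x y| <= N1 + N2 * `|x| + N3 * `|y|.
Hypothesis HX : (F1 S + F2 S) * M2 + (G1 S + G2 S) * N2 + (X1 S + X2 S) < 1.
Hypothesis HY : (F1 S + F2 S) * M3 + (G1 S + G2 S) * N3 + (Y1 S + Y2 S) < 1.

Let HS' : standing_assumptions S'. Proof. exact: standing_assumptions_swap. Qed.
Let ab : a < b. Proof. by case: HS => -[]. Qed.

Let hf (z : R -> R * R) := superposition a b f z.
Let hg (z : R -> R * R) := superposition a b g z.

Let pr1 (z : R -> R * R) s := (z s).1.
Let pr2 (z : R -> R * R) s := (z s).2.

Definition fixed_point_map (p : R * R) (z : R -> R * R) (t : R) : R * R :=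
  (volterra S p.1 (hf z) (pr1 z) (clip a b t),
   volterra S' p.2 (hg z) (pr2 z) (clip a b t)).

Definition boundary_map (z : R -> R * R) : R * R :=
  (coefficient S (hf z) (hg z) (pr1 z) (pr2 z),
   coefficient S' (hg z) (hf z) (pr2 z) (pr1 z)).

Let cl_in t : clip a b t \in `[a, b]. Proof. by apply: clip_in; exact: ltW. Qed.

Let c1 z : continuous z -> continuous (pr1 z).
Proof. by move=> cz t; apply: cvg_comp (cz t) _; exact: cvg_fst. Qed.

Let c2 z : continuous z -> continuous (pr2 z).
Proof. by move=> cz t; apply: cvg_comp (cz t) _; exact: cvg_snd. Qed.

Let chf z : continuous z -> continuous (hf z).
Proof. exact: superposition_continuous. Qed.

Let chg z : continuous z -> continuous (hg z).
Proof. exact: superposition_continuous. Qed.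

Let hf_bound z (X Y : R) : (forall t, `|pr1 z t| <= X) -> (forall t, `|pr2 z t| <= Y) ->
  forall t, `|hf z t| <= M1 + M2 * X + M3 * Y.
Proof.
move=> zX zY t; apply: le_trans (fM _ _ (cl_in t)) _.
apply: lerD; last by apply: ler_wpM2l => //; exact: zY.
by rewrite lerD2l; apply: ler_wpM2l => //; exact: zX.
Qed.

Let hg_bound z (X Y : R) : (forall t, `|pr1 z t| <= X) -> (forall t, `|pr2 z t| <= Y) ->
  forall t, `|hg z t| <= N1 + N2 * X + N3 * Y.
Proof.
move=> zX zY t; apply: le_trans (gN _ _ (cl_in t)) _.
apply: lerD; last by apply: ler_wpM2l => //; exact: zY.
by rewrite lerD2l; apply: ler_wpM2l => //; exact: zX.
Qed.

Let pr_norm (z : R -> R * R) (r : R) : (forall t, `|z t| <= r) ->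
  (forall t, `|pr1 z t| <= r) /\ (forall t, `|pr2 z t| <= r).
Proof.
by move=> zr; split => t; apply: le_trans (zr t); rewrite prod_normE le_max lexx ?orbT.
Qed.

Let pair_norm (p : R * R) r : `|p| <= r -> `|p.1| <= r /\ `|p.2| <= r.
Proof. by rewrite prod_normE ge_max => /andP. Qed.

Let map_equicontinuous (r e : R) : 0 < e -> exists2 d : R, 0 < d &
  forall p (z : R -> R * R), continuous z -> `|p| <= r -> (forall t, `|z t| <= r) ->
  forall s t : R, `|s - t| <= d -> `|fixed_point_map p z s - fixed_point_map p z t| <= e.
Proof.
move=> e0; pose K := Num.max r (Num.max (M1 + M2 * r + M3 * r) (N1 + N2 * r + N3 * r)).
have [d d0 H] := volterra_equicontinuous HS K e0.
have [d' d'0 H'] := volterra_equicontinuous HS' K e0.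
exists (Num.min d d'); first by rewrite lt_min d0.
move=> p z cz /pair_norm[pr1' pr2'] zr s t; rewrite le_min => /andP[sd sd'].
have [z1 z2] := pr_norm zr.
have rK (u v : R) : u <= v -> v <= K -> u <= K by exact: le_trans.
have K1 : r <= K by rewrite le_max lexx.
have K2 : M1 + M2 * r + M3 * r <= K by rewrite !le_max lexx orbT.
have K3 : N1 + N2 * r + N3 * r <= K by rewrite !le_max lexx !orbT.
have cd := clip_dist a b s t.
rewrite prod_normE ge_max; apply/andP; split.
  apply: H => //; [exact: rK K1|exact: chf|exact: c1| | |exact: le_trans cd _].
    by move=> u; apply: rK K2; exact: hf_bound.
  by move=> u; exact: rK K1.
apply: H' => //; [exact: rK K1|exact: chg|exact: c2| | |exact: le_trans cd _].
  by move=> u; apply: rK K3; exact: hg_bound.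
by move=> u; exact: rK K1.
Qed.

Let boundary_bounded (r : R) : exists r' : R, forall z : R -> R * R, continuous z ->
  (forall t, `|z t| <= r) -> `|boundary_map z| <= r'.
Proof.
pose H := M1 + M2 * r + M3 * r; pose G := N1 + N2 * r + N3 * r.
exists (Num.max (coefficient_bound S H G r r) (coefficient_bound S' G H r r)).
move=> z cz /pr_norm[z1 z2].
have hH := hf_bound z1 z2; have gG := hg_bound z1 z2.
rewrite prod_normE ge_max !le_max; apply/andP; split; apply/orP; [left|right].
  by apply: coefficient_norm => //; [exact: chf|exact: chg|exact: c1|exact: c2].
by apply: coefficient_norm => //; [exact: chg|exact: chf|exact: c2|exact: c1].
Qed.

Let map_uniform (r e : R) : 0 < e -> exists2 d : R, 0 < d &
  forall p p' (z z' : R -> R * R), continuous z -> continuous z' ->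
  `|p| <= r -> `|p'| <= r -> (forall t, `|z t| <= r) -> (forall t, `|z' t| <= r) ->
  `|p - p'| <= d -> (forall t, `|z t - z' t| <= d) ->
  `|boundary_map z - boundary_map z'| <= e /\
  forall t, `|fixed_point_map p z t - fixed_point_map p' z' t| <= e.
Proof.
move=> e0.
pose A (T : coupled_data R) := coefficient_bound T 1 1 1 1.
pose B (T : coupled_data R) := Phi1 T + end_bound T 1 1.
have above (u v w x : R) : exists2 C, 0 < C & [/\ u <= C, v <= C, w <= C & x <= C].
  exists (Num.max 1 (Num.max u (Num.max v (Num.max w x)))); first by rewrite lt_max ltr01.
  by split; rewrite !le_max lexx ?orbT.
have [C C0 [AC AC' BC BC']] := above (A S) (A S') (B S) (B S').
pose k := e / C; have k0 : 0 < k by exact: divr_gt0.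
have kC (D : R) : D <= C -> k * D <= e.
  by move=> DC; rewrite -[leRHS](divfK (lt0r_neq0 C0)) ler_wpM2l// ltW.
have [d d0 Hf] := superposition_uniform ab cf r k0.
have [d' d'0 Hg] := superposition_uniform ab cg r k0.
exists (Num.min k (Num.min d d')); first by rewrite !lt_min k0 d0.
move=> p p' z z' cz cz' _ _ zr z'r; rewrite le_min => /andP[/pair_norm[pk1 pk2] _] zz.
have zzk t : `|z t - z' t| <= k by have := zz t; rewrite le_min => /andP[].
have zzd t : `|z t - z' t| <= d by have := zz t; rewrite !le_min => /and3P[].
have zzd' t : `|z t - z' t| <= d' by have := zz t; rewrite !le_min => /and3P[].
have hk s : `|hf z s - hf z' s| <= k by exact: Hf.
have gk s : `|hg z s - hg z' s| <= k by exact: Hg.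
have xk s : `|pr1 z s - pr1 z' s| <= k by have [] := pair_norm (zzk s).
have yk s : `|pr2 z s - pr2 z' s| <= k by have [] := pair_norm (zzk s).
have subc (u v : R -> R) : continuous u -> continuous v -> continuous (fun s => u s - v s).
  by move=> cu cv s; apply: cvgB; [exact: cu|exact: cv].
have [ch ch'] := (chf cz, chf cz'); have [cg1 cg'] := (chg cz, chg cz').
have [cx cx'] := (c1 cz, c1 cz'); have [cy cy'] := (c2 cz, c2 cz').
split.
  rewrite prod_normE ge_max /=; apply/andP; split.
    rewrite (coefficientB HS ch cg1 cx cy ch' cg' cx' cy').
    apply: le_trans (coefficient_norm HS (subc _ _ ch ch') (subc _ _ cg1 cg')
      (subc _ _ cx cx') (subc _ _ cy cy') hk gk xk yk) _.
    by rewrite coefficient_boundZ; exact: kC AC.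
  rewrite (coefficientB HS' cg1 ch cy cx cg' ch' cy' cx').
  apply: le_trans (coefficient_norm HS' (subc _ _ cg1 cg') (subc _ _ ch ch')
    (subc _ _ cy cy') (subc _ _ cx cx') gk hk yk xk) _.
  by rewrite coefficient_boundZ; exact: kC AC'.
move=> t; rewrite prod_normE ge_max /=; apply/andP; split.
  rewrite (volterraB HS _ _ _ ch cx ch' cx').
  apply: le_trans (volterra_norm HS _ (cl_in t) (subc _ _ ch ch') (subc _ _ cx cx') hk xk) _.
  have kB : k * B S <= e by exact: kC.
  apply: le_trans kB; rewrite /B [leRHS]mulrDr -(end_boundZ S); apply: lerD => //.
  by apply: ler_wpM2r; [exact: ltW (Phi1_gt0 HS)|exact: pk1].
rewrite (volterraB HS' _ _ _ cg1 cy cg' cy').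
apply: le_trans (volterra_norm HS' _ (cl_in t) (subc _ _ cg1 cg') (subc _ _ cy cy') gk yk) _.
have kB : k * B S' <= e by exact: kC.
apply: le_trans kB; rewrite /B [leRHS]mulrDr -(end_boundZ S'); apply: lerD => //.
by apply: ler_wpM2r; [exact: ltW (Phi1_gt0 HS')|exact: pk2].
Qed.

Let K := (F1 S + F2 S) * M1 + (G1 S + G2 S) * N1.
Let rho := Num.max ((F1 S + F2 S) * M2 + (G1 S + G2 S) * N2 + (X1 S + X2 S))
                   ((F1 S + F2 S) * M3 + (G1 S + G2 S) * N3 + (Y1 S + Y2 S)).

Let map_apriori p (z : R -> R * R) (X Y : R) : continuous z ->
  (forall t : R, `|(z t).1| <= X) -> (forall t : R, `|(z t).2| <= Y) ->
  `|p.1| <= `|(boundary_map z).1| -> `|p.2| <= `|(boundary_map z).2| ->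
  forall s t, `|(fixed_point_map p z s).1| + `|(fixed_point_map p z t).2| <= K + rho * (X + Y).
Proof.
move=> cz zX zY p1 p2 s t.
have X0 : 0 <= X by exact: le_trans (zX 0).
have Y0 : 0 <= Y by exact: le_trans (zY 0).
have hH := hf_bound zX zY; have gG := hg_bound zX zY.
set H := M1 + _ + _ in hH; set G := N1 + _ + _ in gG.
have [ch cg1 cx cy] : [/\ continuous (hf z), continuous (hg z), continuous (pr1 z) & continuous (pr2 z)].
  by split; [exact: chf|exact: chg|exact: c1|exact: c2].
have B1 : `|(fixed_point_map p z s).1| <= F1 S * H + G1 S * G + X1 S * X + Y1 S * Y.
  apply: le_trans (volterra_norm HS _ (cl_in s) ch cx hH zX) _.
  rewrite -coefficient_bound_affine lerD2r ler_wpM2r ?(ltW (Phi1_gt0 HS))//.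
  by apply: le_trans p1 _; exact: coefficient_norm.
have B2 : `|(fixed_point_map p z t).2| <= G2 S * G + F2 S * H + Y2 S * Y + X2 S * X.
  apply: le_trans (volterra_norm HS' _ (cl_in t) cg1 cy gG zY) _.
  rewrite -F1_swap -G1_swap -X1_swap -Y1_swap -coefficient_bound_affine.
  rewrite lerD2r ler_wpM2r ?(ltW (Phi1_gt0 HS'))//.
  by apply: le_trans p2 _; exact: coefficient_norm.
have RX : ((F1 S + F2 S) * M2 + (G1 S + G2 S) * N2 + (X1 S + X2 S)) * X <= rho * X.
  by rewrite ler_wpM2r// le_max lexx.
have RY : ((F1 S + F2 S) * M3 + (G1 S + G2 S) * N3 + (Y1 S + Y2 S)) * Y <= rho * Y.
  by rewrite ler_wpM2r// le_max lexx orbT.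
apply: le_trans (lerD B1 B2) _.
rewrite (mulrDr rho); apply: le_trans _ (lerD (lexx K) (lerD RX RY)).
rewrite /K /H /G; move: (F1 S) (F2 S) (G1 S) (G2 S) (X1 S) (X2 S) (Y1 S) (Y2 S) => *.
by rewrite le_eqVlt; apply/orP; left; apply/eqP; ring.
Qed.

(** The hypotheses [HX] and [HY] say that the a priori bound is contracting
    for the norm [sup |x| + sup |y|]. *)
Lemma coupled_fixed_point : exists z : R -> R * R, continuous z /\
  forall t, z t = fixed_point_map (boundary_map z) z t.
Proof.
apply: (@causal_fixed_point R a b fixed_point_map boundary_map ab _ _ _
  map_equicontinuous map_uniform boundary_bounded K rho _ map_apriori).
- by move=> p z t; rewrite /fixed_point_map [clip a b (clip a b t)]clip_id.
- move=> p z; have aab : a \in `[a, b] by rewrite in_itv/= lexx ltW.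
  by rewrite /fixed_point_map clip_id// (volterra_base HS) (volterra_base HS').
- move=> p z z' t tab zz; have hh s : s \in `[a, t] -> z s = z' s by exact: zz.
  rewrite /fixed_point_map clip_id// /volterra.
  by congr (_ + _, _ + _); apply: eq_rl_pair => s /hh;
    rewrite /hf /hg /pr1 /pr2 /superposition => ->.
- by rewrite gt_max HX HY.
Qed.

End CoupledFixedPoint.

Section Assembly.
Variables (R : realType) (S : coupled_data R).
Hypothesis HS : standing_assumptions S.
Local Notation a := (d_a S).
Local Notation b := (d_b S).
Implicit Types (c d t : R) (h g x y : R -> R).

Lemma nonlocal_condition c d h g x y :
  continuous h -> continuous g -> continuous x -> continuous y ->
  (forall t, t \in `[a, b] -> x t = volterra S c h x t) ->
  (forall t, t \in `[a, b] -> y t = volterra (swap_data S) d g y t) ->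
  c * Phi1 S - d * Phi2 S = nonlocal_value S g y - end_value S h x ->
  x b = \sum_(i < d_n S) d_mu i * RLint a (d_nu i) y (d_eta i).
Proof.
move=> ch cg cx cy xE yE cd.
have ab : a < b by case: HS => -[].
have nu_eta (i : 'I_(d_n S)) : 0 < d_nu i /\ d_eta i \in `[a, b].
  by case: HS => _ [_ [_ [_ [_ []]]]].
have -> : \sum_(i < d_n S) d_mu i * RLint a (d_nu i) y (d_eta i) =
    d * Phi2 S + nonlocal_value S g y.
  rewrite /Phi2 mulr_sumr -big_split/=; apply: eq_bigr => i _.
  have [nu0 ei] := nu_eta i; move: (ei); rewrite in_itv/= => /andP[ae eb].
  rewrite (@eq_RLint R _ _ _ (volterra (swap_data S) d g y)); last first.
    move=> s; rewrite in_itv/= => /andP[as_ se]; apply: yE.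
    by rewrite in_itv/= as_ (le_trans se).
  rewrite (RLint_volterra (standing_assumptions_swap HS))// mulrDr; congr (_ + _).
  rewrite /rlpow/= -/(delta1 S).
  have -> : gamma1 (swap_data S) = delta1 S by [].
  rewrite (addrC (d_nu i)); move: (Gamma _) => G; ring.
rewrite xE ?in_itv/= ?lexx ?(ltW ab)// /volterra -/(end_value S h x).
have -> : rlpow a (gamma1 S + d_alpha2 S) b = Phi1 S by [].
by rewrite -[c * _](subrK (d * Phi2 S)) cd; ring.
Qed.

End Assembly.

Theorem theorem3p1 (R : realType) (S : coupled_data R)
  (f g : R -> R -> R -> R) (M1 M2 M3 N1 N2 N3 : R) :
  standing_assumptions S ->
  {within [set z : R * R * R | z.1.1 \in `[d_a S, d_b S]],
     continuous (fun z : R * R * R => f z.1.1 z.1.2 z.2)} ->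
  {within [set z : R * R * R | z.1.1 \in `[d_a S, d_b S]],
     continuous (fun z : R * R * R => g z.1.1 z.1.2 z.2)} ->
  0 <= M1 -> 0 <= M2 -> 0 <= M3 -> 0 <= N1 -> 0 <= N2 -> 0 <= N3 ->
  (forall t x y : R, t \in `[d_a S, d_b S] ->
     `|f t x y| <= M1 + M2 * `|x| + M3 * `|y|) ->
  (forall t x y : R, t \in `[d_a S, d_b S] ->
     `|g t x y| <= N1 + N2 * `|x| + N3 * `|y|) ->
  (F1 S + F2 S) * M2 + (G1 S + G2 S) * N2 + (X1 S + X2 S) < 1 ->
  (F1 S + F2 S) * M3 + (G1 S + G2 S) * N3 + (Y1 S + Y2 S) < 1 ->
  exists x y : R -> R, is_solution S f g x y.
Proof.
move=> HS cf cg _ M20 M30 _ N20 N30 fM gN HX HY.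
have HS' := standing_assumptions_swap HS.
have [z [cz zE]] := coupled_fixed_point HS cf cg M20 M30 N20 N30 fM gN HX HY.
have ab : d_a S < d_b S by case: HS => -[].
have L0 : Lambda S != 0 by case: HS => _ [_ [_ [_ [_ [_ []]]]]].
have L0' : Lambda (swap_data S) != 0 by rewrite Lambda_swap.
pose x s := (z s).1; pose y s := (z s).2.
pose h := superposition (d_a S) (d_b S) f z.
pose k := superposition (d_a S) (d_b S) g z.
have cx : continuous x by move=> t; apply: cvg_comp (cz t) _; exact: cvg_fst.
have cy : continuous y by move=> t; apply: cvg_comp (cz t) _; exact: cvg_snd.
have ch : continuous h by exact: superposition_continuous.
have ck : continuous k by exact: superposition_continuous.
pose c := coefficient S h k x y; pose d := coefficient (swap_data S) k h y x.
have xE t : t \in `[d_a S, d_b S] -> x t = volterra S c h x t.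
  by move=> tab; rewrite {1}/x zE /= clip_id.
have yE t : t \in `[d_a S, d_b S] -> y t = volterra (swap_data S) d k y t.
  by move=> tab; rewrite {1}/y zE /= clip_id.
have aab : d_a S \in `[d_a S, d_b S] by rewrite in_itv/= lexx ltW.
have clE t : t \in `]d_a S, d_b S] -> clip (d_a S) (d_b S) t = t.
  by rewrite in_itv/= => /andP[/ltW at_ tb]; rewrite clip_id// in_itv/= at_.
have cd := coefficient_solve h k x y L0.
have dc : d * Phi1 (swap_data S) - c * Phi2 (swap_data S) =
    nonlocal_value (swap_data S) h x - end_value (swap_data S) k y.
  exact: (coefficient_solve k h y x L0').
exists x, y; split; first exact: continuous_subspaceT.
split; first exact: continuous_subspaceT.
split.
  have [u [Hu1 Hu2]] := volterra_Hilfer HS ch cx xE; exists u; split => //.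
  by apply: eq_is_Hilfer Hu2 => t tab; rewrite /h /superposition clE.
split.
  have [u [Hu1 Hu2]] := volterra_Hilfer HS' ck cy yE; exists u; split => //.
  by apply: eq_is_Hilfer Hu2 => t tab; rewrite /k /superposition clE.
split; split.
- by rewrite xE// (volterra_base HS).
- exact: (nonlocal_condition HS ch ck cx cy xE yE cd).
- by rewrite yE// (volterra_base HS').
- exact: (nonlocal_condition HS' ck ch cy cx yE xE dc).
Qed.
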